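(* Let $d\ge 2$, $\mu>-1$ and $s\in\mathbb{N}$. There is a constant $c>0$, depending only on $\mu$, $d$ and $s$, such that for every $f\in W_2^{2s}(\varpi_\mu,\mathbb{B}^d)$ and every integer $n\ge 2s$, $$E_n(f)_{\mu}\le \frac{c}{n^{2s}}\left[E_{n-2s}(\Delta^s f)_{\mu+2s}+E_n(\Delta_0^s f)_{\mu}\right].$$
   Context: $\mathbb{B}^d=\{x\in\mathbb{R}^d:\|x\|\le 1\}$ is the unit ball, $\varpi_\mu(x)=(1-\|x\|^2)^\mu$ for $\mu>-1$, and $\|f\|_\mu=\big(b_\mu\int_{\mathbb{B}^d}|f(x)|^2\varpi_\mu(x)\,dx\big)^{1/2}$ (with values in $[0,\infty]$), where $b_\mu=1/\int_{\mathbb{B}^d}\varpi_\mu(x)\,dx$. $\Pi_n^d$ is the space of polynomials of degree at most $n$ in $d$ variables, and $E_n(f)_\mu=\inf_{p\in\Pi_n^d}\|f-p\|_\mu$. For $s\in\mathbb{N}$, $W_2^s(\varpi_\mu,\mathbb{B}^d)$ is the Sobolev space of all $f\in L^2(\varpi_\mu,\mathbb{B}^d)$ with $\partial^{\mathbf m}f\in L^2(\varpi_{\mu+|\mathbf m|},\mathbb{B}^d)$ for all $\mathbf m\in\mathbb{N}_0^d$ with $|\mathbf m|=m_1+\dots+m_d\le s$, where $\partial^{\mathbf m}=\partial_1^{m_1}\cdots\partial_d^{m_d}$. $\Delta=\partial_1^2+\dots+\partial_d^2$, and $\Delta_0$ is the Laplace-Beltrami operator on the unit sphere $\mathbb{S}^{d-1}$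 acting on functions on the ball, i.e. $\Delta_0=\sum_{1\le i<j\le d}D_{i,j}^2$ with $D_{i,j}=x_i\partial_j-x_j\partial_i$; equivalently in spherical-polar coordinates $\Delta=\frac{d^2}{dr^2}+\frac{d-1}{r}\frac{d}{dr}+\frac1{r^2}\Delta_0$. *)

(* Defs.v *)
From HB Require Import structures.
From mathcomp Require Import all_boot all_order all_algebra.
From mathcomp Require Import all_classical all_reals all_analysis.
(* Not imported: the notations of mpoly clash with those of analysis. *)
From mathcomp Require multinomials.mpoly.

Set Implicit Arguments.
Unset Strict Implicit.
Unset Printing Implicit Defensive.

Import Order.TTheory GRing.Theory Num.Theory.
Import numFieldNormedType.Exports.

Local Open Scope classical_set_scope.
Local Open Scope ring_scope.

Definition measure_rV_display : measure_display. Proof. exact. Qed.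

(* The sigma-algebra on R^n is the one generated by the coordinates, as the
   library does for n.-tuple R; it is the Borel sigma-algebra of 'rV[R]_n. *)
Section measurable_rV.
Context {R : realType} (n : nat).

Let coors : 'I_n -> 'rV[R]_n -> R := fun i x => x 0 i.

Let rV_set0 : g_sigma_preimage coors set0.
Proof. exact: sigma_algebra0. Qed.

Let rV_setC A : g_sigma_preimage coors A -> g_sigma_preimage coors (~` A).
Proof. exact: sigma_algebraC. Qed.

Let rV_bigcup (F : _^nat) : (forall i, g_sigma_preimage coors (F i)) ->
  g_sigma_preimage coors (\bigcup_i (F i)).
Proof. exact: sigma_algebra_bigcup. Qed.

HB.instance Definition _ := @isMeasurable.Build measure_rV_display
  'rV[R]_n (g_sigma_preimage coors) rV_set0 rV_setC rV_bigcup.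

Lemma measurable_coord (i : 'I_n) :
  measurable_fun [set: 'rV[R]_n] (fun x : 'rV[R]_n => x 0 i).
Proof.
move=> _ Y mY; rewrite setTI; apply: sub_sigma_algebra => /=.
rewrite -bigcup_seq/=; exists i => /=; first by rewrite mem_index_enum.
by exists Y => //; rewrite setTI.
Qed.

Lemma measurable_fun_coordP d (T : measurableType d) (f : T -> 'rV[R]_n) :
  (forall i, measurable_fun [set: T] (fun t => f t 0 i)) ->
  measurable_fun [set: T] f.
Proof.
move=> mf.
have : g_sigma_preimage (fun i => coors i \o f) `<=` measurable.
  apply: smallest_sub; first exact: sigma_algebra_measurable.
  rewrite -bigcup_seq; apply: bigcup_sub => i _ A [B mB <-].
  exact: mf.
rewrite g_sigma_preimage_comp => prefS _ A mA; apply: prefS.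
by exists A.
Qed.

End measurable_rV.

Section lebesgue_rV.
Context {R : realType}.

Definition cons_rV (n : nat) (p : R * 'rV[R]_n) : 'rV[R]_n.+1 :=
  row_mx p.1%:M p.2.

Lemma cons_rV0 n (p : R * 'rV[R]_n) : cons_rV p 0 ord0 = p.1.
Proof.
rewrite /cons_rV -[ord0](_ : lshift n (0 : 'I_1) = _); last exact/val_inj.
by rewrite (row_mxEl p.1%:M p.2) mxE eqxx.
Qed.

Lemma cons_rVS n (p : R * 'rV[R]_n) j : cons_rV p 0 (lift ord0 j) = p.2 0 j.
Proof.
rewrite /cons_rV -[lift _ _](_ : rshift 1 j = _); last exact/val_inj.
exact: (row_mxEr p.1%:M p.2).
Qed.

Lemma measurable_cons_rV n : measurable_fun setT (@cons_rV n).
Proof.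
apply: measurable_fun_coordP => i.
case: (unliftP ord0 i) => [j|] ->.
  rewrite (_ : (fun t => _) = (fun x : 'rV[R]_n => x 0 j) \o snd).
    by apply: measurableT_comp => //; exact: measurable_coord.
  by apply/funext => t; rewrite cons_rVS.
rewrite (_ : (fun t => _) = fst); first exact: measurable_fst.
by apply/funext => t; rewrite cons_rV0.
Qed.

Section step.
Variables (n : nat) (m : {sigma_finite_measure set 'rV[R]_n -> \bar R}).

Definition lebesgue_step : set 'rV[R]_n.+1 -> \bar R :=
  pushforward (lebesgue_measure \x m)%E (@cons_rV n).

Let step0 : lebesgue_step set0 = 0%E.
Proof. by rewrite /lebesgue_step /pushforward preimage_set0 measure0. Qed.

Let step_ge0 A : (0 <= lebesgue_step A)%E.
Proof. by rewrite /lebesgue_step /pushforward; exact: measure_ge0. Qed.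

Let step_sigma_additive : semi_sigma_additive lebesgue_step.
Proof.
move=> F mF tF mUF.
have mpre A : measurable A -> measurable (@cons_rV n @^-1` A).
  by move=> mA; rewrite -[X in measurable X]setTI; exact: measurable_cons_rV.
rewrite /lebesgue_step /pushforward preimage_bigcup.
apply: measure_semi_sigma_additive.
- by move=> k; exact: mpre.
- apply/trivIsetP => /= i j _ _ ij; rewrite -preimage_setI.
  by move/trivIsetP : tF => /(_ _ _ _ _ ij) ->//; rewrite preimage_set0.
- by rewrite -preimage_bigcup; exact: mpre.
Qed.

HB.instance Definition _ := isMeasure.Build _ _ _ lebesgue_step
  step0 step_ge0 step_sigma_additive.

Let step_sigma_finite : sigma_finite setT lebesgue_step.
Proof.
pose uncons (y : 'rV[R]_n.+1) : R * 'rV[R]_n :=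
  (y 0 ord0, \row_j y 0 (lift ord0 j)).
have consK : cancel (@cons_rV n) uncons.
  case=> a x; rewrite /uncons cons_rV0; congr pair.
  by apply/rowP => j; rewrite mxE cons_rVS.
have muncons : measurable_fun setT uncons.
  apply/measurable_fun_pairP; split; first exact: measurable_coord.
  apply: measurable_fun_coordP => i.
  rewrite (_ : (fun t => _) = fun y : 'rV[R]_n.+1 => y 0 (lift ord0 i)).
    exact: measurable_coord.
  by apply/funext => y /=; rewrite mxE.
have /sigma_finiteP[F [TF ndF Foo]] := sigma_finiteT (@lebesgue_measure R).
have /sigma_finiteP[G [TG ndG Goo]] := sigma_finiteT m.
exists (fun k => uncons @^-1` (F k `*` G k)).
  rewrite -preimage_bigcup -[LHS](preimage_setT uncons); congr (_ @^-1` _).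
  rewrite -setXTT TF TG predeqE => -[x y]; split.
    move=> [/= [k _ Fkx] [l _ Gly]]; exists (maxn k l) => //; split.
    - by move: x Fkx; exact/subsetPset/ndF/leq_maxl.
    - by move: y Gly; exact/subsetPset/ndG/leq_maxr.
  by move=> [k _ []/= ? ?]; split; exists k.
move=> k; have [mF Fk] := Foo k; have [mG Gk] := Goo k; split.
  by rewrite -[X in measurable X]setTI; apply: muncons => //; exact: measurableX.
rewrite /lebesgue_step /pushforward -comp_preimage.
rewrite (_ : uncons \o _ = id); last by apply/funext => x /=; rewrite consK.
by rewrite preimage_id product_measure1E// lte_mul_pinfty// ge0_fin_numE.
Qed.

HB.instance Definition _ := Measure_isSigmaFinite.Build _ _ _ lebesgue_step
  step_sigma_finite.

End step.

(* Lebesgue measure on R^n, by recursion along R^n.+1 = R * R^n; lebesgue_rV_box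
   below gives its value on products of measurable sets. *)
Fixpoint lebesgue_rV (n : nat) : {sigma_finite_measure set 'rV[R]_n -> \bar R} :=
  match n with
  | 0 => @dirac _ 'rV[R]_0 (0 : 'rV[R]_0) R
  | k.+1 => lebesgue_step (lebesgue_rV k)
  end.

Lemma lebesgue_rV_box n (A : 'I_n -> set R) :
  (forall i, measurable (A i)) ->
  lebesgue_rV n [set x : 'rV[R]_n | forall i, A i (x 0 i)] =
  (\prod_(i < n) lebesgue_measure (A i))%E.
Proof.
elim: n A => [|n IH] A mA.
  rewrite big_ord0 /= diracE; rewrite mem_set//; first by case.
rewrite big_ord_recl -(IH (fun j => A (lift ord0 j)))//.
rewrite -product_measure1E; [|exact: mA|]; last first.
  have -> : [set x : 'rV[R]_n | forall i, A (lift ord0 i) (x 0 i)] =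
      \big[setI/setT]_(i < n) ((fun x : 'rV[R]_n => x 0 i) @^-1` A (lift ord0 i)).
    rewrite -bigcap_seq; apply/seteqP; split => x Ax i; first by move=> _; exact: Ax.
    by apply: (Ax i); rewrite /= mem_index_enum.
  apply: bigsetI_measurable => i _.
  by rewrite -[X in measurable X]setTI; exact: measurable_coord.
rewrite /= /lebesgue_step /pushforward.
congr (product_measure1 _ _ _).
apply/seteqP; split => -[a x] /=.
  move=> Aax; split => [|i]; first by have := Aax ord0; rewrite cons_rV0.
  by have := Aax (lift ord0 i); rewrite cons_rVS.
move=> [Aa Ax] i; case: (unliftP ord0 i) => [j|] ->.
  by rewrite cons_rVS; exact: Ax.
by rewrite cons_rV0.
Qed.
End lebesgue_rV.

(* Functions on the closed unit ball are represented by functions on R^d, of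
   which only the values on the ball are ever used. The norm of 'rV[R]_d in the
   library is the sup norm, hence the explicit Euclidean norm below. *)
Section best_approximation_on_the_ball.
Context {R : realType} {d : nat}.
Local Notation E := 'rV[R]_d.
Local Notation leb := (lebesgue_rV d).
Implicit Types (f g phi : E -> R) (m : 'I_d -> nat) (i j : 'I_d) (mu : R).

Definition sqnorm2 (x : E) : R := \sum_i x 0 i ^+ 2.

Definition enorm2 (x : E) : R := Num.sqrt (sqnorm2 x).

Definition unit_ball : set E := [set x | enorm2 x <= 1].
Definition open_unit_ball : set E := [set x | enorm2 x < 1].

Definition weight mu (x : E) : R := (1 - enorm2 x ^+ 2) `^ mu.

Definition weight_const mu : R := (\int[leb]_(x in unit_ball) weight mu x)^-1.

Definition wnorm mu f : \bar R :=
  (((weight_const mu)%:E *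
    \int[leb]_(x in unit_ball) (`|f x| ^+ 2 * weight mu x)%:E) `^ 2^-1)%E.

Definition in_L2 mu f : Prop :=
  measurable_fun unit_ball f /\ (wnorm mu f < +oo)%E.

(* Pi_n^d, as functions: every monomial of p has total degree at most n. *)
Definition polys_deg_le (n : nat) : set (E -> R) :=
  [set (fun x : E => mpoly.meval (x 0) p) | p in
    [set p : mpoly.mpoly d R |
      all (fun a => mpoly.mdeg a <= n)%N (mpoly.msupp p)]].

Definition best_approx (n : nat) mu f : \bar R :=
  ereal_inf [set wnorm mu (f \- q) | q in polys_deg_le n].

Definition partial i phi : E -> R := fun x => 'D_(delta_mx 0 i) phi x.

(* d_1^(m 0) o ... o d_d^(m (d-1)) for the classical partial derivatives *)
Definition partial_mi m phi : E -> R :=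
  foldr (fun i => iter (m i) (partial i)) phi (enum 'I_d).

(* C^infty functions with compact support in the open unit ball *)
Definition test_function phi : Prop :=
  (forall (l : seq 'I_d) (x : E), differentiable (foldr partial phi l) x) /\
  exists2 K : set E, compact K /\ K `<=` open_unit_ball &
    forall x, ~ K x -> phi x = 0.

Definition locally_integrable_ball f : Prop :=
  measurable_fun unit_ball f /\
  forall K : set E, compact K -> K `<=` open_unit_ball ->
    leb.-integrable K (EFin \o f).

Definition mi_size m : nat := (\sum_i m i)%N.

Definition is_weak_derivative m f g : Prop :=
  [/\ locally_integrable_ball f, locally_integrable_ball g &
   forall phi, test_function phi ->
     \int[leb]_(x in unit_ball) (f x * partial_mi m phi x) =
     (-1) ^+ mi_size m * \int[leb]_(x in unit_ball) (g x * phi x)].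

Definition sobolev (s : nat) mu f : Prop :=
  in_L2 mu f /\
  forall m, (mi_size m <= s)%N ->
    exists2 g, is_weak_derivative m f g & in_L2 (mu + (mi_size m)%:R) g.

(* A chosen weak partial derivative: it is unique up to a null set when it
   exists, and cst 0 is a junk value. Existence is never tested with wpartial:
   sobolev asserts it explicitly. *)
Definition wpartial i f : E -> R :=
  xget (cst 0) [set g | is_weak_derivative (fun j => (j == i) : nat) f g].

Definition laplacian f : E -> R :=
  fun x => \sum_i wpartial i (wpartial i f) x.

(* D_(i,j) = x_i d_j - x_j d_i *)
Definition angular i j f : E -> R :=
  fun x => x 0 i * wpartial j f x - x 0 j * wpartial i f x.

Definition laplace_beltrami f : E -> R :=
  fun x => \sum_(i < d) \sum_(j < d | (i < j)%N) angular i j (angular i j f) x.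

End best_approximation_on_the_ball.

(* Main.v *)
From HB Require Import structures.
From mathcomp Require Import all_boot all_order all_algebra.
From mathcomp Require Import all_classical all_reals all_analysis.
From mathcomp Require Import -(notations) multinomials.mpoly.
From mathcomp Require Import measurable_realfun ring lra zify.
Require Import Defs.
Set Implicit Arguments.
Unset Strict Implicit.
Unset Printing Implicit Defensive.
Import Order.TTheory GRing.Theory Num.Theory.
Import numFieldNormedType.Exports.
Local Open Scope classical_set_scope.
Local Open Scope ring_scope.

(** Write L for the Laplacian, S for the Laplace-Beltrami operator, t for
    1 - |x|^2 and <p, q>_nu for the integral of p q t^nu over the ball.

    The heart of the matter is algebraic. Let p have degree k and be orthogonal,
    for t^nu, to all polynomials of lower degree. Since S is symmetric and does
    not raise degrees, S p is of the same kind, and since the adjoint of L from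
    t^nu to t^(nu+2) raises degrees by 2, L p is of the same kind with k - 2
    and nu + 2. Up to terms of lower degree, the adjoint of L composed with L is
    (al + S)(be + S), where al and be are comparable to k^2
    [lapstar_lap_top], so that
      |L p|^2 = al be |p|^2 + (al + be) <p, S p> + |S p|^2.
    The middle term is the only one that can be negative, and Cauchy-Schwarz
    bounds it by |p| |S p|. Hence k^4 |p|^2 is at most C (|L p|^2 + |S p|^2):
    where L loses its strength, S has the full size k^2. As L and S commute this
    can be iterated, and log-convexity of the norms of the powers of S removes
    the mixed products L^a S^b [double_interpolate]. The result is
      k^(4s) |p|^2 <= C (|L^s p|^2 + |S^s p|^2)    [orth_space_bound],
    and by orthogonality it holds with n in place of k for every polynomial
    orthogonal to those of degree at most n [orth_bound].

    Let now f be in the Sobolev space, let p and pK be its orthogonal projections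
    on the polynomials of degree at most n and less than K, and h = pK - p. Moving
    the derivatives to the polynomial side, L^s h and S^s h are projections of
    L^s f and S^s f on polynomials orthogonal to those of degree n - 2s and n.
    They are therefore no longer than L^s f - q and S^s f - r, whatever the
    polynomials q and r of these degrees are [projection_gap_bound]. The
    algebraic estimate bounds h, and f - pK tends to 0 because polynomials are
    dense [L2_approximable].

    To move the derivatives, a polynomial times a power of t has to be used as a
    test function, though it does not vanish near the sphere. It is approximated
    by combinations of polynomials times u^b exp (- e / u), u = t - e, which are
    smooth with compact support in the open ball. Differentiation preserves these
    combinations, and as e tends to 0 all the terms created by the exponential
    disappear [eval_terms_limit]. *)

(** * Differential operators on polynomials *)
Section differential_operators.
Variables (R : realFieldType) (d : nat).
Local Notation P := (mpoly d R).
Implicit Types (p q : P) (i j : 'I_d) (b c : R).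

Definition xvar i : P := mpolyX R (mnm1 i).
Definition rsq : P := \sum_i xvar i ^+ 2.
Definition euler p : P := \sum_i xvar i * mderiv i p.
Definition lap p : P := \sum_i mderiv i (mderiv i p).
(** The derivative along the rotations of the plane (x_i, x_j). *)
Definition drot i j p : P := xvar i * mderiv j p - xvar j * mderiv i p.
Definition sphlap p : P := \sum_(i < d) \sum_(j < d | (i < j)%N) drot i j (drot i j p).
(** With t = 1 - |x|^2, this is t^(1-b) d_j (t^b q): up to sign, the adjoint of
    d_j from the weight t^(b-1) to the weight t^b. *)
Definition dstar b j q : P :=
  (1 - rsq) * mderiv j q - mpolyC d (2 * b) * (xvar j * q).
(** t^(2-b) times the Laplacian of t^b q. *)
Definition lapstar b q : P := \sum_j dstar (b - 1) j (dstar b j q).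

Lemma lap_is_linear : linear lap.
Proof.
move=> c p q; rewrite /lap scaler_sumr -big_split /=.
by apply: eq_bigr => i _; rewrite !linearP.
Qed.
HB.instance Definition _ := GRing.isLinear.Build R P P _ lap lap_is_linear.

Lemma euler_is_linear : linear euler.
Proof.
move=> c p q; rewrite /euler scaler_sumr -big_split /=.
by apply: eq_bigr => i _; rewrite !linearP mulrDr scalerAr.
Qed.
HB.instance Definition _ := GRing.isLinear.Build R P P _ euler euler_is_linear.

Lemma drot_is_linear i j : linear (drot i j).
Proof.
move=> c p q; rewrite /drot !linearP /= -!mul_mpolyC. ring.
Qed.
HB.instance Definition _ i j := GRing.isLinear.Build R P P _ (drot i j) (drot_is_linear i j).

Lemma sphlap_is_linear : linear sphlap.
Proof.
move=> c p q; rewrite /sphlap scaler_sumr -big_split /=; apply: eq_bigr => i _.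
rewrite scaler_sumr -big_split /=; apply: eq_bigr => j _.
by rewrite !linearP.
Qed.
HB.instance Definition _ := GRing.isLinear.Build R P P _ sphlap sphlap_is_linear.

Lemma dstar_is_linear b j : linear (dstar b j).
Proof.
move=> c p q; rewrite /dstar !linearP /= -!mul_mpolyC; ring.
Qed.
HB.instance Definition _ b j := GRing.isLinear.Build R P P _ (dstar b j) (dstar_is_linear b j).

Lemma lapstar_is_linear b : linear (lapstar b).
Proof.
move=> c p q; rewrite /lapstar scaler_sumr -big_split /=.
by apply: eq_bigr => i _; rewrite !linearP.
Qed.
HB.instance Definition _ b := GRing.isLinear.Build R P P _ (lapstar b) (lapstar_is_linear b).

Lemma mderiv_xvar i j : mderiv i (xvar j) = (i == j)%:R.
Proof.
rewrite /xvar mderivX mnm1E eq_sym; case: eqP => [->|_]; last by rewrite scale0r.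
by rewrite -{1}[mnm1 j]add0m addmK mpolyX0 scale1r.
Qed.

Lemma mderiv_xvar_diag i : mderiv i (xvar i) = 1.
Proof. by rewrite mderiv_xvar eqxx. Qed.

Lemma mderiv_nat i n : mderiv i (n%:R : P) = 0.
Proof. by rewrite -mpolyC_nat mderivC. Qed.

Lemma mderiv_one i : mderiv i (1 : P) = 0.
Proof. exact: (mderiv_nat i 1). Qed.

Lemma mderiv_rsq i : mderiv i rsq = 2 * xvar i.
Proof.
rewrite /rsq linear_sum /= (bigD1 i) //= big1 ?addr0.
  by rewrite expr2 mderivM mderiv_xvar_diag; ring.
by move=> j ji; rewrite expr2 mderivM mderiv_xvar eq_sym (negbTE ji) /=; ring.
Qed.

Lemma euler_mderiv i p : euler (mderiv i p) = mderiv i (euler p) - mderiv i p.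
Proof.
rewrite /euler linear_sum /=.
under [in RHS]eq_bigr do rewrite mderivM mderiv_xvar (mderiv_comm _ i).
rewrite big_split /=.
have -> : \sum_j (i == j)%:R * mderiv j p = mderiv i p.
  rewrite (bigD1 i) //= big1 ?addr0 ?eqxx ?mul1r // => j ji.
  by rewrite eq_sym (negbTE ji) mul0r.
by rewrite addrAC subrr add0r.
Qed.

Lemma lap_euler p : lap (euler p) = euler (lap p) + 2 * lap p.
Proof.
rewrite {3}/lap /lap linear_sum /= mulr_sumr -big_split /=; apply: eq_bigr => i _.
rewrite !euler_mderiv !linearB /=; ring.
Qed.

Lemma lap_rsq p : lap (rsq * p) = rsq * lap p + 4 * euler p + (2 * d%:R) * p.
Proof.
rewrite /lap /euler !mulr_sumr.
have -> : 2 * d%:R * p = \sum_(i < d) (2 * p).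
  by rewrite sumr_const card_ord -mulr_natl; ring.
rewrite -!big_split /=; apply: eq_bigr => i _.
have E2 : mderiv i (2 : P) = 0 by exact: mderiv_nat.
rewrite mderivM mderiv_rsq linearD /= !mderivM mderiv_rsq mderiv_xvar_diag E2; ring.
Qed.

Lemma eulerM p q : euler (p * q) = euler p * q + p * euler q.
Proof.
rewrite /euler mulr_suml mulr_sumr -big_split /=; apply: eq_bigr => i _.
rewrite mderivM; ring.
Qed.

Lemma euler_rsq : euler rsq = 2 * rsq.
Proof.
rewrite /euler {2}/rsq mulr_sumr; apply: eq_bigr => i _; rewrite mderiv_rsq; ring.
Qed.

Lemma drot_diag i p : drot i i p = 0.
Proof. by rewrite /drot subrr. Qed.

Lemma drotC i j p : drot j i p = - drot i j p.
Proof. by rewrite /drot opprB. Qed.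

(** Summing over ordered pairs instead of pairs i < j doubles the sum and
    makes it separate in i and j. This form expresses the Laplace-Beltrami
    operator through |x|^2, the Laplacian and the Euler operator, whose
    commutators are simple. *)
Lemma sphlapE p :
  sphlap p = rsq * lap p - euler (euler p) - (d%:R - 2) * euler p.
Proof.
pose S i j := drot i j (drot i j p).
have SC i j : S i j = S j i.
  by rewrite /S (drotC j i) (drotC j i p) raddfN /= opprK.
have S0 i : S i i = 0 by rewrite /S drot_diag.
have E2 : 2 * sphlap p = \sum_i \sum_j S i j.
  transitivity (sphlap p + \sum_(i < d) \sum_(j < d | (j < i)%N) S i j).
    rewrite (exchange_big_dep predT) //=.
    under [X in _ + X]eq_bigr do under eq_bigr do rewrite SC.
    by rewrite -/(sphlap p); ring.
  rewrite /sphlap -big_split /=; apply: eq_bigr => i _.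
  rewrite [RHS](bigID (fun j => (i < j)%N)) /=; congr (_ + _).
  rewrite [RHS](bigD1 i) ?ltnn //= S0 add0r; apply: eq_bigl => j.
  by rewrite -leqNgt ltn_neqAle andbC.
have S_E i j : S i j = xvar i ^+ 2 * mderiv j (mderiv j p)
    + xvar j ^+ 2 * mderiv i (mderiv i p)
    - 2 * (xvar i * (xvar j * mderiv j (mderiv i p)))
    - xvar i * mderiv i p - xvar j * mderiv j p
    + (i == j)%:R * (2 * (xvar i * mderiv i p)).
  rewrite /S /drot !linearB /= !mderivM !mderiv_xvar !eqxx (mderiv_comm i j p) (eq_sym j i).
  by case: (eqVneq i j) => [->|_] /=; ring.
have EE : euler (euler p) = euler p + \sum_i \sum_j xvar i * (xvar j * mderiv j (mderiv i p)).
  rewrite {1}/euler -big_split /=; apply: eq_bigr => i _.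
  rewrite -mulr_sumr -/(euler (mderiv i p)) euler_mderiv; ring.
have sumC (F : 'I_d -> P) : \sum_(i < d) \sum_(j < d) F i = d%:R * \sum_i F i.
  rewrite mulr_sumr; apply: eq_bigr => i _.
  by rewrite sumr_const card_ord mulr_natl.
have two_inj : injective ( *%R (2 : P)).
  move=> x y /= /(congr1 (fun z => mpolyC d (2^-1 : R) * z)).
  rewrite !mulrA -(mpolyC_nat d R 2) -mpolyCM mulVf ?pnatr_eq0 // mpolyC1.
  by rewrite !mul1r.
apply: two_inj => /=; rewrite E2.
under eq_bigr do under eq_bigr do rewrite S_E.
under eq_bigr do rewrite !(sumrB, big_split) /=.
rewrite !(sumrB, big_split) /=.
have -> : \sum_i \sum_j xvar i ^+ 2 * mderiv j (mderiv j p) = rsq * lap p.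
  by rewrite /rsq mulr_suml; apply: eq_bigr => i _; rewrite -mulr_sumr.
have -> : \sum_i \sum_j xvar j ^+ 2 * mderiv i (mderiv i p) = rsq * lap p.
  by rewrite mulr_sumr; apply: eq_bigr => i _; rewrite -mulr_suml.
have -> : \sum_i \sum_j (i == j)%:R * (2 * (xvar i * mderiv i p)) = 2 * euler p.
  rewrite mulr_sumr; apply: eq_bigr => i _.
  rewrite (bigD1 i) //= big1 ?addr0 ?eqxx ?mul1r // => j ji.
  by rewrite eq_sym (negbTE ji) mul0r.
have -> : \sum_i \sum_j 2 * (xvar i * (xvar j * mderiv j (mderiv i p))) =
    2 * (euler (euler p) - euler p).
  rewrite EE addrAC subrr add0r mulr_sumr; apply: eq_bigr => i _.
  by rewrite mulr_sumr.
have -> : \sum_(i < d) \sum_(j < d) xvar i * mderiv i p = d%:R * euler p.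
  exact: sumC.
have -> : \sum_(i < d) \sum_(j < d) xvar j * mderiv j p = d%:R * euler p.
  by rewrite exchange_big sumC.
ring.
Qed.

Lemma lap_sphlap p : lap (sphlap p) = sphlap (lap p).
Proof.
have mulD n q : lap (n%:R * q) = n%:R * lap q by rewrite !mulr_natl raddfMn.
rewrite !sphlapE !raddfB /= lap_rsq !lap_euler.
have -> : lap ((d%:R - 2) * euler p) = (d%:R - 2) * lap (euler p).
  by rewrite mulrBl raddfB /= !mulD -mulrBl.
rewrite ?raddfD /= !lap_euler ?raddfD /=.
have -> : euler (2 * lap p) = 2 * euler (lap p) by rewrite !mulr_natl raddfMn.
ring.
Qed.

Lemma sphlap_rsq p : sphlap (rsq * p) = rsq * sphlap p.
Proof.
rewrite !sphlapE lap_rsq !eulerM euler_rsq raddfD /= !eulerM euler_rsq.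
have -> : euler (2 : P) = 0.
  by rewrite /euler big1 // => i _; rewrite mderiv_nat mulr0.
ring.
Qed.

Lemma lapstarE b q : lapstar b q = (1 - rsq) ^+ 2 * lap q
  - mpolyC d (4 * b) * ((1 - rsq) * euler q)
  - mpolyC d (2 * b * d%:R) * ((1 - rsq) * q)
  + mpolyC d (4 * b * (b - 1)) * (rsq * q).
Proof.
rewrite /lapstar /lap /euler {3}/rsq mulr_sumr !mulr_suml !mulr_sumr.
have -> : mpolyC d (2 * b * d%:R) * ((1 - rsq) * q) =
    \sum_(j < d) mpolyC d (2 * b) * ((1 - rsq) * q).
  by rewrite sumr_const card_ord mpolyCM mpolyC_nat -mulr_natl; ring.
rewrite -!(sumrB, big_split) /=; apply: eq_bigr => j _.
rewrite /dstar !linearB /= !mderivM !mderivC !linearB /= mderiv_one mderiv_rsq.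
rewrite mderiv_xvar_diag !(mpolyCM, mpolyCB, mpolyCD, mpolyC1, mpolyC_nat).
ring.
Qed.

End differential_operators.

(** * Degrees, and the operators modulo lower degree *)
Section degree.
Variables (R : realFieldType) (d : nat).
Local Notation P := (mpoly d R).
Implicit Types (p q : P) (i j : 'I_d) (b c : R) (k : nat).

(** The strict bound makes the zero polynomial the only one for k = 0. *)
Definition deg_lt k p : Prop := forall m, (k <= mdeg m)%N -> mcoeff m p = 0.

Lemma deg_lt_msupp k p : deg_lt k.+1 p <-> all (fun m => mdeg m <= k)%N (msupp p).
Proof.
split=> [h|/allP h m km].
  apply/allP => m; rewrite mcoeff_msupp => pm; rewrite leqNgt; apply/negP => km.
  by rewrite h // eqxx in pm.
by apply/eqP/negPn/negP; rewrite -mcoeff_msupp => /h; rewrite leqNgt km.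
Qed.

Lemma deg_lt_exists p : exists k, deg_lt k p.
Proof.
exists (\sum_(m <- msupp p) mdeg m).+1%N; apply/deg_lt_msupp/allP => m mp.
by rewrite (big_rem m) //= leq_addr.
Qed.

Lemma deg_ltW k l p : deg_lt k p -> (k <= l)%N -> deg_lt l p.
Proof. by move=> h kl m lm; apply: h; apply: leq_trans lm. Qed.

Lemma deg_lt0 k : deg_lt k 0.
Proof. by move=> m _; rewrite mcoeff0. Qed.

Lemma deg_ltD k p q : deg_lt k p -> deg_lt k q -> deg_lt k (p + q).
Proof. by move=> hp hq m km; rewrite mcoeffD hp // hq // addr0. Qed.

Lemma deg_ltZ k c p : deg_lt k p -> deg_lt k (c *: p).
Proof. by move=> hp m km; rewrite mcoeffZ hp // mulr0. Qed.

Lemma deg_ltC k c p : deg_lt k p -> deg_lt k (mpolyC d c * p).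
Proof. by rewrite mul_mpolyC; exact: deg_ltZ. Qed.

Lemma deg_ltN k p : deg_lt k p -> deg_lt k (- p).
Proof. by move=> hp m km; rewrite mcoeffN hp // oppr0. Qed.

Lemma deg_ltB k p q : deg_lt k p -> deg_lt k q -> deg_lt k (p - q).
Proof. by move=> hp hq; apply: deg_ltD => //; exact: deg_ltN. Qed.

Lemma deg_lt_nat k n p : deg_lt k p -> deg_lt k (n%:R * p).
Proof. by rewrite -mpolyC_nat; exact: deg_ltC. Qed.

Lemma deg_lt_sum (I : Type) (r : seq I) (Q : pred I) (F : I -> P) k :
  (forall x, Q x -> deg_lt k (F x)) -> deg_lt k (\sum_(x <- r | Q x) F x).
Proof.
by move=> h; elim/big_ind: _ => // [|p q]; [exact: deg_lt0|exact: deg_ltD].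
Qed.

Lemma deg_lt_mderiv k i p : deg_lt k p -> deg_lt k.-1 (mderiv i p).
Proof.
move=> hp m km; rewrite mcoeff_deriv hp ?mul0rn //.
by rewrite mdegD mdeg1 addn1; case: k km {hp}.
Qed.

Lemma deg_lt_monomials k p :
  deg_lt k p -> p = \sum_(m <- msupp p | (mdeg m < k)%N) mcoeff m p *: mpolyX R m.
Proof.
move=> hp; rewrite {1}[p]mpolyE [RHS]big_mkcond /=; apply: eq_bigr => m _.
by case: ltnP => // km; rewrite hp // scale0r.
Qed.

Lemma deg_lt_X m : deg_lt (mdeg m).+1 (mpolyX R m).
Proof. by move=> l ml; rewrite mcoeffX; case: eqP ml => // ->; rewrite ltnn. Qed.

Lemma deg_lt_xvar k i p : deg_lt k p -> deg_lt k.+1 (xvar R i * p).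
Proof.
move=> hp; rewrite (deg_lt_monomials hp) mulr_sumr; apply: deg_lt_sum => m mk.
rewrite -scalerAr -mpolyXD; apply: deg_ltZ.
by apply: (deg_ltW (@deg_lt_X _)); rewrite mdegD mdeg1.
Qed.

Lemma deg_lt_rsq k p : deg_lt k p -> deg_lt k.+2 (rsq R d * p).
Proof.
move=> hp; rewrite /rsq mulr_suml; apply: deg_lt_sum => i _.
by rewrite expr2 -mulrA; do 2 apply: deg_lt_xvar.
Qed.

Lemma deg_lt_lap k p : deg_lt k p -> deg_lt (k - 2) (lap p).
Proof.
move=> hp; apply: deg_lt_sum => i _; rewrite subn2.
by do 2 apply: deg_lt_mderiv.
Qed.

(** Monomials are the eigenvectors of the Euler operator. *)
Lemma mcoeff_euler m p : mcoeff m (euler p) = (mdeg m)%:R * mcoeff m p.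
Proof.
have eulerX l : euler (mpolyX R l) = (mdeg l)%:R *: mpolyX R l.
  rewrite /euler mdegE natr_sum scaler_suml; apply: eq_bigr => i _.
  rewrite mderivX -scalerAr -mpolyXD.
  have [->|li] := posnP (l i); first by rewrite !scale0r.
  rewrite addmC submK //; apply/mnm_lepP => j; rewrite mnm1E.
  by case: eqP => // <-.
have -> : euler p = \sum_(l <- msupp p) ((mdeg l)%:R * mcoeff l p) *: mpolyX R l.
  rewrite [in LHS](mpolyE p) raddf_sum /=; apply: eq_bigr => l _.
  by rewrite linearZ /= eulerX scalerA mulrC.
rewrite raddf_sum [in RHS](mpolyE p) [X in _ = _ * X]raddf_sum mulr_sumr /=; apply: eq_bigr => l _.
by rewrite !mcoeffZ mcoeffX mulrA; case: eqP => [->|_]; rewrite ?mulr0.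
Qed.

Lemma deg_lt_euler k p : deg_lt k p -> deg_lt k (euler p).
Proof. by move=> hp m km; rewrite mcoeff_euler hp // mulr0. Qed.

(** Euler's identity for the homogeneous component of degree k. *)
Lemma deg_lt_euler_sub k p : deg_lt k.+1 p -> deg_lt k (euler p - k%:R * p).
Proof.
move=> hp m km; rewrite mcoeffB mulr_natl mcoeffMn mcoeff_euler mulr_natl.
move: km; rewrite leq_eqVlt => /predU1P[->|km]; first by rewrite subrr.
by rewrite hp // !mul0rn subrr.
Qed.

Lemma deg_lt_sphlap k p : deg_lt k p -> deg_lt k (sphlap p).
Proof.
move=> hp; rewrite sphlapE; apply: deg_ltB; last first.
  rewrite mulrBl; apply: deg_ltB; apply: deg_lt_nat; exact: deg_lt_euler.
apply: deg_ltB; last by do 2 apply: deg_lt_euler.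
have [k2|k2] := leqP 2 k.
  by have := deg_lt_rsq (deg_lt_lap hp); rewrite -addn2 subnK.
suff -> : lap p = 0 by rewrite mulr0; exact: deg_lt0.
apply/mpolyP => m; rewrite mcoeff0; apply: (deg_lt_lap hp).
by rewrite (_ : k - 2 = 0)%N //; lia.
Qed.

Lemma lapD p q : lap (p + q) = lap p + lap q. Proof. exact: raddfD. Qed.
Lemma eulerD p q : euler (p + q) = euler p + euler q. Proof. exact: raddfD. Qed.
Lemma sphlapD p q : sphlap (p + q) = sphlap p + sphlap q. Proof. exact: raddfD. Qed.

Lemma euler_mulC c p : euler (mpolyC d c * p) = mpolyC d c * euler p.
Proof. by rewrite !mul_mpolyC linearZ. Qed.

Lemma lap_mulC c p : lap (mpolyC d c * p) = mpolyC d c * lap p.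
Proof. by rewrite !mul_mpolyC linearZ. Qed.

Lemma sphlap_mulC c p : sphlap (mpolyC d c * p) = mpolyC d c * sphlap p.
Proof. by rewrite !mul_mpolyC linearZ. Qed.

(** Below, A = |x|^2 and L = lap p. Modulo lower degree, euler is multiplication
    by the degree, so A L = sphlap p + al p by [sphlapE]; applying this to L once
    more gives A (A (lap L)) = (sphlap + c) (A L) with the constant c that belongs
    to the degree k - 2. The factors 1 - A of [lapstarE] count as - A, and the
    remaining constants add up to be. The errors e, e', e2 record the terms
    of lower degree. *)
Lemma lapstar_lap_top k (mu : R) p : deg_lt k.+1 p ->
  let al := k%:R * (k%:R + d%:R - 2) in
  let K := k%:R + 2 * mu + 2 in
  let be := K * (K + d%:R - 2) in
  deg_lt k (lapstar (mu + 2) (lap p) -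
    (mpolyC d (al * be) * p + mpolyC d (al + be) * sphlap p + sphlap (sphlap p))).
Proof.
move=> hp al K be.
set kR : R := k%:R; set A := rsq R d; set L := lap p.
set e := euler p - mpolyC d kR * p.
have he : deg_lt k e by rewrite /e /kR mpolyC_nat; exact: deg_lt_euler_sub.
have Ep : euler p = mpolyC d kR * p + e by rewrite /e; ring.
clearbody e.
have r2lap q : deg_lt k q -> deg_lt k (A * lap q).
  move=> hq; have -> : A * lap q = sphlap q + euler (euler q) + (d%:R - 2) * euler q.
    by rewrite sphlapE /A; ring.
  apply: deg_ltD; last by rewrite mulrBl; apply: deg_ltB; apply: deg_lt_nat; exact: deg_lt_euler.
  by apply: deg_ltD; [exact: deg_lt_sphlap|do 2 apply: deg_lt_euler].
set e' := euler e + mpolyC d (kR + d%:R - 2) * e.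
have he' : deg_lt k e' by apply: deg_ltD; [exact: deg_lt_euler|exact: deg_ltC].
have AL : A * L = sphlap p + mpolyC d al * p + e'.
  rewrite sphlapE Ep raddfD /=. rewrite euler_mulC Ep /e' /al.
  rewrite !(mpolyCM, mpolyCB, mpolyCD, mpolyC_nat) -/A -/L -/kR; ring.
have EL : euler L = mpolyC d (kR - 2) * L + lap e.
  have := lap_euler p; rewrite Ep raddfD /= lap_mulC -/L => h.
  have -> : euler L = (euler L + 2 * L) - 2 * L by ring.
  by rewrite -h mpolyCB mpolyC_nat; ring.
set e2 := mpolyC d (kR + d%:R - 6) * e + euler e.
have AAL : A * (A * lap L) = sphlap (sphlap p) + mpolyC d al * sphlap p + sphlap e'
    + mpolyC d ((kR - 2) * (kR + d%:R - 4)) * (sphlap p + mpolyC d al * p + e')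
    + A * lap e2.
  have -> : A * lap L = sphlap L + euler (euler L) + (d%:R - 2) * euler L.
    by rewrite (sphlapE L) /A; ring.
  transitivity (sphlap (A * L)
      + mpolyC d ((kR - 2) * (kR + d%:R - 4)) * (A * L) + A * lap e2).
    rewrite EL eulerD euler_mulC EL sphlap_rsq -/A.
    have -> : euler (lap e) = lap (euler e) - 2 * lap e by rewrite lap_euler; ring.
    rewrite /e2 lapD lap_mulC.
    rewrite !(mpolyCM, mpolyCB, mpolyCD, mpolyC_nat).
    move: (lap e) (lap (euler e)) (sphlap L) (L) (A) (mpolyC d kR) => x1 x2 x3 x4 x5 x6.
    ring.
  by rewrite AL !sphlapD sphlap_mulC.
have hL : deg_lt k L by apply: (deg_ltW (deg_lt_lap hp)); lia.
have hlap q : deg_lt k q -> deg_lt k (lap q).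
  by move=> hq; apply: (deg_ltW (deg_lt_lap hq)); lia.
pose b := mu + 2.
have -> : lapstar (mu + 2) L - (mpolyC d (al * be) * p + mpolyC d (al + be) * sphlap p
      + sphlap (sphlap p)) =
    lap L - 2%:R * (A * lap L) + sphlap e'
    + mpolyC d ((kR - 2) * (kR + d%:R - 4) + 4 * b * (kR - 2) + 2 * b * d%:R
                + 4 * b * (b - 1)) * e'
    + A * lap e2 - mpolyC d (4 * b) * (euler L - A * lap e)
    - mpolyC d (2 * b * d%:R) * L.
  rewrite lapstarE -/A -/b.
  have -> : (1 - A) ^+ 2 * lap L = lap L - 2%:R * (A * lap L) + A * (A * lap L) by ring.
  rewrite AAL.
  have -> : (1 - A) * euler L = euler L - A * lap e - mpolyC d (kR - 2) * (A * L).
    by rewrite EL; ring.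
  have -> : (1 - A) * L = L - A * L by ring.
  rewrite AL /be /K /b -/kR /al -/kR.
  rewrite !(mpolyCM, mpolyCB, mpolyCD, mpolyC_nat).
  move: (lap e) (lap L) (lap e2) (L) (A) (mpolyC d kR) (mpolyC d mu) => x1 x2 x3 x4 x5 x6 x7.
  ring.
have he2 : deg_lt k (A * lap e2).
  by apply: r2lap; apply: deg_ltD; [exact: deg_ltC|exact: deg_lt_euler].
apply: deg_ltB; last exact: deg_ltC.
apply: deg_ltB; last first.
  by apply: deg_ltC; apply: deg_ltB; [exact: deg_lt_euler|exact: r2lap].
apply: deg_ltD => //; apply: deg_ltD; last exact: deg_ltC.
apply: deg_ltD; last exact: deg_lt_sphlap.
by apply: deg_ltB; [exact: hlap|apply: deg_lt_nat; exact: r2lap].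
Qed.

Lemma deg_lt_lapstar k b p : deg_lt k p -> deg_lt k.+2 (lapstar b p).
Proof.
move=> hp; apply: deg_lt_sum => j _.
have hd l c q i : deg_lt l q -> deg_lt l.+1 (dstar c i q).
  move=> hq; rewrite /dstar mulrBl mul1r.
  have h1 := deg_lt_mderiv i hq; apply: deg_ltB; last first.
    by apply: deg_ltC; exact: deg_lt_xvar.
  apply: deg_ltB; first by apply: (deg_ltW h1); lia.
  case: l q hq h1 => [|l] q hq h1; last exact: deg_lt_rsq.
  rewrite (_ : mderiv i q = 0) ?mulr0; first exact: deg_lt0.
  by apply/mpolyP => m; rewrite mcoeff0 h1.
by do 2 apply: (hd).
Qed.

Lemma deg_lt_iter_lap k s p : deg_lt k p -> deg_lt (k - 2 * s) (iter s (@lap R d) p).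
Proof.
move=> kp; elim: s => [|s IH]; first by rewrite subn0.
by rewrite iterS mulnS addnC subnDA; exact: deg_lt_lap.
Qed.

Lemma deg_lt_iter_sphlap k s p : deg_lt k p -> deg_lt k (iter s (@sphlap R d) p).
Proof. by move=> kp; elim: s => // s; rewrite iterS; exact: deg_lt_sphlap. Qed.

(** The product rule that turns integration by parts into the vanishing of the
    integral of a [dstar]. *)
Lemma mul_mderiv_dstar b j p q :
  (1 - rsq R d) * (mderiv j p * q) = dstar b j (p * q) - p * dstar b j q.
Proof. by rewrite /dstar mderivM; ring. Qed.

Lemma drotM i j p q : drot i j (p * q) = drot i j p * q + p * drot i j q.
Proof. by rewrite /drot !mderivM; ring. Qed.

End degree.

(** * Interpolation inequalities for sequences of norms *)
Section interpolation.
Variable R : realFieldType.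
Implicit Types (v : nat -> R) (u : nat -> nat -> R).

Lemma amgm (x y z de : R) : 0 < de -> 0 <= y -> 0 <= z ->
  x ^+ 2 <= y * z -> `|x| <= de * y + de^-1 * z.
Proof.
move=> de0 y0 z0; rewrite -real_normK ?num_real // => xyz.
have a0 : 0 <= de * y by rewrite mulr_ge0 // ltW.
have b0 : 0 <= de^-1 * z by rewrite mulr_ge0 // invr_ge0 ltW.
have abE : y * z = (de * y) * (de^-1 * z) by field; rewrite gt_eqF.
rewrite leNgt; apply/negP => ltx; rewrite abE in xyz.
have := normr_ge0 x; nra.
Qed.

(** Log-convexity makes each term small against the sum of its neighbours; the
    induction on m trades the right neighbour for the last term. *)
Lemma interpolate m (e : R) : (0 < m)%N -> 0 < e ->
  exists2 C, 0 < C & forall v, (forall j, 0 <= v j) ->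
    (forall j, v j.+1 ^+ 2 <= v j * v j.+2) ->
    forall j, (0 < j <= m)%N -> v j <= e * v 0%N + C * v m.
Proof.
case: m => // m _; elim: m e => [|m IH] e e0.
  exists 1 => // v v0 _ j /andP[j0 j1].
  have -> : j = 1%N by lia.
  by rewrite mul1r lerDr mulr_ge0 // ltW.
have last_term (e' : R) : 0 < e' -> exists2 B, 0 < B &
    forall v, (forall j, 0 <= v j) -> (forall j, v j.+1 ^+ 2 <= v j * v j.+2) ->
    v m.+1 <= e' * v 0%N + B * v m.+2.
  move=> e'0; have [C1 C10 H1] := IH 1 ltr01.
  (* The first bound gives the coefficient of v 0, the second lets half of
     v m.+1 be absorbed. *)
  pose de := Num.min (e' / 2) (2 * C1)^-1.
  have de0 : 0 < de by rewrite lt_min !divr_gt0 ?invr_gt0 ?mulr_gt0.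
  exists (2 * de^-1); first by rewrite mulr_gt0 ?invr_gt0.
  move=> v v0 vv.
  have h1 : v m <= v 0%N + C1 * v m.+1.
    have [->|m0] := posnP m; first by rewrite lerDl mulr_ge0 // ltW.
    by rewrite -[X in X + _]mul1r; apply: H1 => //; rewrite m0 leqnSn.
  have h2 := le_trans (ler_norm _) (amgm de0 (v0 m) (v0 m.+2) (vv m)).
  have h3 : de <= e' / 2 by rewrite ge_min lexx.
  have h4 : de * C1 <= 2^-1.
    have hd : de <= (2 * C1)^-1 by rewrite ge_min lexx orbT.
    have -> : 2^-1 = (2 * C1)^-1 * C1 by rewrite invfM -mulrA mulVf ?mulr1 // gt_eqF.
    by rewrite ler_pM2r.
  have h5 : de * v m <= de * (v 0%N + C1 * v m.+1) by rewrite ler_pM2l.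
  have h6 : de * C1 * v m.+1 <= 2^-1 * v m.+1 by exact: ler_wpM2r.
  have h7 : de * v 0%N <= e' / 2 * v 0%N by exact: ler_wpM2r.
  by move: h2 h5 h6 h7; clear; move: (de^-1) => i; lra.
have [C1 C10 H1] := IH (e / 2) (divr_gt0 e0 (ltr0Sn _ _)).
have [C2 C20 H2] := last_term (e / 2 / C1) (divr_gt0 (divr_gt0 e0 (ltr0Sn _ _)) C10).
exists (C1 * C2 + 1); first by rewrite addr_gt0 ?mulr_gt0.
move=> v v0 vv j /andP[j0]; rewrite leq_eqVlt => /predU1P[->|jm].
  rewrite mulrDl mul1r addrA lerDr addr_ge0 // mulr_ge0 // ltW //.
  exact: mulr_gt0.
have h1 := H1 v v0 vv j; rewrite j0 -ltnS jm in h1; move: (h1 isT) => {}h1.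
have h2 : C1 * v m.+1 <= e / 2 * v 0%N + C1 * C2 * v m.+2.
  have h2 := H2 v v0 vv; rewrite -(ler_pM2l C10) in h2; apply: (le_trans h2).
  by rewrite le_eqVlt; apply/orP; left; apply/eqP; field; rewrite gt_eqF.
by have := v0 m.+2; lra.
Qed.

(** Here u a b stands for the normalized square norm of L^a S^b p, with L the
    Laplacian and S the Laplace-Beltrami operator. Each application of L can be
    undone at the price of one application of S; the powers of S that accumulate
    in this way are then interpolated between p and S^t p, with a coefficient
    of p small enough to be absorbed by the left-hand side. *)
Lemma double_interpolate s (C : R) : (0 < s)%N -> 0 < C ->
  exists2 C', 0 < C' & forall u, (forall a b, 0 <= u a b) ->
    (forall b, u 0%N b.+1 ^+ 2 <= u 0%N b * u 0%N b.+2) ->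
    (forall a b, (a < s)%N -> u a b <= C * (u a.+1 b + u a b.+1)) ->
    (forall a b, (a < s)%N -> u a.+1 b <= C * (u a b + u a b.+1)) ->
    u 0%N 0%N <= C' * (u s 0%N + u 0%N s).
Proof.
move=> s0 C0.
(* The mixed terms are dominated by pure powers of S. *)
have mixed a : exists2 D, 0 < D & forall u, (forall a b, 0 <= u a b) ->
    (forall a b, (a < s)%N -> u a.+1 b <= C * (u a b + u a b.+1)) ->
    (a <= s)%N -> forall b, u a b <= D * \sum_(j < a.+1) u 0%N (b + j)%N.
  elim: a => [|a [D D0 IH]].
    by exists 1 => // u _ _ _ b; rewrite big_ord1 addn0 mul1r.
  exists (C * (D + D)); first by rewrite mulr_gt0 ?addr_gt0.
  move=> u u0 hu sa b; apply: (le_trans (hu _ _ sa)).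
  rewrite -mulrA ler_pM2l // mulrDl.
  apply: lerD; apply: (le_trans (IH u u0 hu (ltnW sa) _)); rewrite ler_pM2l //.
    by rewrite [leRHS]big_ord_recr /= lerDl.
  rewrite [leRHS]big_ord_recl /=.
  under eq_bigr do rewrite addSnnS.
  by rewrite lerDr.
(* The number of factors L grows one at a time, from 0 to s. *)
have main t : (0 < t <= s)%N -> exists2 C', 0 < C' & forall u, (forall a b, 0 <= u a b) ->
    (forall b, u 0%N b.+1 ^+ 2 <= u 0%N b * u 0%N b.+2) ->
    (forall a b, (a < s)%N -> u a b <= C * (u a.+1 b + u a b.+1)) ->
    (forall a b, (a < s)%N -> u a.+1 b <= C * (u a b + u a b.+1)) ->
    u 0%N 0%N <= C' * (u t 0%N + u 0%N t).
  elim: t => [//|t IH] /andP[_ ts].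
  have [->|t0] := posnP t; first by exists C => // u _ _ h _; apply: h.
  have [C1 C10 H1] : exists2 C', 0 < C' & _ := IH (introT andP (conj t0 (ltnW ts))).
  have [D D0 HD] := mixed t.
  (* u 0 0 returns with coefficient M (2 M)^-1 = 1/2, and is absorbed. *)
  pose M := C1 * (C * D * t.+1%:R + 1).
  have M0 : 0 < M by rewrite mulr_gt0 // addr_gt0 // !mulr_gt0.
  have iM0 : 0 < (2 * M)^-1 by rewrite invr_gt0 mulr_gt0.
  have [E E0 HE] := interpolate (ltn0Sn t) iM0.
  exists (2 * (C1 * C + M * E)); first by do ?[apply: mulr_gt0 | apply: addr_gt0].
  move=> u u0 u2 h1 h2.
  have hE j : (0 < j <= t.+1)%N -> u 0%N j <= (2 * M)^-1 * u 0%N 0%N + E * u 0%N t.+1.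
    exact: (HE (u 0%N) (u0 0%N) u2 j).
  set X := _ * _ + _ * _ in hE.
  have hmix : u t 1%N <= D * t.+1%:R * X.
    apply: (le_trans (HD u u0 h2 (ltnW ts) 1%N)); rewrite -mulrA ler_pM2l //.
    apply: (@le_trans _ _ (\sum_(j < t.+1) X)).
      by apply: ler_sum => j _; apply: hE; rewrite add1n /= ltn_ord.
    by rewrite sumr_const card_ord mulr_natl.
  have ht : u 0%N t <= X by apply: hE; rewrite t0 leqnSn.
  have htt := h1 t 0%N ts.
  have hu := H1 u u0 u2 h1 h2.
  have hX : u 0%N 0%N <= C1 * C * u t.+1 0%N + M * X.
    apply: (le_trans hu).
    have -> : C1 * C * u t.+1 0%N + M * X =
       C1 * (C * (u t.+1 0%N + D * t.+1%:R * X) + X) by rewrite /M; ring.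
    rewrite ler_pM2l //; apply: lerD => //; apply: (le_trans htt).
    by rewrite ler_pM2l // lerD2l.
  have hMX : M * X = 2^-1 * u 0%N 0%N + M * E * u 0%N t.+1.
    by rewrite /X; field; rewrite gt_eqF.
  rewrite hMX in hX.
  have : u 0%N 0%N <= 2 * (C1 * C * u t.+1 0%N + M * E * u 0%N t.+1) by lra.
  move=> /le_trans; apply.
  rewrite -subr_ge0.
  set x := u t.+1 0%N; set y := u 0%N t.+1.
  have -> : 2 * (C1 * C + M * E) * (x + y) - 2 * (C1 * C * x + M * E * y) =
    2 * (C1 * C * y + M * E * x) by ring.
  have xy0 : 0 <= x /\ 0 <= y by split; exact: u0.
  apply: mulr_ge0 => //; apply: addr_ge0; (apply: mulr_ge0; last by case: xy0);
  by apply: mulr_ge0; exact: ltW.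
by apply: main; rewrite s0 leqnn.
Qed.
End interpolation.

(** * Semidefinite forms and Riesz representation *)
Lemma discriminant_le (R : realFieldType) (a b c : R) : 0 <= c ->
  (forall t, 0 <= a + 2 * t * b + t ^+ 2 * c) -> b ^+ 2 <= a * c.
Proof.
move=> c0 h; have a0 : 0 <= a by have := h 0; rewrite mulr0 expr0n /= !mul0r !addr0.
move: c0; rewrite le_eqVlt => /predU1P[c0|c0].
  rewrite -c0 mulr0; have [->|b0] := eqVneq b 0; first by rewrite expr0n.
  have := h (- (a + 1) / (2 * b)); rewrite -c0 mulr0 addr0.
  have -> : 2 * (- (a + 1) / (2 * b)) * b = - (a + 1) by field.
  by rewrite opprD addNKr ler0N1.
have := h (- b / c); have -> : a + 2 * (- b / c) * b + (- b / c) ^+ 2 * c =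
  (a * c - b ^+ 2) / c by field; rewrite gt_eqF.
by rewrite pmulr_lge0 ?invr_gt0 // subr_ge0.
Qed.

Section representation.
Variables (R : realFieldType) (V : lmodType R) (B : V -> V -> R).
Hypothesis BC : forall u v, B u v = B v u.
Hypothesis BP : forall a u v w, B (a *: u + v) w = a * B u w + B v w.
Hypothesis B0 : forall u, 0 <= B u u.

Lemma form_cauchy u v : B u v ^+ 2 <= B u u * B v v.
Proof.
apply: discriminant_le => // t.
have := B0 (t *: v + u).
by rewrite BP (BC v) BP (BC u (_ + _)) BP (BC v u) => h; apply: (le_trans h); lra.
Qed.

Lemma form0l v : B 0 v = 0.
Proof. by have := BP 1 0 0 v; rewrite scaler0 addr0 mul1r => h; lra. Qed.

Definition lin_closed (S : V -> Prop) :=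
  S 0 /\ forall a u v, S u -> S v -> S (a *: u + v).

(** The span as the intersection of all linearly closed predicates, which avoids
    choosing coefficients. *)
Definition in_span (vs : seq V) (u : V) :=
  forall S, lin_closed S -> (forall v, List.In v vs -> S v) -> S u.

(** Gram-Schmidt, one vector at a time: the new vector minus its projection on the
    span of the others corrects the representing vector. If that difference has
    norm zero, the bound on l forces l to vanish on it, so the form may be
    degenerate. *)
Lemma riesz_span (l : V -> R) (M : R) (vs : seq V) :
  (forall a u v, l (a *: u + v) = a * l u + l v) ->
  (forall v, l v ^+ 2 <= M * B v v) ->
  exists2 p, in_span vs p & forall v, List.In v vs -> B p v = l v.
Proof.
elim: vs l M => [|v vs IH] l M lP lM.
  by exists 0 => // S [].
have l0 : l 0 = 0 by have := lP 1 0 0; rewrite scaler0 addr0 mul1r => h; lra.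
have [v' v'S v'B] := IH (B v) (B v v)
   (fun a u w => etrans (BC _ _) (etrans (BP a u w v)
      (congr2 (fun x y => a * x + y) (BC u v) (BC w v))))
   (fun u => form_cauchy v u).
have [p' p'S p'B] := IH l M lP lM.
have spanW u : in_span vs u -> in_span (v :: vs) u.
  by move=> uS S Sl Sv; apply: uS => // w wv; apply: Sv; right.
have Bp'v' : B p' v' = l v'.
  apply: (v'S (fun u => B p' u = l u)) => //; split.
    by rewrite BC form0l l0.
  by move=> a u w hu hw; rewrite BC BP !(BC _ p') hu hw lP.
pose w := (-1) *: v' + v.
have Bw u : List.In u vs -> B w u = 0.
  by move=> uv; rewrite /w BP v'B // mulN1r addNr.
have vE : v = 1 *: v' + w by rewrite /w addrA scale1r scaleN1r subrr add0r.
have wS : in_span (v :: vs) w.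
  move=> S Sl Sv; apply: (Sl.2); last by apply: Sv; left.
  by apply: (spanW v').
clearbody w.
have [ww|ww] := eqVneq (B w w) 0.
  exists p'; first exact: spanW.
  have lw : l w = 0.
    by apply/eqP; rewrite -sqrf_eq0 eq_le sqr_ge0 andbT (le_trans (lM w)) // ww mulr0.
  have pw : B p' w = 0.
    apply/eqP; rewrite -sqrf_eq0 eq_le sqr_ge0 andbT (le_trans (form_cauchy _ _)) //.
    by rewrite ww mulr0.
  move=> u [<-|]; last exact: p'B.
  by rewrite vE lP BC BP !(BC _ p') Bp'v' pw lw.
pose c := (l w - B p' w) / B w w.
exists (c *: w + p').
  by move=> S Sl Sv; apply: (Sl.2); [exact: wS|exact: (spanW p')].
have Bwv' : B w v' = 0.
  apply: (v'S (fun u => B w u = 0)) => //; split; first by rewrite BC form0l.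
  by move=> a u z hu hz; rewrite BC BP !(BC _ w) hu hz mulr0 addr0.
move=> u [<-|uv]; last by rewrite BP Bw // mulr0 add0r p'B.
rewrite vE lP BC BP !(BC _ (_ + _)) !BP Bwv' Bp'v' /c divfK //.
by rewrite mulr0 add0r subrK.
Qed.

End representation.

(** * Norms on the polynomials orthogonal to lower degree *)
Section real_bounds.
Variable R : realFieldType.

(** After a < s Laplacians the degree k has become k - 2 a and the exponent mu has
    become mu + 2 a: both constants of [lapstar_lap_top] stay comparable to k^2,
    as k > 2 s leaves a fixed fraction of k. *)
Lemma shift_bounds (d s : nat) (mu : R) : (2 <= d)%N -> -1 < mu ->
  exists2 A : R * R, 0 < A.1 /\ 0 < A.2 &
  forall k a : nat, (a < s)%N -> (2 * s < k)%N ->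
    let ka := (k - 2 * a)%:R : R in
    let al := ka * (ka + d%:R - 2) in
    let K := ka + 2 * (mu + (2 * a)%:R) + 2 in
    let be := K * (K + d%:R - 2) in
    A.1 * k%:R ^+ 2 <= al <= A.2 * k%:R ^+ 2 /\
    A.1 * k%:R ^+ 2 <= be <= A.2 * k%:R ^+ 2.
Proof.
move=> d2 mu1.
pose M : R := (2 * s)%:R + 2 * mu + 4.
have M2 : 2 <= M by rewrite /M; have := ler0n R (2 * s); lra.
exists ((2 * s).+1%:R ^- 2, M ^+ 2 * d%:R).
  split => /=; first by rewrite invr_gt0 exprn_gt0 // ltr0n.
  by rewrite mulr_gt0 ?exprn_gt0 ?ltr0n //; [lra|lia].
move=> k a as_ ks ka al K be /=.
have d2' : (2 : R) <= d%:R by rewrite ler_nat.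
have k1 : (1 : R) <= k%:R by rewrite ler1n; lia.
have kak : ka <= k%:R by rewrite ler_nat leq_subr.
have a2 : (2 * a)%:R <= (2 * s)%:R :> R by rewrite ler_nat; lia.
have a0 := ler0n R (2 * a).
have kaK : ka + (2 * a)%:R = k%:R :> R by rewrite -natrD subnK //; lia.
have Kl : k%:R <= K by rewrite /K; lra.
have Ku : K <= M * k%:R.
  have -> : K = k%:R + ((2 * a)%:R + 2 * mu + 2) by rewrite /K -kaK; ring.
  have : (2 * a)%:R + 2 * mu + 2 <= ((2 * s)%:R + 2 * mu + 2) * k%:R.
    by apply: (@le_trans _ _ ((2 * s)%:R + 2 * mu + 2)); [lra|rewrite ler_peMr //; lra].
  by rewrite /M; lra.
have kal : k%:R <= (2 * s).+1%:R * ka.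
  by rewrite -natrM ler_nat; nia.
have ka0 : 0 <= ka by exact: ler0n.
have low (x : R) : k%:R <= (2 * s).+1%:R * x -> 0 <= x ->
    (2 * s).+1%:R ^- 2 * k%:R ^+ 2 <= x * (x + d%:R - 2).
  move=> kx x0; apply: (@le_trans _ _ (x ^+ 2)); last first.
    by rewrite expr2 ler_wpM2l //; lra.
  rewrite mulrC ler_pdivrMr ?exprn_gt0 ?ltr0n //.
  by rewrite -exprMn lerXn2r ?nnegrE ?mulr_ge0 // mulrC.
have upp (x : R) : x <= M * k%:R -> 0 <= x -> x * (x + d%:R - 2) <= M ^+ 2 * d%:R * k%:R ^+ 2.
  move=> xM x0; have -> : M ^+ 2 * d%:R * k%:R ^+ 2 = (M * k%:R) * (M * k%:R * d%:R) by ring.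
  apply: ler_pM => //; first lra.
  have : 2 <= M * k%:R by apply: (le_trans M2); rewrite ler_peMr //; lra.
  by nra.
split; apply/andP; split.
- exact: low.
- by apply: upp => //; apply: (le_trans kak); rewrite ler_peMl //; lra.
- apply: low; last by apply: le_trans Kl.
  apply: (le_trans Kl); rewrite ler_peMl ?ler1n //; first by apply: le_trans Kl.
- by apply: upp => //; apply: le_trans Kl.
Qed.

(** In the application n0, n1, n2 are the square norms of p, S p, L p, and x is
    <p, S p>. The term (al + be) x may be negative; by the inequality of
    arithmetic and geometric means it costs half of al be n0 and a multiple of n1. *)
Lemma step_bounds (A1 A2 : R) : 0 < A1 -> 0 < A2 ->
  exists2 C : R, 0 < C & forall k2 al be n0 n1 n2 x : R, 0 < k2 ->
    A1 * k2 <= al <= A2 * k2 -> A1 * k2 <= be <= A2 * k2 ->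
    0 <= n0 -> 0 <= n1 -> 0 <= n2 -> x ^+ 2 <= n0 * n1 ->
    n2 = al * be * n0 + (al + be) * x + n1 ->
    k2 ^+ 2 * n0 <= C * (n2 + n1) /\ n2 <= C * (k2 ^+ 2 * n0 + n1).
Proof.
move=> A10 A20.
pose B := 8 * A2 ^+ 2 / A1 ^+ 2.
have B0 : 0 < B by rewrite divr_gt0 ?mulr_gt0 ?exprn_gt0.
pose C1 := 2 / A1 ^+ 2 * (1 + B).
pose C2 := A2 ^+ 2 + A1 ^+ 2 / 2 + B + 1.
have C10 : 0 < C1 by rewrite mulr_gt0 ?divr_gt0 ?exprn_gt0 ?addr_gt0.
have C20 : 0 < C2 by rewrite !addr_gt0 ?divr_gt0 ?mulr_gt0 ?exprn_gt0.
exists (C1 + C2); first by rewrite addr_gt0.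
move=> k2 al be n0 n1 n2 x k20 /andP[al1 al2] /andP[be1 be2] n00 n10 n20 xn n2E.
(* de is such that 2 A2 k2 de n0, which bounds the n0 part of the cross term,
   is half of the lower bound A1^2 k2^2 n0 of al be n0. *)
pose de := A1 ^+ 2 * k2 / (4 * A2).
have de0 : 0 < de by rewrite divr_gt0 ?mulr_gt0 ?exprn_gt0.
have hx := amgm de0 n00 n10 xn.
have A1k : 0 < A1 * k2 by rewrite mulr_gt0.
have hX : `|(al + be) * x| <= A1 ^+ 2 * k2 ^+ 2 / 2 * n0 + B * n1.
  rewrite normrM (ger0_norm (_ : 0 <= al + be)); last by lra.
  apply: (@le_trans _ _ (2 * A2 * k2 * (de * n0 + de^-1 * n1))).
    apply: ler_pM => //; first lra.
    by lra.
  rewrite le_eqVlt; apply/orP; left; apply/eqP; rewrite /de /B; field.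
  by rewrite !gt_eqF.
have [x1 x2] : - (A1 ^+ 2 * k2 ^+ 2 / 2 * n0 + B * n1) <= (al + be) * x /\
    (al + be) * x <= A1 ^+ 2 * k2 ^+ 2 / 2 * n0 + B * n1.
  by move: hX; rewrite ler_norml => /andP[].
have low : A1 ^+ 2 * k2 ^+ 2 * n0 <= al * be * n0.
  apply: ler_wpM2r => //; rewrite -exprMn expr2; apply: ler_pM => //; exact: ltW.
have upp : al * be * n0 <= A2 ^+ 2 * k2 ^+ 2 * n0.
  by apply: ler_wpM2r => //; rewrite -exprMn expr2; apply: ler_pM => //; lra.
have k2n0 : 0 <= k2 ^+ 2 * n0 by rewrite mulr_ge0 // exprn_ge0 // ltW.
split.
  have h : A1 ^+ 2 / 2 * (k2 ^+ 2 * n0) <= n2 + B * n1 by lra.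
  have : A1 ^+ 2 / 2 * (k2 ^+ 2 * n0) <= (1 + B) * (n2 + n1).
    by apply: (le_trans h); have := mulr_ge0 (ltW B0) n20; lra.
  rewrite mulrC -ler_pdivlMr ?divr_gt0 ?exprn_gt0 // => h'; apply: (le_trans h').
  have -> : (1 + B) * (n2 + n1) / (A1 ^+ 2 / 2) = C1 * (n2 + n1).
    by rewrite /C1; field; rewrite gt_eqF.
  by rewrite ler_wpM2r ?addr_ge0 // lerDl ltW.
apply: (@le_trans _ _ (C2 * (k2 ^+ 2 * n0 + n1))); last first.
  by rewrite ler_wpM2r ?addr_ge0 // lerDr ltW.
have h1 := mulr_ge0 (ltW B0) k2n0.
have h2 : 0 <= A2 ^+ 2 * n1 by rewrite mulr_ge0 ?sqr_ge0.
have h3 : 0 <= A1 ^+ 2 * n1 by rewrite mulr_ge0 ?sqr_ge0.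
by rewrite /C2 n2E; lra.
Qed.

End real_bounds.

Section spectral.
Variables (R : realFieldType) (d : nat) (mu0 : R).
Local Notation P := (mpoly d R).
Implicit Types (p q r : P) (mu nu : R) (k : nat).

(** The family of inner products with weight (1 - |x|^2)^nu, reduced to the
    properties from which the spectral estimate follows. *)
Record ball_form (ip : R -> P -> P -> R) : Prop := BallForm {
  ball_formC : forall nu p q, ip nu p q = ip nu q p;
  ball_formP : forall nu (a : R) p q r, mu0 <= nu ->
    ip nu (a *: p + q) r = a * ip nu p r + ip nu q r;
  ball_form_ge0 : forall nu p, mu0 <= nu -> 0 <= ip nu p p;
  ball_form_sphlap : forall nu p q, mu0 <= nu -> ip nu (sphlap p) q = ip nu p (sphlap q);
  ball_form_lap : forall nu p q, mu0 <= nu ->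
    ip (nu + 2) (lap p) q = ip nu p (lapstar (nu + 2) q) }.

Hypothesis mu0_gtN1 : -1 < mu0.
Variable ip : R -> P -> P -> R.
Hypothesis bf : ball_form ip.

Lemma ip_cauchy nu p q : mu0 <= nu -> ip nu p q ^+ 2 <= ip nu p p * ip nu q q.
Proof.
move=> nu1; apply: form_cauchy => *; [exact: (ball_formC bf)|exact: (ball_formP bf)|].
exact: (ball_form_ge0 bf).
Qed.

Lemma ip0l nu p : mu0 <= nu -> ip nu 0 p = 0.
Proof. by move=> nu1; apply: form0l => *; exact: (ball_formP bf). Qed.

Lemma ipDl nu p q r : mu0 <= nu -> ip nu (p + q) r = ip nu p r + ip nu q r.
Proof.
by move=> nu1; rewrite -[p in LHS]scale1r (ball_formP bf) // mul1r.
Qed.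

Lemma ipDr nu p q r : mu0 <= nu -> ip nu r (p + q) = ip nu r p + ip nu r q.
Proof. by move=> nu1; rewrite !(ball_formC bf _ r) ipDl. Qed.

Lemma ipCl nu (a : R) p r : mu0 <= nu -> ip nu (mpolyC d a * p) r = a * ip nu p r.
Proof.
by move=> nu1; rewrite mul_mpolyC -[_ *: p]addr0 (ball_formP bf) // ip0l // addr0.
Qed.

Lemma ipCr nu (a : R) p r : mu0 <= nu -> ip nu r (mpolyC d a * p) = a * ip nu r p.
Proof. by move=> nu1; rewrite (ball_formC bf) ipCl // (ball_formC bf). Qed.

Lemma ipBr nu p q r : mu0 <= nu -> ip nu r (p - q) = ip nu r p - ip nu r q.
Proof.
move=> nu1; have -> : p - q = mpolyC d (-1) * q + p by rewrite mpolyCN mpolyC1; ring.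
by rewrite ipDr // !(ball_formC bf _ r) ipCl // mulN1r addrC.
Qed.

(** The k-th space of orthogonal polynomials, for the weight of exponent nu. *)
Definition orth_space nu k p :=
  deg_lt k.+1 p /\ forall q, deg_lt k q -> ip nu p q = 0.

Lemma orth_space_sphlap nu k p : mu0 <= nu ->
  orth_space nu k p -> orth_space nu k (sphlap p).
Proof.
move=> nu1 [hp op]; split; first exact: deg_lt_sphlap.
by move=> q hq; rewrite (ball_form_sphlap bf) //; apply: op; exact: deg_lt_sphlap.
Qed.

Lemma orth_space_lap nu k p : mu0 <= nu -> (2 <= k)%N ->
  orth_space nu k p -> orth_space (nu + 2) (k - 2) (lap p).
Proof.
move=> nu1 k2 [hp op]; split; first by rewrite -subSn //; exact: deg_lt_lap.
move=> q hq; rewrite (ball_form_lap bf) //; apply: op.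
by apply: (deg_ltW (deg_lt_lapstar _ hq)); rewrite -addn2 subnK.
Qed.

(** The remainder of [lapstar_lap_top] has lower degree, hence is orthogonal
    to p. *)
Lemma lap_norm nu k p : mu0 <= nu -> orth_space nu k p ->
  let al := k%:R * (k%:R + d%:R - 2) in
  let K := k%:R + 2 * nu + 2 in
  let be := K * (K + d%:R - 2) in
  ip (nu + 2) (lap p) (lap p) =
    al * be * ip nu p p + (al + be) * ip nu p (sphlap p) + ip nu (sphlap p) (sphlap p).
Proof.
move=> nu1 [hp op] al K be.
rewrite (ball_form_lap bf) //.
have /op := lapstar_lap_top nu hp; rewrite -/al -/K -/be ipBr // => /eqP.
rewrite subr_eq0 => /eqP ->.
clearbody be; clearbody al.
have comb a b q1 q2 q3 : ip nu p (mpolyC d a * q1 + mpolyC d b * q2 + q3) =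
    a * ip nu p q1 + b * ip nu p q2 + ip nu p q3.
  by rewrite ipDr // ipDr // ipCr // ipCr.
by rewrite (ball_form_sphlap bf) //; exact: comb.
Qed.

(** The adjoint of the s-th power of the Laplacian. *)
Fixpoint lapstars s mu q : P :=
  if s is s'.+1 then lapstar (mu + 2) (lapstars s' (mu + 2) q) else q.

Lemma ip_iter_lap s nu p q : mu0 <= nu ->
  ip (nu + (2 * s)%:R) (iter s (@lap R d) p) q = ip nu p (lapstars s nu q).
Proof.
elim: s nu p => [|s IH] nu p nu1; first by rewrite addr0.
rewrite iterSr /= -(ball_form_lap bf) // -IH //; last by lra.
by congr (ip _ _ _); rewrite mulnS natrD; lra.
Qed.

Lemma iter_sphlapP c p q b :
  iter b (@sphlap R d) (c *: p + q) = c *: iter b (@sphlap R d) p + iter b (@sphlap R d) q.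
Proof. by elim: b => //= b ->; rewrite linearP. Qed.

Lemma iter_lapP c p q b :
  iter b (@lap R d) (c *: p + q) = c *: iter b (@lap R d) p + iter b (@lap R d) q.
Proof. by elim: b => //= b ->; rewrite linearP. Qed.

Lemma iter_sphlapD p q b :
  iter b (@sphlap R d) (p + q) = iter b (@sphlap R d) p + iter b (@sphlap R d) q.
Proof. by rewrite -[p in LHS]scale1r iter_sphlapP scale1r. Qed.

Lemma iter_lapD p q b :
  iter b (@lap R d) (p + q) = iter b (@lap R d) p + iter b (@lap R d) q.
Proof. by rewrite -[p in LHS]scale1r iter_lapP scale1r. Qed.

Lemma sphlap_iter_lap (a : nat) p :
  sphlap (iter a (@lap R d) p) = iter a (@lap R d) (sphlap p).
Proof. by elim: a => //= a <-; rewrite lap_sphlap. Qed.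

Lemma orth_space_iter_sphlap nu k b p : mu0 <= nu ->
  orth_space nu k p -> orth_space nu k (iter b (@sphlap R d) p).
Proof. by move=> nu1 hp; elim: b => //= b; exact: orth_space_sphlap. Qed.

Lemma gtN1_addn nu n : mu0 <= nu -> mu0 <= nu + n%:R.
Proof. by move=> nu1; have := ler0n R n; lra. Qed.

Lemma orth_space_iter_lap nu k (a : nat) p : mu0 <= nu -> (2 * a <= k)%N ->
  orth_space nu k p ->
  orth_space (nu + (2 * a)%:R) (k - 2 * a) (iter a (@lap R d) p).
Proof.
move=> nu1 + hp; elim: a => [|a IH] ak; first by rewrite addr0 subn0.
have ak' : (2 * a <= k)%N by lia.
have -> : nu + (2 * a.+1)%:R = nu + (2 * a)%:R + 2 by rewrite mulnS natrD; lra.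
have -> : (k - 2 * a.+1 = k - 2 * a - 2)%N by lia.
by apply: orth_space_lap; [exact: gtN1_addn|lia|exact: IH].
Qed.

(** [lap_norm] at the successive exponents mu + 2 a and degrees k - 2 a yields the
    two comparisons that [double_interpolate] asks for, once each operator is
    divided by k^2; log-convexity of the powers of the symmetric operator
    [sphlap] is Cauchy-Schwarz. *)
Lemma orth_space_bound mu s : (2 <= d)%N -> mu0 <= mu -> (0 < s)%N ->
  exists2 C, 0 < C & forall k p, (2 * s < k)%N -> orth_space mu k p ->
    k%:R ^+ (4 * s) * ip mu p p <=
    C * (ip (mu + (2 * s)%:R) (iter s (@lap R d) p) (iter s (@lap R d) p) +
         ip mu (iter s (@sphlap R d) p) (iter s (@sphlap R d) p)).
Proof.
move=> d2 mu1 s0.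
have mu2 : -1 < mu by exact: lt_le_trans mu1.
have [[A1 A2] /= [A10 A20] hA] := shift_bounds s d2 mu2.
have [C C0 hC] := step_bounds A10 A20.
have [C' C'0 hC'] := double_interpolate s0 C0.
exists C' => // k p sk hp.
pose T a b := iter a (@lap R d) (iter b (@sphlap R d) p).
pose N a b := ip (mu + (2 * a)%:R) (T a b) (T a b).
have k0 : 0 < k%:R :> R by rewrite ltr0n; lia.
pose k2 : R := k%:R ^+ 2.
have k20 : 0 < k2 by rewrite exprn_gt0.
pose u a b := N a b / k2 ^+ (2 * (a + b)).
have N0 a b : 0 <= N a b by apply: (ball_form_ge0 bf); exact: gtN1_addn.
have u0 a b : 0 <= u a b by rewrite divr_ge0 // exprn_ge0 // ltW.
have step a b : (a < s)%N -> k2 ^+ 2 * N a b <= C * (N a.+1 b + N a b.+1) /\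
    N a.+1 b <= C * (k2 ^+ 2 * N a b + N a b.+1).
  move=> as_.
  have hk : (2 * a <= k)%N by lia.
  have hT : orth_space (mu + (2 * a)%:R) (k - 2 * a) (T a b).
    by apply: orth_space_iter_lap => //; exact: orth_space_iter_sphlap.
  have [hal hbe] := hA k a as_ sk.
  have nu1 := gtN1_addn (2 * a) mu1.
  have TE : sphlap (T a b) = T a b.+1 by rewrite /T sphlap_iter_lap.
  apply: (hC k2 _ _ (N a b) (N a b.+1) (N a.+1 b)
    (ip (mu + (2 * a)%:R) (T a b) (T a b.+1)) k20 hal hbe) => //.
    exact: ip_cauchy.
  have := lap_norm nu1 hT; rewrite /= TE => <-.
  by rewrite /N /T /= mulnS natrD; congr (ip _ _ _); lra.
have uE a b c : c = (a + b)%N -> N a b = k2 ^+ (2 * c) * u a b.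
  by move=> ->; rewrite /u mulrC divfK // expf_neq0 // gt_eqF.
have pow a b : 0 < k2 ^+ (2 * (a + b).+1) by rewrite exprn_gt0.
have powS a b : k2 ^+ (2 * (a + b).+1) = k2 ^+ 2 * k2 ^+ (2 * (a + b)).
  by rewrite -exprD; congr (_ ^+ _); lia.
have := hC' u u0.
have -> : u 0%N 0%N = ip mu p p.
  rewrite /u /N /T /=. by rewrite addr0 expr0 divr1.
have us0 : u s 0%N = ip (mu + (2 * s)%:R) (iter s (@lap R d) p) (iter s (@lap R d) p)
    / k%:R ^+ (4 * s).
  by rewrite /u /N /T /= addn0 /k2 -exprM; congr (_ / _ ^+ _); lia.
have u0s : u 0%N s = ip mu (iter s (@sphlap R d) p) (iter s (@sphlap R d) p)
    / k%:R ^+ (4 * s).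
  by rewrite /u /N /T /= addr0 add0n /k2 -exprM; congr (_ / _ ^+ _); lia.
clearbody u k2.
rewrite us0 u0s -mulrDl mulrA ler_pdivlMr ?exprn_gt0 // mulrC; apply.
- move=> b; rewrite -(@ler_pM2l _ (k2 ^+ (4 * b.+1))) ?exprn_gt0 //.
  have -> : k2 ^+ (4 * b.+1) * u 0%N b.+1 ^+ 2 = N 0%N b.+1 ^+ 2.
    by rewrite (uE 0%N b.+1 b.+1) // exprMn -exprM; congr (_ ^+ _ * _); lia.
  have -> : k2 ^+ (4 * b.+1) * (u 0%N b * u 0%N b.+2) = N 0%N b * N 0%N b.+2.
    rewrite (uE 0%N b b) // (uE 0%N b.+2 b.+2) // mulrACA -exprD.
    by congr (_ ^+ _ * _); lia.
  have nu1 := gtN1_addn (2 * 0) mu1.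
  have -> : N 0%N b.+1 = ip (mu + (2 * 0)%:R) (T 0%N b) (T 0%N b.+2).
    by rewrite /N {1}/T /= (ball_form_sphlap bf).
  exact: ip_cauchy.
- move=> a b as_; rewrite -(@ler_pM2l _ (k2 ^+ (2 * (a + b).+1))) //.
  have [h _] := step a b as_.
  rewrite {1}powS -mulrA -(uE a b) // mulrCA mulrDr.
  by rewrite -(uE a.+1 b) // -(uE a b.+1) // addnS.
- move=> a b as_; rewrite -(@ler_pM2l _ (k2 ^+ (2 * (a + b).+1))) //.
  have [_ h] := step a b as_.
  rewrite -(uE a.+1 b) // mulrCA mulrDr -(uE a b.+1) ?addnS //.
  by rewrite powS -mulrA -(uE a b).
Qed.

(** Monomials of degree less than k span, so [riesz_span] applies. *)
Lemma riesz_deg nu k (l : P -> R) (M : R) : mu0 <= nu ->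
  (forall a p q, l (a *: p + q) = a * l p + l q) ->
  (forall p, l p ^+ 2 <= M * ip nu p p) ->
  exists2 p, deg_lt k p & forall q, deg_lt k q -> ip nu p q = l q.
Proof.
move=> nu1 lP lM.
pose vs : seq P := [seq mpolyX R (m : multinom d) | m : bmultinom d k].
have vsP (m : multinom d) : (mdeg m < k)%N -> List.In (mpolyX R m) vs.
  move=> mk.
  have : (BMultinom mk) \in enum {: bmultinom d k} by rewrite mem_enum.
  rewrite /vs /image_mem; elim: (enum _) => //= m' ms IH.
  rewrite in_cons => /predU1P[<-|/IH]; [by left|by right].
have vs_deg p : List.In p vs -> deg_lt k p.
  rewrite /vs /image_mem; elim: (enum _) => //= m' ms IH [<-|/IH//].
  by apply: (deg_ltW (@deg_lt_X _ _ _)); exact: bmdeg.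
have [p pS pl] := @riesz_span R P (ip nu) (ball_formC bf nu)
  (fun a u v w => ball_formP bf a u v w nu1) (fun u => ball_form_ge0 bf u nu1) l M vs lP lM.
exists p.
  apply: (pS (deg_lt k)) => //; split; first exact: deg_lt0.
  by move=> a u v hu hv; apply: deg_ltD => //; exact: deg_ltZ.
move=> q hq; rewrite (deg_lt_monomials hq).
have l0 : l 0 = 0 by have := lP 1 0 0; rewrite scaler0 addr0 mul1r => h; lra.
elim/big_rec: _ => [|m r mk IH]; first by rewrite (ball_formC bf) ip0l // l0.
by rewrite (ball_formC bf) (ball_formP bf) // !(ball_formC bf _ _ p) lP IH pl //; exact: vsP.
Qed.

(** Induction on the degree: h splits into its projection on lower degree and a
    part of exact degree k > n, and [lap] and [sphlap] keep the two parts
    orthogonal, so that both sides are additive. *)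
Lemma orth_bound mu s : (2 <= d)%N -> mu0 <= mu -> (0 < s)%N ->
  exists2 C, 0 < C & forall n N h, (2 * s <= n)%N -> deg_lt N h ->
    (forall q, deg_lt n.+1 q -> ip mu h q = 0) ->
    n%:R ^+ (4 * s) * ip mu h h <=
    C * (ip (mu + (2 * s)%:R) (iter s (@lap R d) h) (iter s (@lap R d) h) +
         ip mu (iter s (@sphlap R d) h) (iter s (@sphlap R d) h)).
Proof.
move=> d2 mu1 s0; have [C C0 hC] := orth_space_bound d2 mu1 s0.
have nu1 := gtN1_addn (2 * s) mu1.
have rhs_ge0 h : 0 <= C *
    (ip (mu + (2 * s)%:R) (iter s (@lap R d) h) (iter s (@lap R d) h) +
     ip mu (iter s (@sphlap R d) h) (iter s (@sphlap R d) h)).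
  by apply: mulr_ge0; [exact: ltW|apply: addr_ge0; exact: (ball_form_ge0 bf)].
exists C => // n N h sn; elim: N h => [|k IH] h hN hn.
  have -> : h = 0 by apply/mpolyP => m; rewrite mcoeff0 hN.
  by rewrite ip0l // mulr0.
have [kn|nk] := leqP k n.
  by rewrite (hn h) ?mulr0 //; exact: (deg_ltW hN).
have [h' h'k h'P] := @riesz_deg mu k (ip mu h) (ip mu h h) mu1
   (fun a p q => etrans (ball_formC bf _ _ _) (etrans (ball_formP bf a p q h mu1)
      (congr2 (fun x y => a * x + y) (ball_formC bf _ _ _) (ball_formC bf _ _ _))))
   (fun p => ip_cauchy h p mu1).
pose p := h - h'.
have hE : h = p + h' by rewrite /p subrK.
have pk : orth_space mu k p.
  split; first by apply: deg_ltB => //; exact: (deg_ltW h'k).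
  move=> q hq; rewrite /p (ball_formC bf) ipBr // !(ball_formC bf _ q) h'P //.
  by rewrite subrr.
have h'n q : deg_lt n.+1 q -> ip mu h' q = 0.
  by move=> hq; rewrite h'P ?hn //; exact: (deg_ltW hq).
have pyth nu q r : mu0 <= nu -> ip nu q r = 0 ->
    ip nu (q + r) (q + r) = ip nu q q + ip nu r r.
  by move=> nu1' qr; rewrite ipDl // !ipDr // (ball_formC bf _ r q) qr addr0 add0r.
have ks : (2 * s < k)%N by apply: leq_ltn_trans nk.
clearbody p; rewrite {}hE in hn hN *.
rewrite iter_lapD iter_sphlapD !pyth //.
- have := IH h' h'k h'n; have := hC k p ks pk.
  have : n%:R ^+ (4 * s) * ip mu p p <= k%:R ^+ (4 * s) * ip mu p p.
    rewrite ler_wpM2r ?(ball_form_ge0 bf) // lerXn2r ?nnegrE ?ler0n // ler_nat ltnW //.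
  move=> h1 h2 h3; rewrite mulrDr; have := lerD (le_trans h1 h2) h3.
  by move/le_trans; apply; rewrite -mulrDr ler_pM2l // addrACA.
- by apply: (orth_space_iter_sphlap s mu1 pk).2; exact: deg_lt_iter_sphlap.
- by apply: (orth_space_iter_lap mu1 (ltnW ks) pk).2; exact: deg_lt_iter_lap.
- by apply: pk.2.
Qed.

End spectral.

(** * Borel sets and polynomial functions *)
Section borel_rV.
Context {R : realType} {d : nat}.
Local Notation E := 'rV[R]_d.

Lemma ball_rVP (x y : E) (e : R) : 0 < e ->
  (forall i, `|x 0 i - y 0 i| < e) -> ball x e y.
Proof.
by move=> e0 h; split => // i j; rewrite ord1; exact: h.
Qed.

(** An open set is the union of the countably many rational cubes it contains,
    and cubes are measurable for the sigma-algebra of the coordinates. *)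
Lemma open_measurable_rV (U : set E) : open U -> measurable U.
Proof.
move=> oU.
pose B (p : 'rV[rat]_d * nat) : set E :=
  [set x | forall i, `|x 0 i - ratr (p.1 0 i)| < p.2.+1%:R^-1].
have mB p : measurable (B p).
  have -> : B p = \bigcap_(i in [set: 'I_d])
      (fun x : E => x 0 i) @^-1` ball (ratr (p.1 0 i) : R) p.2.+1%:R^-1.
    apply/seteqP; split => x /=.
      by move=> Bx i _; rewrite /preimage /ball /= distrC; exact: Bx.
    by move=> Bx i; have := Bx i I; rewrite /preimage /ball /= distrC.
  apply: fin_bigcap_measurable; first exact: finite_finset.
  move=> i _; rewrite -[X in measurable X]setTI; apply: measurable_coord => //.
  by apply: open_measurable; exact: ball_open.
pose C p := if `[< B p `<=` U >] then B p else set0.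
have -> : U = \bigcup_p C p.
  apply/seteqP; split => [x Ux|x [p _]]; last first.
    by rewrite /C; case: asboolP => // h; exact: h.
  have : nbhs x U by exact: open_nbhs_nbhs.
  move=> /nbhs_ballP[e /= e0 xeU].
  have e20 : 0 < e / 2 by rewrite divr_gt0.
  have [k _ /(_ k (leqnn k)) /= ke] := near_infty_natSinv_lt (PosNum e20).
  have k0 : 0 < k.+1%:R^-1 :> R by rewrite invr_gt0.
  have /choice[q hq] i : exists r : rat, ratr r \in `]x 0 i - k.+1%:R^-1, x 0 i + k.+1%:R^-1[.
    have lt i' : x 0 i' - k.+1%:R^-1 < x 0 i' + k.+1%:R^-1.
      by rewrite ltrD2l gtrN.
    by have [r hr] := rat_in_itvoo (lt i); exists r.
  have hq' i : `|x 0 i - ratr (q i)| < k.+1%:R^-1.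
    by rewrite ltr_distlC; have := hq i; rewrite in_itv.
  exists (\row_i q i, k) => //; rewrite /C; case: asboolP => [_ i|].
    by rewrite mxE.
  case; move=> y By; apply: xeU; apply: ball_rVP => // i.
  have := By i; rewrite /= mxE => hy.
  have -> : x 0 i - y 0 i = (x 0 i - ratr (q i)) - (y 0 i - ratr (q i)) by ring.
  rewrite (le_lt_trans (ler_normB _ _)) // [e]splitr ltrD // (lt_trans _ ke) //.
apply: countable_bigcupT_measurable; first exact: countableP.
by move=> p; rewrite /C; case: asboolP.
Qed.

Lemma closed_measurable_rV (A : set E) : closed A -> measurable A.
Proof.
move=> cA; rewrite -[A]setCK; apply: measurableC; apply: open_measurable_rV.
exact: closed_openC.
Qed.

Lemma compact_measurable_rV (A : set E) : compact A -> measurable A.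
Proof.
by move=> cA; apply: closed_measurable_rV; apply: compact_closed => //; exact: norm_hausdorff.
Qed.

Lemma continuous_measurable_rV (f : E -> R) : continuous f -> measurable_fun setT f.
Proof.
move=> cf; apply: (measurability _ (RGenOpens.measurableE R)).
move=> /= _ [_ [a [b ->]] <-]; rewrite setTI; apply: open_measurable_rV.
by apply: open_comp => // x _; exact: cf.
Qed.

End borel_rV.

Section polynomial_functions.
Context {R : realType} {d : nat}.
Local Notation E := 'rV[R]_d.
Local Notation P := (mpoly d R).
Implicit Types (p q : P) (x : E).

Definition peval p : E -> R := fun x => meval (x 0) p.

(** Polynomials are generated by constants and variables as a ring. *)
Lemma mpoly_ring_ind (Q : P -> Prop) : (forall c, Q (mpolyC d c)) ->
  (forall i, Q (xvar R i)) -> (forall p q, Q p -> Q q -> Q (p + q)) ->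
  (forall p q, Q p -> Q q -> Q (p * q)) -> forall p, Q p.
Proof.
move=> QC QX QD QM p; rewrite (mpolyE p).
have Q0 : Q 0 by rewrite -(mpolyC0 d R).
have Q1 : Q 1 by rewrite -(mpolyC1 d R).
elim/big_ind: _ => // m _; rewrite -mul_mpolyC; apply: (QM _ _ (QC _)).
rewrite mpolyXE_id; elim/big_ind: _ => // i _.
by elim: (m i) => [|k IH]; rewrite ?expr0 // exprS; apply: QM => //; exact: QX.
Qed.

Lemma pevalD p q x : peval (p + q) x = peval p x + peval q x.
Proof. exact: mevalD. Qed.
Lemma pevalB p q x : peval (p - q) x = peval p x - peval q x.
Proof. exact: mevalB. Qed.
Lemma pevalM p q x : peval (p * q) x = peval p x * peval q x.
Proof. exact: mevalM. Qed.
Lemma pevalC c x : peval (mpolyC d c) x = c.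
Proof. exact: mevalC. Qed.
Lemma peval1 x : peval 1 x = 1.
Proof. exact: meval1. Qed.
Lemma pevalZ c p x : peval (c *: p) x = c * peval p x.
Proof. exact: mevalZ. Qed.
Lemma pevalX i x : peval (xvar R i) x = x 0 i.
Proof. exact: mevalXU. Qed.
Lemma pevalsum (I : Type) (r : seq I) (S : pred I) (F : I -> P) x :
  peval (\sum_(i <- r | S i) F i) x = \sum_(i <- r | S i) peval (F i) x.
Proof. exact: (raddf_sum (meval (x 0))). Qed.

Lemma peval_rsq x : peval (rsq R d) x = sqnorm2 x.
Proof.
rewrite /rsq pevalsum; apply: eq_bigr => i _.
by rewrite expr2 pevalM pevalX.
Qed.

Lemma differentiable_peval p x : differentiable (peval p) x.
Proof.
elim/mpoly_ring_ind: p => [c|i|p q hp hq|p q hp hq].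
- rewrite (_ : peval _ = cst c); last by apply/funext => y; rewrite pevalC.
  exact: differentiable_cst.
- rewrite (_ : peval _ = fun y : E => y 0 i); last by apply/funext => y; rewrite pevalX.
  exact: differentiable_coord.
- rewrite (_ : peval _ = peval p + peval q); last by apply/funext => y; rewrite pevalD.
  exact: differentiableD.
- rewrite (_ : peval _ = peval p * peval q); last by apply/funext => y; rewrite pevalM.
  exact: differentiableM.
Qed.

Lemma continuous_peval p : continuous (peval p).
Proof. move=> x; apply: differentiable_continuous; exact: differentiable_peval. Qed.

Lemma is_derive_coord i j x :
  is_derive x (delta_mx 0 j) (fun y : E => y 0 i) ((i == j)%:R : R).
Proof.
have E0 : (fun h : R => h^-1 *: (((fun y : E => y 0 i) \o shift x) (h *: delta_mx 0 j) - x 0 i))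
    = (fun h : R => h^-1 * (h * (i == j)%:R)).
  by apply/funext => h /=; rewrite !mxE addrK.
have lim0 : (fun h : R => h^-1 * (h * (i == j)%:R)) h @[h --> 0^'] --> ((i == j)%:R : R).
  apply: cvg_near_cst; near=> h; rewrite mulrA mulVf ?mul1r //.
  by near: h; exact: nbhs_dnbhs_neq.
split; first by rewrite /derivable E0; apply/cvg_ex; exists (i == j)%:R.
by rewrite /derive E0; exact: cvg_lim.
Unshelve. all: by end_near. Qed.

Lemma is_derive_peval p j x :
  is_derive x (delta_mx 0 j) (peval p) (peval (mderiv j p) x).
Proof.
elim/mpoly_ring_ind: p => [c|i|p q hp hq|p q hp hq].
- rewrite mderivC (_ : peval (mpolyC d c) = cst c); last by apply/funext => y; rewrite pevalC.
  by rewrite -(mpolyC0 d R) pevalC; exact: is_derive_cst.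
- rewrite (_ : peval (xvar R i) = fun y : E => y 0 i); last by apply/funext => y; rewrite pevalX.
  rewrite mderiv_xvar -mpolyC_nat pevalC eq_sym; exact: is_derive_coord.
- rewrite (_ : peval (p + q) = peval p + peval q); last by apply/funext => y; rewrite pevalD.
  by rewrite mderivD pevalD; exact: is_deriveD.
- rewrite (_ : peval (p * q) = peval p * peval q); last by apply/funext => y; rewrite pevalM.
  apply: is_derive_eq; rewrite mderivM pevalD !pevalM /= -!/(_ * _).
  by rewrite addrC mulrC.
Qed.

Lemma continuous_sqnorm2 : continuous (@sqnorm2 R d).
Proof. by rewrite -(funext peval_rsq); exact: continuous_peval. Qed.

End polynomial_functions.

(** * Integrals of partial derivatives *)
Section slices.
Context {R : realType} (n : nat).

Local Notation RxRn := (measurableTypeR R * 'rV[R]_n)%type.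
Local Notation prodleb := (@lebesgue_measure R \x lebesgue_rV n)%E.

Let mcons : measurable_fun [set: RxRn] (@cons_rV R n : RxRn -> 'rV[R]_n.+1).
Proof. exact: measurable_cons_rV. Qed.

Lemma integral_rVS (f : 'rV[R]_n.+1 -> \bar R) : measurable_fun setT f ->
  (lebesgue_measure \x lebesgue_rV n)%E.-integrable setT (f \o @cons_rV R n) ->
  (\int[lebesgue_rV n.+1]_x f x =
   \int[(lebesgue_measure \x lebesgue_rV n)%E]_p f (cons_rV p))%E.
Proof.
move=> mf intf.
have := @integral_pushforward _ _ _ _ _ _ mcons prodleb setT f mf.
rewrite preimage_setT => /(_ intf measurableT) <-; exact: eq_measure_integral.
Qed.

Lemma ge0_integral_rVS (f : 'rV[R]_n.+1 -> \bar R) : measurable_fun setT f ->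
  (forall x, 0 <= f x)%E ->
  (\int[lebesgue_rV n.+1]_x f x =
   \int[(lebesgue_measure \x lebesgue_rV n)%E]_p f (cons_rV p))%E.
Proof.
move=> mf f0.
have := @ge0_integral_pushforward _ _ _ _ _ _ mcons prodleb setT f measurableT mf.
rewrite preimage_setT => /(_ (fun y _ => f0 y)) <-; exact: eq_measure_integral.
Qed.

End slices.

(** The chain rule along an affine map, for one directional derivative of f. *)
Lemma is_derive_line (R : numFieldType) (V1 V2 W : normedModType R) (a : V1 -> V2)
    (f : V2 -> W) (x v : V1) (w : V2) (df : W) :
  (forall h : R, a (h *: v + x) = h *: w + a x) ->
  is_derive (a x) w f df -> is_derive x v (f \o a) df.
Proof.
move=> ha [dfx dfE].
have E : (fun h : R => h^-1 *: (((f \o a) \o shift x) (h *: v) - (f \o a) x)) =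
         (fun h : R => h^-1 *: ((f \o shift (a x)) (h *: w) - f (a x))).
  by apply/funext => h /=; rewrite ha.
split; first by rewrite /derivable E.
by rewrite /derive E.
Qed.

Section integration_by_parts.
Context {R : realType}.

(** The unit ball of the sup norm: a bounded set that slices well and contains
    the Euclidean ball. *)
Definition cube (n : nat) : set 'rV[R]_n := [set x | forall i, x 0 i \in `[(-1), 1]].
Arguments cube : clear implicits.

Lemma cubePn n (x : 'rV[R]_n) : ~ cube n x -> exists i, 1 < `|x 0 i|.
Proof.
move=> /existsNP[i xi]; exists i; rewrite ltNge; apply/negP => h; apply: xi.
by rewrite in_itv /= -ler_norml.
Qed.

Lemma compact_cube n : compact (cube n).
Proof. exact: (@rV_compact R n (fun=> `[(-1), 1]%classic) (fun=> @segment_compact R _ _)). Qed.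

Lemma cube_fin n : (lebesgue_rV n (cube n) < +oo)%E.
Proof.
rewrite (lebesgue_rV_box (A := fun=> `[(-1), 1]%classic)) //.
have E : lebesgue_measure `[(-1 : R), 1]%classic = (1 - (-1))%:E.
  rewrite lebesgue_measure_itv /= lte_fin ifT ?EFinB //.
by under eq_bigr do rewrite E; rewrite prodEFin ltry.
Qed.

Lemma cons_rV_delta n (h t : R) (y : 'rV[R]_n) :
  cons_rV (h + t, y) = h *: delta_mx 0 ord0 + cons_rV (t, y).
Proof.
apply/rowP => i; rewrite [RHS]mxE [X in _ = X + _]mxE.
case: (unliftP ord0 i) => [j|] ->.
  by rewrite !cons_rVS /= mxE mulr0 add0r.
by rewrite !cons_rV0 /= mxE mulr1.
Qed.

Lemma cons_rV_deltaS n (h t : R) (y : 'rV[R]_n) j :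
  cons_rV (t, h *: delta_mx 0 j + y) = h *: delta_mx 0 (lift ord0 j) + cons_rV (t, y).
Proof.
apply/rowP => i; rewrite [RHS]mxE [X in _ = X + _]mxE.
case: (unliftP ord0 i) => [k|] ->.
  by rewrite !cons_rVS !mxE (inj_eq (@lift_inj _ ord0)).
by rewrite !cons_rV0 /= mxE mulr0 add0r.
Qed.

Lemma continuous_cons_rV n (t : R) : continuous (fun y : 'rV[R]_n => cons_rV (t, y)).
Proof.
move=> y A /nbhs_ballP[e e0 eA]; apply/nbhs_ballP; exists e => //= z [_ yz].
apply: eA; apply: ball_rVP => // j.
case: (unliftP ord0 j) => [k|] ->; last by rewrite !cons_rV0 subrr normr0.
by rewrite !cons_rVS; exact: yz.
Qed.

Lemma continuous_cons_rV0 n (y : 'rV[R]_n) : continuous (fun t : R => cons_rV (t, y)).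
Proof.
move=> t A /nbhs_ballP[e e0 eA]; apply/nbhs_ballP; exists e => //= z tz.
apply: eA; apply: ball_rVP => // j.
case: (unliftP ord0 j) => [k|] ->; first by rewrite !cons_rVS subrr normr0.
by rewrite !cons_rV0.
Qed.

Section supported_in_cube.
Context {n : nat}.
Variables (phi g : 'rV[R]_n -> R) (j : 'I_n).
Hypothesis cg : continuous g.
Hypothesis dphi : forall x, is_derive x (delta_mx 0 j) phi (g x).
Hypothesis phi0 : forall x, ~ cube n x -> phi x = 0.

Lemma derive_eq0_off_cube x : ~ cube n x -> g x = 0.
Proof.
move=> /cubePn[i xi]; rewrite -(@derive_val _ _ _ _ _ _ _ (dphi x)).
rewrite (@near_eq_derive _ _ _ _ (cst 0)) ?derive_cst //.
apply/nbhs_ballP; exists (`|x 0 i| - 1) => /=; first by rewrite subr_gt0.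
move=> y [_ xy]; apply: phi0 => /(_ i); rewrite in_itv /= -ler_norml => yi.
have := xy 0 i; rewrite /ball /= ltrBrDl => h.
have := ler_distD 0 (x 0 i) (y 0 i); rewrite !subr0 sub0r normrN => _.
have : `|x 0 i| <= `|y 0 i| + `|x 0 i - y 0 i|.
  by rewrite -{1}[x 0 i](subrK (y 0 i)) addrC (le_trans (ler_normD _ _)).
move=> h2; have := lt_le_trans h h2; rewrite ltrD2r ltNge yi //.
Qed.

Lemma bounded_off_cube : exists M, forall x, `|g x| <= M.
Proof.
have := compact_bounded (@continuous_compact _ _ _ _ (continuous_subspaceT cg) (@compact_cube n)).
move=> [M [_ hM]]; exists (`|M| + 1) => x.
have [cx|cx] := pselect (cube n x).
  by apply: (hM (`|M| + 1)); [rewrite ltr_pwDr // ler_norm|exists x].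
by rewrite derive_eq0_off_cube // normr0 addr_ge0.
Qed.

Lemma integrable_off_cube : (lebesgue_rV n).-integrable setT (EFin \o g).
Proof.
have [M gM] := bounded_off_cube.
have mc : measurable (cube n).
  by apply: compact_measurable_rV; exact: compact_cube.
have -> : EFin \o g = (EFin \o g) \_ (cube n).
  apply/funext => x; rewrite patchE; case: ifPn => // /negP; rewrite inE => h.
  by rewrite /= derive_eq0_off_cube.
apply/(integrable_mkcond _ mc); apply: measurable_bounded_integrable => //.
- exact: cube_fin.
- by apply: measurable_funTS; exact: continuous_measurable_rV.
- by exists M; split; [exact: num_real|move=> K MK x _; apply: (le_trans (gM x)); exact: ltW].
Qed.

End supported_in_cube.

(** The fundamental theorem of calculus on a segment outside of which F vanishes. *)
Lemma integral_derive_slice (F f : R -> R) : continuous f ->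
  (forall t : R, is_derive t (1 : R) F (f t)) -> (forall t, 1 < `|t| -> F t = 0) ->
  (forall t, 1 < `|t| -> f t = 0) ->
  (\int[lebesgue_measure]_t (f t)%:E = 0)%E.
Proof.
move=> cf dF F0 f0.
have h2 : 1 < `|2 : R| by rewrite normr_nat ltr1n.
have -> : (fun t => (f t)%:E) = (EFin \o f) \_ `[(- 2 : R), 2]%classic.
  apply/funext => t; rewrite patchE; case: ifPn => // /negP; rewrite inE /= in_itv /=.
  rewrite -ler_norml => /negP; rewrite -ltNge => h.
  by rewrite f0 // (lt_trans _ h) // ltr1n.
rewrite -integral_mkcond.
have dF1 t : derivable F t 1 by exact: ex_derive.
have cF : continuous F by move=> t; apply: differentiable_continuous; exact/derivable1_diffP.
rewrite (@continuous_FTC2 _ f F).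
- by rewrite F0 // F0 ?normrN // subee.
- by rewrite gtrN.
- exact: continuous_subspaceT.
- split => //.
  + by apply: cvg_at_right_filter; exact: cF.
  + by apply: cvg_at_left_filter; exact: cF.
- by move=> t _; rewrite derive1E; exact: derive_val.
Qed.

(** Fubini along the first coordinate: if it is the direction j, each slice is
    handled by [integral_derive_slice], otherwise the slices are functions of
    fewer variables. *)
Lemma integral_partial0 n (j : 'I_n) (phi g : 'rV[R]_n -> R) :
  continuous g -> (forall x, is_derive x (delta_mx 0 j) phi (g x)) ->
  (forall x, ~ cube n x -> phi x = 0) ->
  (\int[lebesgue_rV n]_x (g x)%:E = 0)%E.
Proof.
elim: n j phi g => [[]//|n IH] j phi g cg dphi phi0.
have mg : measurable_fun setT (EFin \o g).
  by apply/measurable_EFinP; exact: continuous_measurable_rV.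
have intg := integrable_off_cube cg dphi phi0.
have intp : (lebesgue_measure \x lebesgue_rV n)%E.-integrable setT
    ((EFin \o g) \o @cons_rV R n).
  apply/integrableP; split.
    apply: (measurableT_comp mg); exact: measurable_cons_rV.
  move/integrableP : intg => [_]; rewrite ge0_integral_rVS //.
  exact: measurableT_comp.
rewrite integral_rVS //.
have ncube t y : 1 < `|t| -> ~ cube n.+1 (cons_rV (t, y)).
  move=> t1 /(_ ord0); rewrite cons_rV0 in_itv /= -ler_norml.
  by rewrite leNgt t1.
have ncubeS t y : ~ cube n y -> ~ cube n.+1 (cons_rV (t, y)).
  by move=> ny cy; apply: ny => i; have := cy (lift ord0 i); rewrite cons_rVS.
case: (unliftP ord0 j) => [j'|] jE; subst j.
- rewrite -(integral12_prod_meas1 intp) /fubini_F /=.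
  apply: integral0_eq => t _.
  apply: (IH j' (phi \o fun y => cons_rV (t, y))).
  + by move=> y; apply: continuous_comp; [exact: continuous_cons_rV|exact: cg].
  + move=> y; apply: is_derive_line (dphi _) => h; exact: cons_rV_deltaS.
  + by move=> y ny; apply: phi0; exact: ncubeS.
- rewrite -(integral21_prod_meas1 intp) /fubini_G /=.
  apply: integral0_eq => y _.
  apply: (@integral_derive_slice (phi \o fun t => cons_rV (t, y))).
  + by move=> t; apply: continuous_comp; [exact: continuous_cons_rV0|exact: cg].
  + move=> t; apply: is_derive_line (dphi _) => h /=.
    by rewrite -cons_rV_delta -[h *: 1]/(h * 1) mulr1.
  + by move=> t t1; apply: phi0; exact: ncube.
  + by move=> t t1; apply: (derive_eq0_off_cube dphi phi0); exact: ncube.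
Qed.

Lemma sqnorm2_cons n t (y : 'rV[R]_n) : sqnorm2 (cons_rV (t, y)) = t ^+ 2 + sqnorm2 y.
Proof.
rewrite /sqnorm2 big_ord_recl cons_rV0; congr (_ + _).
by apply: eq_bigr => i _; rewrite cons_rVS.
Qed.

(** Lines parallel to the first axis meet the sphere in at most two points. *)
Lemma sphere_null n : lebesgue_rV n.+1 [set x : 'rV[R]_n.+1 | sqnorm2 x = 1] = 0%E.
Proof.
set S := [set x | _].
have mS : measurable S.
  apply: closed_measurable_rV; rewrite (_ : S = @sqnorm2 R n.+1 @^-1` [set 1]) //.
  by apply: preimage_closed => [x _|]; [exact: continuous_sqnorm2|exact: closed_eq].
have mi : measurable_fun setT (fun x => (\1_S x)%:E : \bar R).
  exact/measurable_EFinP/measurable_indic.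
rewrite -[S]setIT -integral_indic // ge0_integral_rVS //.
rewrite fubini_tonelli2 //.
apply: integral0_eq => y _; rewrite /fubini_G /=.
pose a := Num.sqrt (1 - sqnorm2 y).
have sec (t : R) : S (cons_rV (t, y)) -> t \in [:: a; - a].
  rewrite /S /= sqnorm2_cons => h.
  have : t ^+ 2 = a ^+ 2 by rewrite sqr_sqrtr; [lra|have := sqr_ge0 t; lra].
  by move=> /eqP; rewrite eqf_sqr !inE.
rewrite (_ : (fun t : R => _) = fun t : R => (\1_((fun t => cons_rV (t, y)) @^-1` S) t)%:E) //.
have sub : (fun t : R => cons_rV (t, y)) @^-1` S `<=` [set` [:: a; - a]].
  by move=> t /sec.
have cnt : countable ((fun t : R => cons_rV (t, y)) @^-1` S).
  by apply: sub_countable (finite_set_countable (finite_seq [:: a; - a])); exact: subset_card_le.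
rewrite integral_indic ?setIT //; first exact: countable_lebesgue_measure0.
  exact: countable_measurable.
by apply: (measurableT_comp mi); exact: measurable_cons_rV.
Qed.

End integration_by_parts.

(** * Symmetry of mixed partial derivatives *)
Section mixed_partials.
Context {R : realType} {d : nat}.
Local Notation E := 'rV[R]_d.
Implicit Types (phi psi g : E -> R) (x y : E) (i j : 'I_d).
Local Notation e_ i := (delta_mx 0 i : E).

Lemma line_MVT i psi g x (h : R) : 0 < h ->
  (forall y, is_derive y (e_ i) psi (g y)) ->
  exists2 xi, 0 <= xi <= h & psi (h *: e_ i + x) - psi x = h * g (xi *: e_ i + x).
Proof.
move=> h0 dpsi.
pose a (t : R) : E := t *: e_ i + x.
have da (t : R) : is_derive t (1 : R) (psi \o a) (g (a t)).
  apply: is_derive_line (dpsi _) => k.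
  by rewrite /a scalerDl -[k *: 1]/(k * 1) mulr1 addrA.
have ca : continuous (psi \o a).
  move=> t; apply: differentiable_continuous; apply/derivable1_diffP.
  exact: ex_derive.
have [xi] := @MVT R (psi \o a) (g \o a) 0 h h0 (fun t _ => da t) (continuous_subspaceT ca).
rewrite in_itv /= => /andP[x0 xh] E0; exists xi; first by rewrite !ltW.
by move: E0; rewrite /= /a scale0r add0r subr0 mulrC.
Qed.

Lemma is_derive_partial i phi x : differentiable phi x ->
  is_derive x (e_ i) phi (partial i phi x).
Proof. by move=> dphi; split => //; exact: diff_derivable. Qed.

(** The mean value theorem, applied first in the direction i to a difference in
    the direction j and then in the direction j. *)
Lemma second_difference phi i j x (h : R) : 0 < h ->
  (forall y, differentiable phi y) -> (forall y, differentiable (partial i phi) y) ->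
  exists2 y, ball x (2 * h + h) y &
    phi (h *: e_ j + (h *: e_ i + x)) - phi (h *: e_ i + x) - (phi (h *: e_ j + x) - phi x)
    = h * h * partial j (partial i phi) y.
Proof.
move=> h0 dphi d2phi.
pose psi y := phi (h *: e_ j + y) - phi y.
have dpsi y : is_derive y (e_ i) psi (partial i phi (h *: e_ j + y) - partial i phi y).
  apply: (@is_deriveB _ _ _ (phi \o (fun y => h *: e_ j + y)) phi).
    apply: is_derive_line (is_derive_partial _ (dphi _)) => k.
    by rewrite addrCA.
  exact: is_derive_partial.
have [xi /andP[xi0 xih] E1] := line_MVT x h0 dpsi.
have [et /andP[et0 eth] E2] := line_MVT (xi *: e_ i + x) h0
  (fun y => is_derive_partial j (d2phi y)).
exists (et *: e_ j + (xi *: e_ i + x)); last first.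
  by rewrite -[LHS]/(psi (h *: e_ i + x) - psi x) E1 E2 mulrA.
apply: ball_rVP; first by rewrite !addr_gt0 ?mulr_gt0.
move=> k; rewrite !mxE !eqxx /= distrC addrA addrK.
have b (c : R) (b : bool) : 0 <= c <= h -> 0 <= c * b%:R <= h.
  by case: b => /andP[c0 ch]; rewrite ?mulr1 ?mulr0 ?c0 ?ch // lexx ltW.
have /andP[b1 b2] := b et (k == j) (introT andP (conj et0 eth)).
have /andP[b3 b4] := b xi (k == i) (introT andP (conj xi0 xih)).
by rewrite ger0_norm ?addr_ge0 //; lra.
Qed.

(** The second difference is symmetric in i and j, so by [second_difference] both
    mixed derivatives take a common value at two points near x; continuity
    concludes. *)
Lemma partialC phi i j x : (forall l y, differentiable (foldr partial phi l) y) ->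
  partial j (partial i phi) x = partial i (partial j phi) x.
Proof.
move=> sm; apply/eqP; rewrite -subr_eq0; apply/eqP/eqP; rewrite -normr_le0.
apply/ler_addgt0Pl => e e0; rewrite addr0.
have e20 : 0 < e / 2 by rewrite divr_gt0.
have c1 : continuous (partial j (partial i phi)).
  by move=> y; apply: differentiable_continuous; exact: (sm [:: j; i]).
have c2 : continuous (partial i (partial j phi)).
  by move=> y; apply: differentiable_continuous; exact: (sm [:: i; j]).
have /nbhs_ballP[r1 /= r10 h1] := c1 x _ (nbhsx_ballx _ _ e20).
have /nbhs_ballP[r2 /= r20 h2] := c2 x _ (nbhsx_ballx _ _ e20).
pose h := Num.min r1 r2 / 3.
have h0 : 0 < h by rewrite divr_gt0 // lt_min r10.
have h3 : 2 * h + h = Num.min r1 r2 by rewrite /h; lra.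
have [y xy E1] := @second_difference phi i j x h h0 (sm [::]) (sm [:: i]).
have [z xz E2] := @second_difference phi j i x h h0 (sm [::]) (sm [:: j]).
rewrite h3 in xy xz.
have m1 : Num.min r1 r2 <= r1 by rewrite ge_min lexx.
have m2 : Num.min r1 r2 <= r2 by rewrite ge_min lexx orbT.
have := h1 y (le_ball m1 xy).
have := h2 z (le_ball m2 xz).
rewrite /preimage /ball /=.
have -> : partial i (partial j phi) z = partial j (partial i phi) y.
  have hh : h * h != 0 by rewrite mulf_neq0 // gt_eqF.
  have swap (a b c k : R) : a - b - (c - k) = a - c - (b - k) by ring.
  apply: (mulfI hh); apply: etrans (esym E2) (etrans _ E1).
  by rewrite [h *: e_ i + (h *: e_ j + x)](addrCA (h *: e_ i)); exact: swap.
move: (partial i (partial j phi) x) (partial j _ x) (partial j _ y) => a b c k1 k2.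
rewrite -[b](subrK c) -addrA (le_trans (ler_normD _ _)) // [e]splitr.
by rewrite lerD // ltW // distrC.
Qed.

End mixed_partials.

(** * Test functions *)
Section test_functions.
Context {R : realType} {d : nat}.
Local Notation E := 'rV[R]_d.
Local Notation leb := (lebesgue_rV d).
Implicit Types (f g h phi psi : E -> R) (x y : E) (i j : 'I_d).

Definition smooth phi := forall (l : seq 'I_d) (x : E), differentiable (foldr partial phi l) x.

(** Smoothness by coinduction: membership in a class of differentiable functions
    that is stable under partial derivatives. *)
Lemma smooth_coind (S : (E -> R) -> Prop) phi :
  (forall psi, S psi -> forall x, differentiable psi x) ->
  (forall psi i, S psi -> S (partial i psi)) -> S phi -> smooth phi.
Proof.
move=> Sd Sp Sphi l x; apply: Sd; elim: l => //= i l IH; exact: Sp.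
Qed.

Lemma smooth_partial i phi : smooth phi -> smooth (partial i phi).
Proof. by move=> sphi l x; rewrite -foldr_rcons; exact: sphi. Qed.

Lemma smooth_continuous phi : smooth phi -> continuous phi.
Proof. by move=> sphi x; apply: differentiable_continuous; exact: (sphi [::]). Qed.

Lemma smooth_is_derive i phi x : smooth phi -> is_derive x (delta_mx 0 i) phi (partial i phi x).
Proof. by move=> sphi; apply: is_derive_partial; exact: (sphi [::]). Qed.

Lemma partial_eq i phi g : (forall x, is_derive x (delta_mx 0 i) phi (g x)) -> partial i phi = g.
Proof. by move=> h; apply/funext => x; rewrite /partial; exact: derive_val. Qed.

Lemma smoothD_scale (c : R) phi psi : smooth phi -> smooth psi ->
  smooth (fun x => phi x + c * psi x).
Proof.
move=> sphi spsi.
pose S (ch : E -> R) := exists a b, [/\ smooth a, smooth b & ch = fun x => a x + c * b x].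
have SE a b : (fun x => a x + c * b x) = a + c *: b :> (E -> R) by [].
apply: (smooth_coind (S := S)); last by exists phi, psi.
- move=> _ [a [b [sa sb ->]]] x; rewrite SE; apply: differentiableD.
    exact: (sa [::]).
  by apply: differentiableZ; exact: (sb [::]).
- move=> _ i [a [b [sa sb ->]]]; exists (partial i a), (partial i b).
  split; [exact: smooth_partial|exact: smooth_partial|].
  apply: partial_eq => x; rewrite SE; apply: is_deriveD; first exact: smooth_is_derive.
  by apply: is_deriveZ; exact: smooth_is_derive.
Qed.

Lemma partial_coordM k i phi : smooth phi ->
  partial i (fun x => x 0 k * phi x) = fun x => x 0 k * partial i phi x + (k == i)%:R * phi x.
Proof.
move=> sphi; apply: partial_eq => x.
rewrite (_ : (fun x : E => _) = (fun y : E => y 0 k) * phi) //.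
apply: is_derive_eq.
  by apply: is_deriveM; [exact: is_derive_coord|exact: smooth_is_derive].
by congr (_ + _); exact: mulrC.
Qed.

Lemma smooth_coordM k phi : smooth phi -> smooth (fun x => x 0 k * phi x).
Proof.
move=> sphi.
pose S (ch : E -> R) := exists a b, [/\ smooth a, smooth b & ch = fun x => x 0 k * a x + b x].
have sm0 : smooth (fun x => phi x + (-1) * phi x) by exact: smoothD_scale.
apply: (smooth_coind (S := S)); last first.
  exists phi, (fun x => phi x + (-1) * phi x); split => //.
  by apply/funext => x; rewrite mulN1r subrr addr0.
- move=> _ i [a [b [sa sb ->]]].
  exists (partial i a), (fun x => partial i b x + (k == i)%:R * a x).
  split; [exact: smooth_partial|apply: smoothD_scale => //; exact: smooth_partial|].
  apply: partial_eq => x.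
  have -> : (fun x : E => x 0 k * a x + b x) = (fun x => x 0 k * a x) + b by [].
  apply: is_derive_eq.
    apply: is_deriveD; last exact: smooth_is_derive.
    rewrite (_ : (fun x : E => _) = (fun y : E => y 0 k) * a) //.
    by apply: is_deriveM; [exact: is_derive_coord|exact: smooth_is_derive].
  rewrite [_ *: partial i a x]/(_ * _) [a x *: _]mulrC.
  by rewrite -addrA [_ + partial i b x]addrC.
- move=> _ [a [b [sa sb ->]]] x.
  have -> : (fun x : E => x 0 k * a x + b x) = (fun x => x 0 k) * a + b by [].
  apply: differentiableD; last exact: (sb [::]).
  by apply: differentiableM; [exact: differentiable_coord|exact: (sa [::])].
Qed.

(** Schwarz's theorem for sequences of directions, by moving one direction at a
    time to the front. *)
Lemma foldr_partial_perm phi (s1 s2 : seq 'I_d) : smooth phi ->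
  perm_eq s1 s2 -> foldr partial phi s1 = foldr partial phi s2.
Proof.
move=> sphi.
have sm (s : seq 'I_d) : smooth (foldr partial phi s).
  by elim: s => //= i s; exact: smooth_partial.
have front (s : seq 'I_d) i : i \in s ->
    foldr partial phi s = foldr partial phi (i :: rem i s).
  elim: s => //= j s IH; rewrite in_cons; case: eqVneq => [->//|ij /= /IH ->].
  by apply/funext => x /=; rewrite (partialC _ _ _ (sm _)).
elim: s1 s2 => [|i s1 IH] s2; first by rewrite perm_sym => /perm_small_eq ->.
move=> ps; have is2 : i \in s2 by rewrite -(perm_mem ps) mem_head.
rewrite (front s2 i is2) /= (IH (rem i s2)) //.
by rewrite -(perm_cons i) (perm_trans ps) // perm_to_rem.
Qed.

Lemma partial_miE m phi :
  partial_mi m phi = foldr partial phi (flatten [seq nseq (m i) i | i <- enum 'I_d]).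
Proof.
rewrite /partial_mi; elim: (enum _) => //= i s ->.
by rewrite foldr_cat; elim: (m i) => //= k ->.
Qed.

(** The derivatives of a multi-index are taken in the order of the coordinates,
    and an additional one has to be commuted to its place. *)
Lemma partial_mi_add1 m i phi : smooth phi ->
  partial_mi (fun j => m j + (j == i))%N phi = partial i (partial_mi m phi).
Proof.
move=> sphi; rewrite !partial_miE -[RHS]/(foldr partial phi (i :: _)).
apply: foldr_partial_perm => //; apply/permP => P.
have cnt (k : 'I_d -> nat) : count P (flatten [seq nseq (k j) j | j <- enum 'I_d]) =
    (\sum_j k j * P j)%N.
  rewrite count_flatten -map_comp sumnE big_map big_enum /=.
  by apply: eq_bigr => j _; rewrite /= count_nseq mulnC.
rewrite /= !cnt (bigD1 i) //= [in RHS](bigD1 i) //= eqxx mulnDl mul1n.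
rewrite addnAC addnC; congr (_ + (_ + _))%N; apply: eq_bigr => j /negPf ->.
by rewrite addn0.
Qed.

Lemma partial_mi1 i phi : partial_mi (fun j => (j == i) : nat) phi = partial i phi.
Proof.
rewrite partial_miE.
suff -> : flatten [seq nseq ((j == i) : nat) j | j <- enum 'I_d] = [:: i] by [].
have : i \in enum 'I_d by rewrite mem_enum.
elim: (enum _) (enum_uniq 'I_d) => //= j s IH /andP[js us].
rewrite in_cons => /predU1P[->|is_]; last first.
  by rewrite (negPf (_ : j != i)) /= ?IH //; apply: contraNneq js => ->.
rewrite eqxx /=; congr (_ :: _).
elim: s js {us IH} => //= k s IH; rewrite in_cons negb_or => /andP[jk js].
by rewrite eq_sym (negPf jk) /= IH.
Qed.

Lemma mi_size1 i : mi_size (fun j : 'I_d => (j == i) : nat) = 1%N.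
Proof.
rewrite /mi_size (bigD1 i) //= eqxx big1 ?addn0 // => j /negPf -> //.
Qed.

Lemma mi_size_add1 m i : mi_size (fun j : 'I_d => m j + (j == i))%N = (mi_size m).+1.
Proof. by rewrite /mi_size big_split /= -/(mi_size m) -/(mi_size _) mi_size1 addn1. Qed.

Lemma test_partial i phi : test_function phi -> test_function (partial i phi).
Proof.
move=> [sphi [K [cK KB] K0]]; split; first exact: smooth_partial.
exists K => // x nKx; rewrite /partial (@near_eq_derive _ _ _ _ (cst 0)) ?derive_cst //.
have oK : open (~` K) by apply: closed_openC; apply: compact_closed => //; exact: norm_hausdorff.
have : nbhs x (~` K) by apply: open_nbhs_nbhs.
by apply: filterS => y; exact: K0.
Qed.

Lemma test_partial_mi m phi : test_function phi -> test_function (partial_mi m phi).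
Proof.
move=> tphi; rewrite partial_miE; elim: (flatten _) => //= i s; exact: test_partial.
Qed.

Lemma test_coordM k phi : test_function phi -> test_function (fun x => x 0 k * phi x).
Proof.
move=> [sphi [K cK K0]]; split; first exact: smooth_coordM.
by exists K => // x /K0 ->; rewrite mulr0.
Qed.

End test_functions.

(** * The unit ball *)
Section unit_ball_facts.
Context {R : realType} {d : nat}.
Local Notation E := 'rV[R]_d.
Local Notation leb := (lebesgue_rV d).

Lemma sqnorm2_ge0 (x : E) : 0 <= sqnorm2 x.
Proof. by apply: sumr_ge0 => i _; exact: sqr_ge0. Qed.

Lemma enorm2_sqr (x : E) : enorm2 x ^+ 2 = sqnorm2 x.
Proof. by rewrite sqr_sqrtr // sqnorm2_ge0. Qed.

Lemma unit_ballE : unit_ball = [set x : E | sqnorm2 x <= 1].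
Proof.
by apply/funext => x; apply/propext; rewrite /unit_ball /= /enorm2 -[X in _ <= X]sqrtr1 ler_sqrt.
Qed.

Lemma open_unit_ballE : open_unit_ball = [set x : E | sqnorm2 x < 1].
Proof.
by apply/funext => x; apply/propext; rewrite /open_unit_ball /= /enorm2 -[X in _ < X]sqrtr1 ltr_sqrt.
Qed.

Lemma open_unit_ball_sub : open_unit_ball `<=` (unit_ball : set E).
Proof. by move=> x /ltW. Qed.

Lemma coord_le1 (x : E) i : sqnorm2 x <= 1 -> `|x 0 i| <= 1.
Proof.
move=> h; rewrite -[_ <= _](@ler_pXn2r _ 2) ?nnegrE // expr1n real_normK ?num_real //.
apply: le_trans h; rewrite /sqnorm2 (bigD1 i) //= lerDl.
by apply: sumr_ge0 => j _; exact: sqr_ge0.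
Qed.

Lemma closed_sublevel (c : R) : closed [set x : E | sqnorm2 x <= c].
Proof.
rewrite (_ : [set x | _] = @sqnorm2 R d @^-1` [set y | y <= c]) //.
by apply: preimage_closed => [x _|]; [exact: continuous_sqnorm2|exact: closed_le].
Qed.

Lemma compact_sublevel (c : R) : c <= 1 -> compact [set x : E | sqnorm2 x <= c].
Proof.
move=> c1; apply: subclosed_compact (@closed_sublevel c) (@compact_cube R d) _.
by move=> x /= xc i; rewrite in_itv /= -ler_norml; apply: coord_le1; exact: le_trans c1.
Qed.

Lemma measurable_unit_ball : measurable (unit_ball : set E).
Proof. by rewrite unit_ballE; apply: closed_measurable_rV; exact: closed_sublevel. Qed.

Lemma unit_ball_fin : (leb (unit_ball : set E) < +oo)%E.
Proof.
apply: le_lt_trans (@cube_fin R d); apply: le_measure.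
- by rewrite inE; exact: measurable_unit_ball.
- by rewrite inE; apply: compact_measurable_rV; exact: compact_cube.
- by rewrite unit_ballE => x /= h i; rewrite in_itv /= -ler_norml; exact: coord_le1.
Qed.

Lemma continuous_bounded_on (K : set E) (f : E -> R) : compact K -> continuous f ->
  [bounded f x | x in K].
Proof.
move=> cK cf.
have := compact_bounded (@continuous_compact _ _ _ _ (continuous_subspaceT cf) cK).
move=> [M [Mr hM]]; exists M; split => // N MN x Kx; apply: (hM N MN); by exists x.
Qed.

End unit_ball_facts.

(** * Iterated weak derivatives *)
Section weak_derivatives.
Context {R : realType} {d : nat}.
Local Notation E := 'rV[R]_d.
Local Notation leb := (lebesgue_rV d).
Local Notation B := (unit_ball : set E).
Implicit Types (f g h phi psi : E -> R) (x y : E) (i j k : 'I_d) (n : nat).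

Lemma integrable_test f phi : locally_integrable_ball f -> test_function phi ->
  leb.-integrable B (fun x => (f x * phi x)%:E).
Proof.
move=> [mf lf] [sphi [K [cK KB] K0]].
have mK : measurable K by exact: compact_measurable_rV.
have cphi := smooth_continuous sphi.
apply/(integrable_mkcond _ measurable_unit_ball).
rewrite (_ : _ \_ _ = (fun x => (f x * phi x)%:E) \_ K).
  apply/(integrable_mkcond _ mK).
  have -> : (fun x => (f x * phi x)%:E) = ((EFin \o f) \* (EFin \o phi))%E.
    by apply/funext => x; rewrite /= EFinM.
  apply: integrableMl => //; first exact: lf.
    by apply: measurable_funTS; exact: continuous_measurable_rV.
  exact: continuous_bounded_on.
apply/funext => x; rewrite !patchE; case: ifPn => [xB|/negP xB]; case: ifPn => [xK|/negP xK] //.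
  by rewrite K0 ?mulr0 // => xK'; apply: xK; rewrite inE.
by exfalso; apply: xB; rewrite inE; apply: open_unit_ball_sub; apply: KB; rewrite inE in xK.
Qed.

Definition pairing f phi : R := \int[leb]_(x in B) (f x * phi x).

Lemma pairingDZl (c : R) f g phi : locally_integrable_ball f -> locally_integrable_ball g ->
  test_function phi ->
  pairing (fun x => f x + c * g x) phi = pairing f phi + c * pairing g phi.
Proof.
move=> lf lg tphi; have i1 := integrable_test lf tphi; have i2 := integrable_test lg tphi.
rewrite /pairing -RintegralZl //; last exact: measurable_unit_ball.
rewrite -RintegralD //; first by apply: eq_Rintegral => x _; ring.
- exact: measurable_unit_ball.
- rewrite (_ : _ \o _ = (fun x => c%:E * (g x * phi x)%:E)%E); last first.
    by apply/funext => x; rewrite /= EFinM.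
  by apply: integrableZl => //; exact: measurable_unit_ball.
Qed.

Lemma pairingDZr (c : R) f phi psi : locally_integrable_ball f ->
  test_function phi -> test_function psi ->
  pairing f (fun x => phi x + c * psi x) = pairing f phi + c * pairing f psi.
Proof.
move=> lf tphi tpsi; have i1 := integrable_test lf tphi; have i2 := integrable_test lf tpsi.
rewrite /pairing -RintegralZl //; last exact: measurable_unit_ball.
rewrite -RintegralD //; first by apply: eq_Rintegral => x _; ring.
- exact: measurable_unit_ball.
- rewrite (_ : _ \o _ = (fun x => c%:E * (f x * psi x)%:E)%E); last first.
    by apply/funext => x; rewrite /= EFinM.
  by apply: integrableZl => //; exact: measurable_unit_ball.
Qed.

Lemma locintDZ (c : R) f g : locally_integrable_ball f -> locally_integrable_ball g ->
  locally_integrable_ball (fun x => f x + c * g x).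
Proof.
move=> [mf lf] [mg lg]; split.
  by apply: measurable_funD => //; apply: measurable_funM => //; exact: measurable_cst.
move=> K cK KB; have mK := compact_measurable_rV cK.
rewrite (_ : _ \o _ = (EFin \o f) \+ (fun x => c%:E * (EFin \o g) x))%E; last first.
  by apply/funext => x; rewrite /= EFinD EFinM.
by apply: integrableD => //; [exact: lf|apply: integrableZl => //; exact: lg].
Qed.

Lemma locint_coordM k f : locally_integrable_ball f ->
  locally_integrable_ball (fun x => x 0 k * f x).
Proof.
move=> [mf lf]; split.
  apply: measurable_funM => //; apply: measurable_funTS; exact: measurable_coord.
move=> K cK KB; have mK := compact_measurable_rV cK.
rewrite (_ : _ \o _ = (EFin \o (fun x : E => x 0%R k)) \* (EFin \o f))%E; last first.
  by apply/funext => x; rewrite /= EFinM.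
apply: integrableMr => //; [|exact: continuous_bounded_on (@coord_continuous R 1 d 0 k)|exact: lf].
by apply: measurable_funTS; exact: measurable_coord.
Qed.

Lemma testDZ (c : R) phi psi : test_function phi -> test_function psi ->
  test_function (fun x => phi x + c * psi x).
Proof.
move=> [s1 [K1 [cK1 KB1] K10]] [s2 [K2 [cK2 KB2] K20]].
split; first exact: (smoothD_scale c s1 s2).
exists (K1 `|` K2); first by split; [exact: compactU|rewrite subUset].
by move=> x /not_orP[/K10 -> /K20 ->]; rewrite mulr0 addr0.
Qed.

Lemma test0 : test_function (cst 0 : E -> R).
Proof.
split; last by exists set0 => //; split; [exact: compact0|exact: sub0set].
apply: (smooth_coind (S := fun psi => psi = cst 0)) => //.
  by move=> _ -> x; exact: differentiable_cst.
by move=> _ i ->; apply: partial_eq => x; exact: is_derive_cst.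
Qed.

Lemma test_sum (I : Type) (r : seq I) (S : pred I) (F : I -> E -> R) :
  (forall a, S a -> test_function (F a)) ->
  test_function (fun x => \sum_(a <- r | S a) F a x).
Proof.
move=> hF; elim: r => [|a r IH].
  rewrite (_ : (fun _ => _) = cst 0); first exact: test0.
  by apply/funext => x; rewrite big_nil.
case Sa : (S a); last first.
  rewrite (_ : (fun _ => _) = fun x => \sum_(a <- r | S a) F a x) //.
  by apply/funext => x; rewrite big_cons Sa.
rewrite (_ : (fun _ => _) = fun x => F a x + 1 * \sum_(a <- r | S a) F a x).
  by apply: testDZ => //; exact: hF.
by apply/funext => x; rewrite big_cons Sa mul1r.
Qed.

Lemma pairing_sumr (I : Type) (r : seq I) (S : pred I) (F : I -> E -> R) f :
  locally_integrable_ball f -> (forall a, S a -> test_function (F a)) ->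
  \sum_(a <- r | S a) pairing f (F a) = pairing f (fun x => \sum_(a <- r | S a) F a x).
Proof.
move=> lf hF; elim: r => [|a r IH].
  rewrite big_nil /pairing (_ : (fun x => f x * _) = cst 0).
    by rewrite Rintegral_cst ?mul0r //; exact: measurable_unit_ball.
  by apply/funext => x; rewrite big_nil mulr0.
rewrite big_cons; case Sa : (S a); last first.
  by rewrite IH; congr (pairing _ _); apply/funext => x; rewrite big_cons Sa.
rewrite (_ : (fun _ => _) = fun x => F a x + 1 * \sum_(a <- r | S a) F a x); last first.
  by apply/funext => x; rewrite big_cons Sa mul1r.
rewrite pairingDZr ?IH ?mul1r //; first exact: hF.
exact: test_sum.
Qed.

Definition weak1 i f g := is_weak_derivative (fun j => (j == i) : nat) f g.

Lemma weak1P i f g : weak1 i f g <-> [/\ locally_integrable_ball f, locally_integrable_ball g &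
  forall phi, test_function phi -> pairing f (partial i phi) = - pairing g phi].
Proof.
rewrite /weak1 /is_weak_derivative mi_size1 expr1.
split=> -[lf lg h]; split=> // phi tphi; have := h phi tphi;
  by rewrite partial_mi1 mulN1r.
Qed.

(** Weak derivatives of order n taken one direction at a time. Unlike the
    definition by multi-indices, this form is stable under each operation that
    the iterated operators are made of. *)
Fixpoint weakly_diff n f : Prop := if n is n'.+1 then
    locally_integrable_ball f /\ forall i, exists2 g, weak1 i f g & weakly_diff n' g
  else locally_integrable_ball f.

Lemma weakly_diff_locint n f : weakly_diff n f -> locally_integrable_ball f.
Proof. by case: n => [//|n []]. Qed.

Lemma weakly_diffW n f : weakly_diff n.+1 f -> weakly_diff n f.
Proof.
elim: n f => [|n IH] f [lf h] //; split => // i.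
by have [g fg /IH gn] := h i; exists g.
Qed.

Lemma weakly_diff_leq n m f : (n <= m)%N -> weakly_diff m f -> weakly_diff n f.
Proof.
move=> /subnK <-; elim: (m - n)%N => // k IH; rewrite addSn => /weakly_diffW; exact: IH.
Qed.

(** The derivatives of f serve for any g that is indistinguishable from f by test
    functions. *)
Lemma weakly_diff_ext n f g : locally_integrable_ball g ->
  (forall phi, test_function phi -> pairing f phi = pairing g phi) ->
  weakly_diff n f -> weakly_diff n g.
Proof.
move=> lg fg; case: n => [//|n [lf h]]; split => // i.
have [u /weak1P[_ lu hu] un] := h i; exists u => //; apply/weak1P; split => // phi tphi.
by rewrite -fg ?hu //; exact: test_partial.
Qed.

(** The derivative of multi-index m + e_i is a derivative of multi-index m of the
    first derivative in the direction i. *)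
Lemma sobolev_weakly_diff n f : (forall m, (mi_size m <= n)%N ->
  exists g, is_weak_derivative m f g) -> weakly_diff n f.
Proof.
elim: n f => [|n IH] f h.
  by have [g []] := h (fun=> 0%N) ltac:(by rewrite /mi_size big1).
have lf : locally_integrable_ball f.
  by have [g []] := h (fun=> 0%N) ltac:(by rewrite /mi_size big1).
split => // i; have [g fg] := h (fun j => (j == i) : nat) ltac:(by rewrite mi_size1).
exists g => //; have /weak1P[_ lg gP] := fg.
apply: IH => m mn; have [u [_ lu uP]] := h (fun j => m j + (j == i))%N ltac:(by rewrite mi_size_add1).
exists u; split => // phi tphi.
have := uP phi tphi; rewrite partial_mi_add1; last by case: tphi.
rewrite mi_size_add1 -/(pairing f _) gP; last exact: test_partial_mi.
rewrite exprS mulN1r mulNr => /oppr_inj; exact.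
Qed.

(** The chosen derivative pairs with test functions like any other one, so it
    inherits their regularity. *)
Lemma wpartialP n i f : weakly_diff n.+1 f ->
  weak1 i f (wpartial i f) /\ weakly_diff n (wpartial i f).
Proof.
move=> [lf h]; have [g fg gn] := h i.
have wf : weak1 i f (wpartial i f) by exact: (@xgetPex _ (cst 0) [set g | weak1 i f g] (ex_intro _ g fg)).
split => //; apply: weakly_diff_ext gn; first by case: wf.
have /weak1P[_ _ hg] := fg; have /weak1P[_ _ hw] := wf.
by move=> phi tphi; apply: oppr_inj; rewrite -hg // hw.
Qed.

Lemma weakly_diffDZ n (c : R) f g : weakly_diff n f -> weakly_diff n g ->
  weakly_diff n (fun x => f x + c * g x).
Proof.
elim: n f g => [|n IH] f g; first exact: locintDZ.
move=> [lf hf] [lg hg]; split; first exact: locintDZ.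
move=> i; have [u /weak1P[_ lu fu] un] := hf i; have [v /weak1P[_ lv gv] vn] := hg i.
exists (fun x => u x + c * v x); last exact: IH.
apply/weak1P; split; [exact: locintDZ|exact: locintDZ|] => phi tphi.
rewrite !pairingDZl //; last exact: test_partial.
by rewrite fu // gv // mulrN -opprD.
Qed.

Lemma pairing_coordM k f phi : pairing (fun x => x 0 k * f x) phi = pairing f (fun x => x 0 k * phi x).
Proof. by apply: eq_Rintegral => x _; ring. Qed.

Lemma weakly_diff_coordM n k f : weakly_diff n f -> weakly_diff n (fun x => x 0 k * f x).
Proof.
elim: n f => [|n IH] f; first exact: locint_coordM.
move=> fn; have [lf hf] := fn; split; first exact: locint_coordM.
move=> i; have [g /weak1P[_ lg fg] gn] := hf i.
exists (fun x => x 0 k * g x + (k == i)%:R * f x); last first.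
  by apply: weakly_diffDZ; [exact: IH|exact: weakly_diffW].
apply/weak1P; split; [exact: locint_coordM|apply: locintDZ => //; exact: locint_coordM|].
move=> phi tphi; rewrite pairing_coordM pairingDZl //; last exact: locint_coordM.
rewrite pairing_coordM.
have -> : (fun x => x 0 k * partial i phi x) =
    fun x => partial i (fun x => x 0 k * phi x) x + (- (k == i)%:R) * phi x.
  by apply/funext => x; rewrite partial_coordM ?mulNr ?addrK //; case: tphi.
rewrite pairingDZr //; last by apply: test_partial; exact: test_coordM.
rewrite fg; last exact: test_coordM.
by rewrite mulNr opprD.
Qed.

Lemma locint0 : locally_integrable_ball (cst 0 : E -> R).
Proof.
split; first exact: measurable_cst.
move=> K cK _; rewrite (_ : _ \o _ = cst 0%E) //; apply: integrable0.
Qed.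

Lemma pairing0 phi : pairing (cst 0) phi = 0.
Proof.
rewrite /pairing (_ : (fun x => _) = cst 0); last by apply/funext => x; rewrite /= mul0r.
by rewrite Rintegral_cst ?mul0r //; exact: measurable_unit_ball.
Qed.

Lemma weakly_diff0 n : weakly_diff n (cst 0).
Proof.
elim: n => [|n IH]; [exact: locint0|split; first exact: locint0].
move=> i; exists (cst 0) => //; apply/weak1P; split; [exact: locint0|exact: locint0|].
by move=> phi _; rewrite !pairing0 oppr0.
Qed.

Lemma weakly_diff_sum n (I : Type) (r : seq I) (S : pred I) (F : I -> E -> R) :
  (forall a, S a -> weakly_diff n (F a)) ->
  weakly_diff n (fun x => \sum_(a <- r | S a) F a x).
Proof.
move=> hF; elim: r => [|a r IH].
  rewrite (_ : (fun _ => _) = cst 0); first exact: weakly_diff0.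
  by apply/funext => x; rewrite big_nil.
case Sa : (S a); last first.
  rewrite (_ : (fun _ => _) = fun x => \sum_(a <- r | S a) F a x) //.
  by apply/funext => x; rewrite big_cons Sa.
rewrite (_ : (fun _ => _) = fun x => F a x + 1 * \sum_(a <- r | S a) F a x).
  by apply: weakly_diffDZ => //; exact: hF.
by apply/funext => x; rewrite big_cons Sa mul1r.
Qed.

Lemma pairing_sum (I : Type) (r : seq I) (S : pred I) (F : I -> E -> R) phi :
  (forall a, S a -> locally_integrable_ball (F a)) -> test_function phi ->
  pairing (fun x => \sum_(a <- r | S a) F a x) phi = \sum_(a <- r | S a) pairing (F a) phi.
Proof.
move=> lF tphi; elim: r => [|a r IH].
  rewrite big_nil (_ : (fun _ => _) = cst 0) ?pairing0 //.
  by apply/funext => x; rewrite big_nil.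
rewrite big_cons; case Sa : (S a); last first.
  rewrite -IH; congr (pairing _ _); apply/funext => x; by rewrite big_cons Sa.
rewrite (_ : (fun _ => _) = fun x => F a x + 1 * \sum_(a <- r | S a) F a x); last first.
  by apply/funext => x; rewrite big_cons Sa mul1r.
rewrite pairingDZl ?IH ?mul1r //; first exact: lF.
exact: (@weakly_diff_sum 0).
Qed.

Lemma weakly_diff_laplacian n f : weakly_diff n.+2 f -> weakly_diff n (laplacian f).
Proof.
move=> fn; apply: weakly_diff_sum => i _.
by have [_ /(wpartialP i)[]] := wpartialP i fn.
Qed.

Lemma pairing_laplacian f phi : weakly_diff 2 f -> test_function phi ->
  pairing (laplacian f) phi = \sum_i pairing f (partial i (partial i phi)).
Proof.
move=> f2 tphi; rewrite /laplacian pairing_sum //.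
  apply: eq_bigr => i _.
  have [/weak1P[_ _ h1] /(wpartialP i)[/weak1P[_ _ h2] _]] := wpartialP i f2.
  apply: oppr_inj; rewrite -h2 // h1 ?opprK //; exact: test_partial.
move=> i _; have [_ /(wpartialP i)[_]] := wpartialP i f2; exact.
Qed.

Lemma angularE i j f :
  angular i j f = fun x => x 0 i * wpartial j f x + (-1) * (x 0 j * wpartial i f x).
Proof. by apply/funext => x; rewrite mulN1r. Qed.

Lemma weakly_diff_angular n i j f : weakly_diff n.+1 f -> weakly_diff n (angular i j f).
Proof.
move=> fn; rewrite angularE.
by apply: weakly_diffDZ; apply: weakly_diff_coordM; [case: (wpartialP j fn)|case: (wpartialP i fn)].
Qed.

(** The classical counterpart of [angular], as [wpartial] is defined by choice even
    on smooth functions. *)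
Definition drot_fun i j phi : E -> R := fun x => x 0 i * partial j phi x - x 0 j * partial i phi x.

Lemma test_drot_fun i j phi : test_function phi -> test_function (drot_fun i j phi).
Proof.
move=> tphi.
have t k l := test_coordM k (test_partial l tphi).
have -> : drot_fun i j phi = fun x => x 0 i * partial j phi x + (-1) * (x 0 j * partial i phi x).
  by apply/funext => x; rewrite mulN1r.
exact: testDZ.
Qed.

Lemma pairing_angular i j f phi : weakly_diff 1 f -> test_function phi ->
  pairing (angular i j f) phi = - pairing f (drot_fun i j phi).
Proof.
move=> f1 tphi; have [/weak1P[lf l1 h1] _] := wpartialP j f1.
have [/weak1P[_ l2 h2] _] := wpartialP i f1.
have t k := test_coordM k tphi.
rewrite angularE pairingDZl //; [|exact: locint_coordM|exact: locint_coordM].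
rewrite !pairing_coordM -[X in X + _]opprK -h1 // -[pairing (wpartial i f) _]opprK -h2 //.
have -> : drot_fun i j phi = fun x => partial j (fun x => x 0 i * phi x) x +
    (-1) * partial i (fun x => x 0 j * phi x) x.
  apply/funext => x; case: tphi => sphi _; rewrite !partial_coordM // (eq_sym j i) /drot_fun.
  by ring.
rewrite pairingDZr //; [|exact: test_partial|exact: test_partial].
by move: (pairing f _) (pairing f _) => a b; rewrite mulN1r mulN1r !opprK opprB addrC.
Qed.

Lemma weakly_diff_laplace_beltrami n f : weakly_diff n.+2 f -> weakly_diff n (laplace_beltrami f).
Proof.
move=> fn; apply: weakly_diff_sum => i _; apply: weakly_diff_sum => j _.
by do 2 apply: weakly_diff_angular.
Qed.

Lemma pairing_laplace_beltrami f phi : weakly_diff 2 f -> test_function phi ->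
  pairing (laplace_beltrami f) phi =
  \sum_(i < d) \sum_(j < d | (i < j)%N) pairing f (drot_fun i j (drot_fun i j phi)).
Proof.
move=> f2 tphi; have wa i j := weakly_diff_angular i j f2.
have waa i j := weakly_diff_angular i j (wa i j).
rewrite /laplace_beltrami pairing_sum //; last first.
  by move=> i _; apply: (@weakly_diff_sum 0) => j _; exact: waa.
apply: eq_bigr => i _; rewrite pairing_sum //; last by move=> j _; exact: waa.
apply: eq_bigr => j _; rewrite pairing_angular // pairing_angular ?opprK //.
  exact: weakly_diffW.
exact: test_drot_fun.
Qed.

End weak_derivatives.

(** * The cutoff functions u^b exp (- e / u) *)
Section cutoff.
Context {R : realType}.
Implicit Types (e b u t y : R).

(** u^b exp (- e / u) for positive u, written so that one exponential carries both
    factors. *)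
Definition cutoff e b u : R := if 0 < u then expR (b * ln u - e / u) else 0.

Lemma cutoff_ge0 e b u : 0 <= cutoff e b u.
Proof. by rewrite /cutoff; case: ifP => // _; exact: expR_ge0. Qed.

Lemma cutoff_le0 e b u : u <= 0 -> cutoff e b u = 0.
Proof. by rewrite /cutoff ltNge => ->. Qed.

Lemma cutoffS e b u : cutoff e b u = u * cutoff e (b - 1) u.
Proof.
rewrite /cutoff; case: ifPn => [u0|_]; last by rewrite mulr0.
have -> : u * expR ((b - 1) * ln u - e / u) = expR (ln u) * expR ((b - 1) * ln u - e / u).
  by rewrite lnK ?posrE.
by rewrite -expRD; congr expR; ring.
Qed.

(** One term of the exponential series. *)
Lemma exprn_le_expR (m : nat) y : 0 <= y -> y ^+ m <= m`!%:R * expR y.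
Proof.
case: m => [|m] y0; first by rewrite expr0 mul1r -expR0 ler_expR.
have := expR_ge1Dxn m y0; rewrite -ler_pdivrMl ?ltr0n ?fact_gt0 // mulrC.
by apply: le_trans; rewrite lerDr.
Qed.

(** The exponential beats every power of u, in particular u^(2-b). *)
Lemma cutoff_flat e b : 0 < e -> exists2 C, 0 <= C & forall u, u <= 1 -> cutoff e b u <= C * u ^+ 2.
Proof.
(* m is such that u^(b + m) <= u^2, and (e / u)^m <= m! exp (e / u). *)
move=> e0; pose m := Num.bound `|2 - b|.
have mb : 2 <= b + m%:R.
  have h : `|2 - b| < m%:R by exact: archi_boundP.
  by have := ler_norm (2 - b); lra.
pose C := m`!%:R / e ^+ m.
have C0 : 0 <= C by rewrite divr_ge0 // exprn_ge0 // ltW.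
exists C => // u u1; rewrite /cutoff; case: ifPn => [u0|_]; last by rewrite mulr_ge0 // sqr_ge0.
have lnu : ln u <= 0 by exact: ln_le0.
have y0 : 0 <= e / u by rewrite divr_ge0 // ltW.
have h1 : expR (- (e / u)) <= C * u ^+ m.
  rewrite expRN -div1r ler_pdivrMr ?expR_gt0 //.
  have ym0 : 0 < (e / u) ^+ m by rewrite exprn_gt0 // divr_gt0.
  have -> : C * u ^+ m * expR (e / u) = m`!%:R * expR (e / u) / (e / u) ^+ m.
    have em0 : e ^+ m != 0 by rewrite expf_neq0 // gt_eqF.
    have um0 : u ^+ m != 0 by rewrite expf_neq0 // gt_eqF.
    by rewrite /C expr_div_n; move: (e ^+ m) (u ^+ m) em0 um0 => p q p0 q0; field; rewrite p0 q0.
  by rewrite ler_pdivlMr // mul1r; exact: exprn_le_expR.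
rewrite expRD.
have E0 : expR (b * ln u) * u ^+ m = expR ((b + m%:R) * ln u).
  rewrite -[u in u ^+ m](@lnK _ u) ?posrE // -expRM_natl -expRD; congr expR; ring.
apply: (le_trans (ler_wpM2l (expR_ge0 _) h1)).
rewrite mulrCA E0 ler_wpM2l //.
rewrite -[leRHS](@lnK _ (u ^+ 2)) ?posrE ?exprn_gt0 // lnXn // ler_expR.
have -> : ln u *+ 2 = 2 * ln u by rewrite mulr_natl.
exact: ler_wnM2r.
Qed.

(** Away from 0 this is calculus; at 0 the flatness of the cutoff makes the
    difference quotients vanish. *)
Lemma is_derive_cutoff e b u : 0 < e ->
  is_derive u (1 : R) (cutoff e b) (b * cutoff e (b - 1) u + e * cutoff e (b - 2) u).
Proof.
move=> e0; have [u0|u0|u0] := ltgtP u 0.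
- rewrite !(cutoff_le0 _ _ (ltW u0)) !mulr0 addr0.
  apply: (near_eq_is_derive _ (is_derive_cst (0 : R) u (1 : R))).
  by near=> v; rewrite cutoff_le0 // ltW //; near: v; exact: lt_nbhsl.
- have dexp : is_derive u (1 : R) (fun v => expR (b * ln v - e / v))
      (expR (b * ln u - e / u) * (b * u^-1 - e * (- u ^- 2 * 1))).
    apply: (@is_derive1_comp _ expR (fun v => b * ln v - e / v)).
    apply: (@is_deriveB _ _ _ (fun v => b * ln v) (fun v => e / v)).
      apply: (@is_deriveZ _ _ _ (@ln R) b); exact: is_derive1_ln.
    apply: (@is_deriveZ _ _ _ (fun v : R => v^-1) e).
    by apply: (@is_deriveV _ id); rewrite gt_eqF.
  have -> : b * cutoff e (b - 1) u + e * cutoff e (b - 2) u =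
      expR (b * ln u - e / u) * (b * u^-1 - e * (- u ^- 2 * 1)).
    have c1 : cutoff e b u = u * cutoff e (b - 1) u by exact: cutoffS.
    have c2 : cutoff e (b - 1) u = u * cutoff e (b - 2) u.
      by rewrite cutoffS; congr (_ * cutoff _ _ _); ring.
    have <- : cutoff e b u = expR (b * ln u - e / u) by rewrite /cutoff u0.
    by rewrite c1 c2; field; rewrite gt_eqF.
  apply: (near_eq_is_derive _ dexp); near=> v; rewrite /cutoff ifT //.
  by near: v; exact: lt_nbhsr.
- rewrite u0 !(cutoff_le0 _ _ (lexx 0)) !mulr0 addr0.
  have [C C0 hC] := cutoff_flat b e0.
  have lim0 : h^-1 *: ((cutoff e b \o shift 0) (h *: (1 : R)) - cutoff e b 0) @[h --> 0^'] --> (0 : R).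
    apply/cvgr0Pnorm_le => r r0; near=> h.
    have h0 : h != 0 by near: h; exact: nbhs_dnbhs_neq.
    have h1 : `|h| <= 1 by near: h; apply: dnbhs0_le.
    have hr : `|h| <= r / (C + 1) by near: h; apply: dnbhs0_le; rewrite divr_gt0 // ltr_wpDl.
    rewrite /= addr0 -[h *: 1]/(h * 1) mulr1 (cutoff_le0 _ _ (lexx 0)) subr0.
    rewrite -[_ *: _]/(_ * _) normrM normfV (ger0_norm (cutoff_ge0 _ _ _)).
    rewrite ler_pdivrMl ?normr_gt0 //.
    have h2 := hC h (le_trans (ler_norm h) h1).
    rewrite -real_normK ?num_real // expr2 in h2.
    apply: (le_trans h2); rewrite mulrCA ler_pM2l ?normr_gt0 //.
    move: hr; rewrite ler_pdivlMr ?ltr_wpDl // => hr; apply: le_trans hr.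
    by rewrite mulrC ler_wpM2l // lerDl.
  split; first by apply/cvg_ex; exists 0.
  exact: cvg_lim.
Unshelve. all: by end_near. Qed.

End cutoff.

Section cutoff_limits.
Context {R : realType}.
Implicit Types (e b u t y : R).

(** With u = t - e and y = e / u, the left-hand side is at most
    u^b y^l exp (- y), and u^b is at most t^b (1 + y) as b > -1. The powers of y
    are absorbed by the exponential. Only l <= i makes this uniform in e. *)
Lemma cutoff_dominated (i l : nat) b : (l <= i)%N -> -1 < b ->
  exists2 C, 0 <= C & forall e t, 0 < e <= 1 -> 0 < t ->
    e ^+ i * cutoff e (b - l%:R) (t - e) <= C * t `^ b.
Proof.
move=> li b1; exists (l`!%:R + l.+1`!%:R); first by rewrite addr_ge0.
move=> e t /andP[e0 e1] t0.
have C0 : 0 <= (l`!%:R + l.+1`!%:R) * t `^ b by rewrite mulr_ge0 ?addr_ge0 ?powR_ge0.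
have [u0|u0] := leP (t - e) 0; first by rewrite cutoff_le0 // mulr0.
set u := t - e in u0 *; pose y := e / u.
have y0 : 0 < y by rewrite divr_gt0.
have y1 : 0 < 1 + y by rewrite addr_gt0.
have tE : t = u * (1 + y) by rewrite /y mulrDr mulr1 mulrC divfK ?gt_eqF // /u subrK.
have h1 : e ^+ i * cutoff e (b - l%:R) u <= e ^+ l * cutoff e (b - l%:R) u.
  by rewrite ler_wpM2r ?cutoff_ge0 // ler_wiXn2l // ltW.
apply: (le_trans h1).
have h2 : e ^+ l * cutoff e (b - l%:R) u = expR (b * ln u) * (y ^+ l * expR (- y)).
  rewrite /cutoff u0 /y expr_div_n mulrBl.
  have -> : b * ln u - l%:R * ln u - e / u = b * ln u + (- (l%:R * ln u) + - (e / u)) by ring.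
  rewrite expRD expRD expRN expRM_natl lnK ?posrE //; ring.
rewrite h2.
have h3 : expR (b * ln u) <= t `^ b * (1 + y).
  have -> : t `^ b * (1 + y) = expR (b * ln t + ln (1 + y)).
    by rewrite /powR gt_eqF // expRD [expR (ln (1 + y))]lnK ?posrE.
  rewrite ler_expR.
  rewrite tE lnM ?posrE // mulrDr -addrA lerDl -[X in _ + X]mul1r -mulrDl.
  by rewrite mulr_ge0 ?ln_ge0 //; lra.
apply: (le_trans (ler_wpM2r _ h3)); first by rewrite mulr_ge0 ?expR_ge0 ?exprn_ge0 // ltW.
rewrite -mulrA mulrC ler_wpM2r ?powR_ge0 //.
have E (m : nat) : y ^+ m * expR (- y) <= m`!%:R.
  by rewrite expRN ler_pdivrMr ?expR_gt0 //; apply: exprn_le_expR; exact: ltW.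
rewrite mulrDl mul1r; apply: lerD => //.
by rewrite mulrA -exprS.
Qed.

Lemma cutoff_cvg (e_ : R^nat) (i : nat) b t : (forall n, 0 < e_ n) ->
  e_ n @[n --> \oo] --> (0 : R) -> 0 < t ->
  e_ n ^+ i * cutoff (e_ n) b (t - e_ n) @[n --> \oo] --> (if i == 0%N then t `^ b else 0).
Proof.
move=> e0 ecv t0.
have u_cv : t - e_ n @[n --> \oo] --> t.
  by rewrite -[X in _ --> X]subr0; apply: cvgB => //; exact: cvg_cst.
have c1 : cutoff (e_ n) b (t - e_ n) @[n --> \oo] --> t `^ b.
  have h : expR (b * ln (t - e_ n) - e_ n / (t - e_ n)) @[n --> \oo] --> t `^ b.
    rewrite /powR gt_eqF //; apply: continuous_cvg; first exact: continuous_expR.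
    rewrite -[X in _ --> X]subr0; apply: cvgB.
      by apply: cvgMr; apply: continuous_cvg => //; exact: continuous_ln.
    rewrite -[X in _ --> X](mul0r t^-1); apply: cvgM => //.
    by apply: cvgV => //; rewrite gt_eqF.
  apply: cvg_trans h; apply: near_eq_cvg; near=> n; rewrite /cutoff ifT //.
  by near: n; apply: (cvgr_gt _ u_cv).
have c2 : e_ n ^+ i @[n --> \oo] --> (0 : R) ^+ i.
  by apply: (@continuous_cvg _ _ _ _ _ e_ (fun x : R => x ^+ i)); [exact: exprn_continuous|exact: ecv].
have -> : (if i == 0%N then t `^ b else 0) = 0 ^+ i * t `^ b.
  by case: (i) => [|k]; rewrite ?expr0 ?mul1r // expr0n mul0r.
exact: cvgM c2 c1.
Unshelve. all: by end_near. Qed.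

End cutoff_limits.

Lemma is_derive_comp1 {R : realType} (V : normedModType R) (F : R -> R) (u : V -> R)
    (x v : V) (dF du : R) :
  differentiable u x -> is_derive x v u du -> is_derive (u x) (1 : R) F dF ->
  is_derive x v (F \o u) (dF * du).
Proof.
move=> udiff hu [dvF EF]; have Fdiff : differentiable F (u x) by exact/derivable1_diffP.
have FuD : differentiable (F \o u) x by exact: differentiable_comp.
have duE : 'd u x v = du by rewrite -deriveE //; case: hu.
split; first exact: diff_derivable FuD.
rewrite (deriveE _ FuD) (diff_comp udiff Fdiff) /= duE.
have -> : du = du *: (1 : R) by rewrite -[_ *: _]/(_ * _) mulr1.
by rewrite linearZ /= -(deriveE _ Fdiff) EF -[_ *: dF]/(_ * _) mulrC -[_ *: 1]/(_ * _) mulr1.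
Qed.

(** * Differentiation of families of cutoffs *)
Section radial_families.
Context {R : realType} {d : nat}.
Local Notation E := 'rV[R]_d.
Local Notation P := (mpoly d R).
Local Notation leb := (lebesgue_rV d).
Local Notation B := (unit_ball : set E).
Implicit Types (e be : R) (q : P) (x : E) (i j : 'I_d).

(** A term (q, i, l) of exponent be stands for the function
    q(x) e^i F_(be - l)(1 - e - |x|^2), where F_b(u) = u^b exp (- e / u). Formally,
    as e tends to 0, it tends to q (1 - |x|^2)^be if i = l = 0 and to 0 if i > 0.
    Keeping the terms as data separates this formal limit from analysis. *)
Definition term : Type := P * nat * nat.
Implicit Types (T : seq term) (t : term).

Definition eval_term e be t x : R :=
  peval t.1.1 x * (e ^+ t.1.2 * cutoff e (be - t.2%:R) (1 - e - sqnorm2 x)).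

Definition eval_terms e be T x : R := \sum_(t <- T) eval_term e be t x.

(** The terms of the derivative, of exponent be - 1, since
    F_b' = b F_(b-1) + e F_(b-2) and |x|^2 = 1 - e - u. *)
Definition partial_term be j t : seq term :=
  let: (q, i, l) := t in
  [:: ((1 - rsq R d) * mderiv j q - mpolyC d (2 * (be - l%:R)) * (xvar R j * q), i, l);
      (- mderiv j q, i.+1, l);
      (mpolyC d (-2) * (xvar R j * q), i.+1, l.+1)].

Definition partial_terms be j T : seq term := flatten [seq partial_term be j t | t <- T].

Definition lap_terms be T : seq term :=
  flatten [seq partial_terms (be - 1) j (partial_terms be j T) | j <- enum 'I_d].

Definition drot_terms i j T : seq term := [seq (drot i j t.1.1, t.1.2, t.2) | t <- T].

Definition sphlap_terms T : seq term :=
  flatten [seq flatten [seq drot_terms i j (drot_terms i j T) | j <- enum 'I_d & (i < j)%N]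
          | i <- enum 'I_d].

(** The condition l <= i of [cutoff_dominated], which differentiation preserves. *)
Definition wf_terms T := all (fun t => (t.2 <= t.1.2)%N) T.

(** The polynomial q such that the family tends to q (1 - |x|^2)^be. *)
Definition lim_terms T : P := \sum_(t <- T | t.1.2 == 0%N) t.1.1.

Lemma eval_terms_cat e be T1 T2 x :
  eval_terms e be (T1 ++ T2) x = eval_terms e be T1 x + eval_terms e be T2 x.
Proof. exact: big_cat. Qed.

Lemma eval_terms_flatten e be (I : Type) (r : seq I) (F : I -> seq term) x :
  eval_terms e be (flatten [seq F a | a <- r]) x = \sum_(a <- r) eval_terms e be (F a) x.
Proof.
elim: r => [|a r IH] /=; first by rewrite /eval_terms !big_nil.
by rewrite eval_terms_cat IH big_cons.
Qed.

Lemma lim_terms_flatten (I : Type) (r : seq I) (F : I -> seq term) :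
  lim_terms (flatten [seq F a | a <- r]) = \sum_(a <- r) lim_terms (F a).
Proof.
elim: r => [|a r IH] /=; first by rewrite /lim_terms !big_nil.
by rewrite /lim_terms big_cat /= big_cons -IH.
Qed.

Lemma wf_partial_terms be j T : wf_terms T -> wf_terms (partial_terms be j T).
Proof.
elim: T => // -[[q i] l] T IH /= /andP[/= li wT].
by rewrite /wf_terms /= li (leqW li) ltnS li -/(wf_terms _) IH.
Qed.

Lemma wf_flatten (I : Type) (r : seq I) (F : I -> seq term) :
  (forall a, wf_terms (F a)) -> wf_terms (flatten [seq F a | a <- r]).
Proof. by move=> h; elim: r => //= a r IH; rewrite /wf_terms all_cat -!/(wf_terms _) h. Qed.

Lemma wf_lap_terms be T : wf_terms T -> wf_terms (lap_terms be T).
Proof.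
by move=> wT; apply: wf_flatten => j; do 2 apply: wf_partial_terms.
Qed.

Lemma wf_drot_terms i j T : wf_terms T -> wf_terms (drot_terms i j T).
Proof. by rewrite /wf_terms all_map. Qed.

Lemma wf_sphlap_terms T : wf_terms T -> wf_terms (sphlap_terms T).
Proof.
move=> wT; apply: wf_flatten => i; apply: wf_flatten => j.
by do 2 apply: wf_drot_terms.
Qed.

Lemma lim_partial_terms be j T : wf_terms T ->
  lim_terms (partial_terms be j T) = dstar be j (lim_terms T).
Proof.
move=> wT; rewrite /partial_terms lim_terms_flatten.
rewrite {2}/lim_terms linear_sum /= [RHS]big_mkcond.
elim: T wT => [|[[q i] l] T IH] /=; first by rewrite !big_nil.
move=> /andP[/= li wT]; rewrite !big_cons -(IH wT); congr (_ + _).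
rewrite /lim_terms !big_cons big_nil /=; case: eqP li => [->|_] //=.
by rewrite leqn0 => /eqP ->; rewrite subr0 addr0.
Qed.

Lemma lim_lap_terms be T : wf_terms T -> lim_terms (lap_terms be T) = lapstar be (lim_terms T).
Proof.
move=> wT; rewrite /lap_terms lim_terms_flatten big_enum /=; apply: eq_bigr => j _.
by rewrite !lim_partial_terms ?wf_partial_terms.
Qed.

Lemma lim_drot_terms i j T : lim_terms (drot_terms i j T) = drot i j (lim_terms T).
Proof. by rewrite /lim_terms big_map linear_sum. Qed.

Lemma lim_sphlap_terms T : lim_terms (sphlap_terms T) = sphlap (lim_terms T).
Proof.
rewrite /sphlap_terms lim_terms_flatten big_enum /=; apply: eq_bigr => i _.
rewrite lim_terms_flatten big_filter big_enum_cond /=; apply: eq_bigr => j _.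
by rewrite !lim_drot_terms.
Qed.

Lemma differentiable_eval_term e be t x : 0 < e -> differentiable (eval_term e be t) x.
Proof.
case: t => [[q i] l] e0.
pose b := be - l%:R.
pose u (y : E) := 1 - e - sqnorm2 y.
have uE : u = peval (mpolyC d (1 - e) - rsq R d).
  by apply/funext => y; rewrite pevalB pevalC peval_rsq.
have du : differentiable u x by rewrite uE; exact: differentiable_peval.
have dc : differentiable (cutoff e b) (u x).
  by apply/derivable1_diffP; case: (is_derive_cutoff b (u x) e0).
have -> : eval_term e be (q, i, l) = peval q * (e ^+ i *: (cutoff e b \o u)) by [].
apply: differentiableM; first exact: differentiable_peval.
by apply: differentiableZ; exact: differentiable_comp.
Qed.

Lemma is_derive_eval_term e be t j x : 0 < e ->
  is_derive x (delta_mx 0 j) (eval_term e be t) (eval_terms e (be - 1) (partial_term be j t) x).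
Proof.
case: t => [[q i] l] e0.
pose b := be - l%:R.
pose u (y : E) := 1 - e - sqnorm2 y.
have uE : u = peval (mpolyC d (1 - e) - rsq R d).
  by apply/funext => y; rewrite pevalB pevalC peval_rsq.
have du : differentiable u x by rewrite uE; exact: differentiable_peval.
have dU : is_derive x (delta_mx 0 j) u (- (2 * x 0 j)).
  have := is_derive_peval (mpolyC d (1 - e) - rsq R d) j x.
  rewrite -uE linearB /= mderivC mderiv_rsq sub0r -(mpolyC_nat d R 2) /peval mevalN.
  by rewrite -!/(peval _ x) pevalM pevalC pevalX.
have dC := is_derive_comp1 du dU (is_derive_cutoff b (u x) e0).
have -> : eval_term e be (q, i, l) = peval q * (e ^+ i *: (cutoff e b \o u)) by [].
apply: is_derive_eq.
  apply: is_deriveM; first exact: is_derive_peval.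
rewrite /eval_terms /= !big_cons big_nil /eval_term /= addr0.
rewrite !(pevalM, pevalB, pevalC, pevalX, peval1, peval_rsq).
have -> : peval (- mderiv j q) x = - peval (mderiv j q) x by exact: mevalN.
have -> : be - 1 - l%:R = b - 1 by rewrite /b; ring.
have -> : be - 1 - l.+1%:R = b - 2 by rewrite /b -natr1; ring.
rewrite -[1 - e - sqnorm2 x]/(u x) !exprS.
have -> : (e ^+ i *: (cutoff e b \o u)) x = e ^+ i * (u x * cutoff e (b - 1) (u x)).
  by rewrite -cutoffS.
have -> : sqnorm2 x = 1 - e - u x by rewrite /u; ring.
rewrite -!/(_ * _) /b.
rewrite -[_ *: (_ *: _)]/(_ * (_ * _)) -[_ *: peval _ _]/(_ * _).
move: (cutoff e (be - l%:R - 1) (u x)) (cutoff e (be - l%:R - 2) (u x)) (u x) (peval q x)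
  (peval (mderiv j q) x) (e ^+ i) (x 0 j).
move=> c1 c2 ux p1 p2 ei xj; ring.
Qed.

Lemma is_derive_eval_terms e be T j x : 0 < e ->
  is_derive x (delta_mx 0 j) (eval_terms e be T) (eval_terms e (be - 1) (partial_terms be j T) x).
Proof.
move=> e0; elim: T => [|t T IH].
  have -> : eval_terms e be [::] = cst 0 by apply/funext => y; rewrite /eval_terms big_nil.
  rewrite /eval_terms big_nil; exact: is_derive_cst.
have -> : eval_terms e be (t :: T) = eval_term e be t + eval_terms e be T.
  by apply/funext => y; rewrite /eval_terms big_cons.
rewrite /partial_terms /= eval_terms_cat.
have h := is_derive_eval_term be t j x e0.
exact: is_deriveD.
Qed.

Lemma partial_eval_terms e be T j : 0 < e ->
  partial j (eval_terms e be T) = eval_terms e (be - 1) (partial_terms be j T).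
Proof. by move=> e0; apply: partial_eq => x; exact: is_derive_eval_terms. Qed.

Lemma smooth_eval_terms e be T : 0 < e -> smooth (eval_terms e be T).
Proof.
move=> e0; apply: (smooth_coind (S := fun psi => exists be T, psi = eval_terms e be T)).
- move=> _ [be' [T' ->]] x.
  elim: T' => [|t T' IH].
    rewrite (_ : eval_terms _ _ _ = cst 0); first exact: differentiable_cst.
    by apply/funext => y; rewrite /eval_terms big_nil.
  have -> : eval_terms e be' (t :: T') = eval_term e be' t + eval_terms e be' T'.
    by apply/funext => y; rewrite /eval_terms big_cons.
  apply: differentiableD => //.
  by case: t => [[q i] l]; exact: differentiable_eval_term.
- move=> _ i [be' [T' ->]]; rewrite partial_eval_terms //.
  by exists (be' - 1), (partial_terms be' i T').
- by exists be, T.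
Qed.

Lemma eval_terms_off e be T x : 1 - e <= sqnorm2 x -> eval_terms e be T x = 0.
Proof.
move=> h; rewrite /eval_terms big1 // => t _; rewrite /eval_term cutoff_le0; first by rewrite !mulr0.
by rewrite subr_le0.
Qed.

Lemma test_eval_terms e be T : 0 < e -> test_function (eval_terms e be T).
Proof.
move=> e0; split; first exact: smooth_eval_terms.
exists [set x : E | sqnorm2 x <= 1 - e].
  split; first by apply: compact_sublevel; rewrite gerBl ltW.
  by rewrite open_unit_ballE => x /= h; rewrite (le_lt_trans h) // gtrBl.
by move=> x /= /negP; rewrite -ltNge => /ltW; exact: eval_terms_off.
Qed.

Lemma eval_lap_terms e be T x : 0 < e ->
  \sum_j partial j (partial j (eval_terms e be T)) x = eval_terms e (be - 2) (lap_terms be T) x.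
Proof.
move=> e0; rewrite eval_terms_flatten big_enum /=; apply: eq_bigr => j _.
rewrite !partial_eval_terms //; congr (eval_terms _ _ _ _); ring.
Qed.

(** Rotations act trivially on the radial factor. *)
Lemma drot_fun_eval_terms e be T i j : 0 < e ->
  drot_fun i j (eval_terms e be T) = eval_terms e be (drot_terms i j T).
Proof.
move=> e0; apply/funext => x; rewrite /drot_fun !partial_eval_terms //.
rewrite eval_terms_flatten eval_terms_flatten /eval_terms big_map.
rewrite !mulr_sumr -sumrB; apply: eq_bigr => -[[q k] l] _ /=.
rewrite !big_cons !big_nil /eval_term /= !addr0.
rewrite /drot !(pevalM, pevalB, pevalC, pevalX, peval1, peval_rsq).
have N p : peval (- p) x = - peval p x by exact: mevalN.
rewrite !N !exprS (cutoffS e (be - l%:R)).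
have -> : be - 1 - l%:R = be - l%:R - 1 by ring.
move: (cutoff e (be - l%:R - 1) (1 - e - sqnorm2 x)) => c1.
move: (cutoff e (be - 1 - l.+1%:R) (1 - e - sqnorm2 x)) => c2.
move: (sqnorm2 x) (peval q x) (peval (mderiv j q) x) (peval (mderiv i q) x) => s p1 p2 p3.
move: (e ^+ k) (x 0 j) (x 0 i) => ek xj xi; ring.
Qed.

Lemma eval_sphlap_terms e be T x : 0 < e ->
  \sum_(i < d) \sum_(j < d | (i < j)%N) drot_fun i j (drot_fun i j (eval_terms e be T)) x =
  eval_terms e be (sphlap_terms T) x.
Proof.
move=> e0; rewrite eval_terms_flatten big_enum /=; apply: eq_bigr => i _.
rewrite eval_terms_flatten big_filter big_enum_cond /=; apply: eq_bigr => j _.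
by rewrite !drot_fun_eval_terms.
Qed.

(** The integrand is a partial derivative of a function supported in the ball. *)
Lemma integral_partial_terms e be T j : 0 < e ->
  \int[leb]_(x in B) eval_terms e (be - 1) (partial_terms be j T) x = 0.
Proof.
move=> e0.
rewrite /Rintegral integral_mkcond.
have -> : (fun x => (eval_terms e (be - 1) (partial_terms be j T) x)%:E) \_ B =
    fun x => (eval_terms e (be - 1) (partial_terms be j T) x)%:E.
  apply/funext => x; rewrite patchE; case: ifPn => // /negP; rewrite inE unit_ballE /= => h.
  by rewrite eval_terms_off //; move/negP: h; rewrite -ltNge => h; lra.
rewrite (_ : (\int[leb]_x _)%E = 0%E) //; apply: (@integral_partial0 R d j (eval_terms e be T)).
- by apply: smooth_continuous; exact: smooth_eval_terms.
- by move=> x; exact: is_derive_eval_terms.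
- move=> x nx; apply: eval_terms_off; rewrite leNgt; apply/negP => h; apply: nx => i.
  by rewrite in_itv /= -ler_norml; apply: coord_le1; lra.
Qed.

End radial_families.

(** * Weighted integrals on the ball *)
Section weighted_integrals.
Context {R : realType} {d : nat}.
Local Notation E := 'rV[R]_d.
Local Notation leb := (lebesgue_rV d).
Local Notation B := (unit_ball : set E).
Implicit Types (mu nu : R) (f g h : E -> R) (x : E).

Definition wintegrable mu h := leb.-integrable B (fun x => (h x * weight mu x)%:E).
Definition wint mu h : R := \int[leb]_(x in B) (h x * weight mu x).

Lemma weightE mu x : weight mu x = (1 - sqnorm2 x) `^ mu.
Proof. by rewrite /weight enorm2_sqr. Qed.

Lemma weight_ge0 mu x : 0 <= weight mu x.
Proof. exact: powR_ge0. Qed.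

Lemma measurable_weight mu : measurable_fun B (weight mu : E -> R).
Proof.
apply: measurable_funTS; rewrite (_ : weight mu = (fun t => t `^ mu) \o (fun x : E => 1 - sqnorm2 x)).
  apply: measurableT_comp; first exact: measurable_powR.
  apply: measurable_funB; first exact: measurable_cst.
  by apply: continuous_measurable_rV; exact: continuous_sqnorm2.
by apply/funext => x; rewrite weightE.
Qed.

Let mB : measurable B := measurable_unit_ball.

Lemma wintegrableD mu f g : wintegrable mu f -> wintegrable mu g ->
  wintegrable mu (fun x => f x + g x).
Proof.
move=> hf hg; have := integrableD mB hf hg; rewrite /wintegrable.
by congr (integrable _ _ _); apply/funext => x; rewrite /= -EFinD -mulrDl.
Qed.

Lemma wintegrableZ mu c f : wintegrable mu f -> wintegrable mu (fun x => c * f x).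
Proof.
move=> hf; have := integrableZl mB c hf; rewrite /wintegrable.
by congr (integrable _ _ _); apply/funext => x; rewrite /= -EFinM mulrA.
Qed.

Lemma wintD mu f g : wintegrable mu f -> wintegrable mu g ->
  wint mu (fun x => f x + g x) = wint mu f + wint mu g.
Proof.
move=> hf hg; rewrite /wint -RintegralD //.
by apply: eq_Rintegral => x _; rewrite mulrDl.
Qed.

Lemma wintZ mu c f : wintegrable mu f -> wint mu (fun x => c * f x) = c * wint mu f.
Proof.
move=> hf; rewrite /wint -RintegralZl //.
by apply: eq_Rintegral => x _; rewrite mulrA.
Qed.

Lemma wint_ge0 mu f : (forall x, B x -> 0 <= f x) -> 0 <= wint mu f.
Proof. by move=> h; apply: Rintegral_ge0 => x Bx; rewrite mulr_ge0 ?h ?weight_ge0. Qed.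

Lemma le_wint mu f g : wintegrable mu f -> wintegrable mu g ->
  (forall x, B x -> f x <= g x) -> wint mu f <= wint mu g.
Proof. by move=> hf hg h; apply: le_Rintegral => // x Bx; rewrite ler_wpM2r ?h ?weight_ge0. Qed.

Lemma eq_wint mu f g : (forall x, B x -> f x = g x) -> wint mu f = wint mu g.
Proof. by move=> h; apply: eq_Rintegral => x; rewrite inE => Bx; rewrite h. Qed.

Lemma wintegrable_le mu f g : measurable_fun B f -> wintegrable mu g ->
  (forall x, B x -> `|f x| <= g x) -> wintegrable mu f.
Proof.
move=> mf ig fg; apply: (le_integrable mB) ig.
  by apply/measurable_EFinP; apply: measurable_funM => //; exact: measurable_weight.
move=> x Bx; rewrite /= lee_fin normrM (ger0_norm (weight_ge0 _ _)).
by rewrite (le_trans _ (ler_norm _)) // ler_wpM2r ?weight_ge0 ?fg.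
Qed.

Lemma wintegrable_norm mu f : wintegrable mu f -> wintegrable mu (fun x => `|f x|).
Proof.
move=> /integrable_abse; rewrite /wintegrable.
congr (integrable _ _ _); apply/funext => x; rewrite /= normrM.
by rewrite (ger0_norm (weight_ge0 _ _)).
Qed.

Definition L2 mu f := measurable_fun B f /\ wintegrable mu (fun x => f x ^+ 2).

Definition dot mu f g : R := wint mu (fun x => f x * g x).

Lemma L2M mu f g : L2 mu f -> L2 mu g -> wintegrable mu (fun x => f x * g x).
Proof.
move=> [mf if_] [mg ig]; apply: (wintegrable_le _ (wintegrableD if_ ig)).
  exact: measurable_funM.
move=> x _; rewrite normrM -[f x ^+ 2]real_normK ?num_real // -[g x ^+ 2]real_normK ?num_real //.
have := sqr_ge0 (`|f x| - `|g x|); rewrite sqrrB.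
move: (`|f x|) (`|g x|) (normr_ge0 (f x)) (normr_ge0 (g x)) => a b a0 b0 h.
have := mulr_ge0 a0 b0; lra.
Qed.

Lemma L2DZ mu c f g : L2 mu f -> L2 mu g -> L2 mu (fun x => c * f x + g x).
Proof.
move=> hf hg; have [mf if_] := hf; have [mg ig] := hg; split.
  by apply: measurable_funD => //; apply: measurable_funM => //; exact: measurable_cst.
rewrite (_ : (fun x => (c * f x + g x) ^+ 2) =
  fun x => c ^+ 2 * f x ^+ 2 + (2 * c * (f x * g x) + g x ^+ 2)); last first.
  by apply/funext => x; ring.
apply: wintegrableD; first exact: wintegrableZ.
by apply: wintegrableD => //; apply: wintegrableZ; exact: L2M.
Qed.

Lemma dotC mu f g : dot mu f g = dot mu g f.
Proof. by apply: eq_wint => x _; rewrite mulrC. Qed.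

Lemma dotDZ mu c f g h : L2 mu f -> L2 mu g -> L2 mu h ->
  dot mu (fun x => c * f x + g x) h = c * dot mu f h + dot mu g h.
Proof.
move=> hf hg hh; have i1 := L2M hf hh; have i2 := L2M hg hh.
rewrite /dot -wintZ // -wintD //; last exact: wintegrableZ.
by apply: eq_wint => x _; ring.
Qed.

Lemma dot_ge0 mu f : 0 <= dot mu f f.
Proof. by apply: wint_ge0 => x _; rewrite -expr2 sqr_ge0. Qed.

Lemma dot_cauchy mu f g : L2 mu f -> L2 mu g -> dot mu f g ^+ 2 <= dot mu f f * dot mu g g.
Proof.
move=> hf hg; apply: discriminant_le => [|t]; first exact: dot_ge0.
have htg : L2 mu (fun x => t * g x + f x) by exact: L2DZ.
have := dot_ge0 mu (fun x => t * g x + f x).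
rewrite dotDZ // (dotC _ g) (dotC _ f (fun x => t * g x + f x)) !dotDZ // (dotC _ g f).
by move=> h; apply: (le_trans h); lra.
Qed.

Lemma weight_le mu nu x : -1 < mu -> mu <= nu -> B x -> weight nu x <= weight mu x + 1.
Proof.
rewrite unit_ballE /= => mu1 munu Bx; rewrite !weightE.
have t0 : 0 <= 1 - sqnorm2 x by rewrite subr_ge0.
have t1 : 1 - sqnorm2 x <= 1 by rewrite gerBl sqnorm2_ge0.
move: t0; rewrite le_eqVlt => /predU1P[<-|t0].
  by rewrite /powR eqxx; case: (nu == 0) => /=; rewrite ?lerDr ?ler0n // addr_ge0.
by rewrite (le_trans (ger_powR _ munu)) ?t0 //= lerDl.
Qed.

(** Integrability of the weight. It is carried as a hypothesis, since only the case
    of a finite integral has a nontrivial normalization. *)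
Definition weight_int mu := leb.-integrable B (EFin \o (weight mu : E -> R)).

Lemma wintegrable1 mu : weight_int mu <-> wintegrable mu (cst 1).
Proof.
rewrite /weight_int /wintegrable.
by rewrite (_ : (fun x => (cst 1 x * weight mu x)%:E) = EFin \o weight mu) //;
  apply/funext => x; rewrite /= mul1r.
Qed.

Lemma weight_int_le mu nu : -1 < mu -> mu <= nu -> weight_int mu -> weight_int nu.
Proof.
move=> mu1 munu imu.
have i1 : leb.-integrable B (EFin \o cst 1).
  apply: measurable_bounded_integrable => //; first exact: unit_ball_fin.
  by exists 1; split => // M M1 x _ /=; rewrite normr1 ltW.
apply: (le_integrable mB) (integrableD mB imu i1).
  by apply/measurable_EFinP; exact: measurable_weight.
move=> x Bx; rewrite /= lee_fin !ger0_norm ?addr_ge0 ?weight_ge0 //.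
exact: weight_le.
Qed.

Lemma peval_bounded (q : mpoly d R) : exists2 M, 0 <= M & forall x, B x -> `|peval q x| <= M.
Proof.
have cB : compact B by rewrite unit_ballE; exact: compact_sublevel.
have [M [_ hM]] := continuous_bounded_on cB (@continuous_peval R d q).
exists (`|M| + 1) => [|x Bx]; first by rewrite addr_ge0.
by apply: hM => //; rewrite ltr_pwDr // ler_norm.
Qed.

Lemma measurable_peval (q : mpoly d R) : measurable_fun B (peval q).
Proof. by apply: measurable_funTS; apply: continuous_measurable_rV; exact: continuous_peval. Qed.

Lemma wintegrable_peval mu (q : mpoly d R) : weight_int mu -> wintegrable mu (peval q).
Proof.
move=> /wintegrable1 imu; have [M M0 hM] := peval_bounded q.
apply: (wintegrable_le _ (wintegrableZ M imu)); first exact: measurable_peval.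
by move=> x Bx; rewrite /= mulr1 hM.
Qed.

Lemma L2_peval mu (q : mpoly d R) : weight_int mu -> L2 mu (peval q).
Proof.
move=> imu; split; first exact: measurable_peval.
by rewrite (_ : (fun x => _) = peval (q * q)); [exact: wintegrable_peval|
  apply/funext => x; rewrite pevalM].
Qed.

Lemma L2_cst mu c : weight_int mu -> L2 mu (cst c).
Proof.
move=> imu; rewrite (_ : cst c = peval (mpolyC d c)); first exact: L2_peval.
by apply/funext => x; rewrite pevalC.
Qed.

Lemma L2_wintegrable mu f : weight_int mu -> L2 mu f -> wintegrable mu f.
Proof.
move=> imu hf; have := L2M hf (L2_cst 1 imu).
by congr (wintegrable _ _); apply/funext => x; rewrite mulr1.
Qed.

End weighted_integrals.

(** * Adjoints of the operators for the weighted integrals *)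
Section limits.
Context {R : realType} {d : nat}.
Local Notation E := 'rV[R]_d.
Local Notation P := (mpoly d R).
Local Notation leb := (lebesgue_rV d).
Local Notation B := (unit_ball : set E).
Implicit Types (mu nu be : R) (f g h : E -> R) (x : E) (q : P) (T : seq (@term R d)).
Hypothesis d_gt0 : (0 < d)%N.

Let mB : measurable B := measurable_unit_ball.

Lemma ae_open_ball : {ae leb, forall x, B x -> sqnorm2 x < 1}.
Proof.
exists [set x : E | sqnorm2 x = 1]; split.
- rewrite (_ : [set x | _] = @sqnorm2 R d @^-1` [set 1]) //.
  apply: closed_measurable_rV; apply: preimage_closed => [x _|]; last exact: closed_eq.
  exact: continuous_sqnorm2.
- by move: (d_gt0); case: (d) => // n _; exact: sphere_null.
- move=> x /=; apply: contra_notP => /eqP x1; rewrite unit_ballE /= => x2.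
  by rewrite lt_neqAle x1.
Qed.

Let eps (n : nat) : R := n.+1%:R^-1.

Let eps_gt0 n : 0 < eps n.
Proof. by rewrite invr_gt0. Qed.

Let eps_le1 n : eps n <= 1.
Proof. by rewrite invf_le1 ?ler1n ?ltr0n. Qed.

Let eps_cvg : eps n @[n --> \oo] --> (0 : R).
Proof. exact: cvg_harmonic. Qed.

Lemma eval_terms_dominated be T : -1 < be -> wf_terms T ->
  exists2 C, 0 <= C & forall n x, B x -> `|eval_terms (eps n) be T x| <= C * weight be x.
Proof.
move=> be1; elim: T => [_|[[q i] l] T IH /= /andP[/= li /IH[C C0 hC]]].
  by exists 0 => // n x _; rewrite /eval_terms big_nil normr0 mul0r.
have [M M0 hM] := peval_bounded q.
have [D D0 hD] := cutoff_dominated li be1.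
exists (M * D + C) => [|n x Bx]; first by rewrite addr_ge0 ?mulr_ge0.
rewrite /eval_terms big_cons mulrDl (le_trans (ler_normD _ _)) // lerD ?hC //.
rewrite /eval_term /= normrM -mulrA; apply: ler_pM => //; first exact: hM.
rewrite ger0_norm; last by rewrite mulr_ge0 ?cutoff_ge0 // exprn_ge0 // ltW.
have [s1|s1] := ltP (sqnorm2 x) 1; last first.
  rewrite cutoff_le0 ?mulr0 ?mulr_ge0 ?weight_ge0 //.
  by have := eps_gt0 n; lra.
have := hD (eps n) (1 - sqnorm2 x); rewrite eps_gt0 eps_le1 subr_gt0 s1 weightE => /(_ isT isT).
by rewrite addrAC.
Qed.

Lemma eval_terms_cvg be T x : wf_terms T -> sqnorm2 x < 1 ->
  eval_terms (eps n) be T x @[n --> \oo] --> peval (lim_terms T) x * weight be x.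
Proof.
move=> + x1; elim: T => [_|[[q i] l] T IH /= /andP[/= li /IH h]].
  rewrite /lim_terms big_nil -(mpolyC0 d R) pevalC mul0r.
  by under eq_fun do rewrite /eval_terms big_nil; exact: cvg_cst.
under eq_fun do rewrite /eval_terms big_cons.
have -> : peval (lim_terms ((q, i, l) :: T)) x * weight be x =
    peval q x * (if i == 0%N then (1 - sqnorm2 x) `^ (be - l%:R) else 0)
    + peval (lim_terms T) x * weight be x.
  rewrite /lim_terms big_cons /=; case: eqP li => [->|_] li.
    by move: li; rewrite leqn0 => /eqP ->; rewrite pevalD mulrDl subr0 weightE.
  by rewrite mulr0 add0r.
apply: cvgD => //; apply: cvgMr.
have t0 : 0 < 1 - sqnorm2 x by rewrite subr_gt0.
have := @cutoff_cvg R eps i (be - l%:R) (1 - sqnorm2 x) eps_gt0 eps_cvg t0.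
by under eq_fun do rewrite addrAC.
Qed.

(** Dominated convergence: the bound is [cutoff_dominated], uniform in e, and the
    pointwise limit holds off the sphere, which is a null set. *)
Lemma eval_terms_limit be T h : -1 < be -> wf_terms T -> measurable_fun B h ->
  wintegrable be h ->
  \int[leb]_(x in B) (h x * eval_terms (eps n) be T x) @[n --> \oo] -->
    wint be (fun x => h x * peval (lim_terms T) x).
Proof.
move=> be1 wT mh ih; have [C C0 hC] := eval_terms_dominated be1 wT.
have mev n : measurable_fun B (eval_terms (eps n) be T).
  apply: measurable_funTS; apply: continuous_measurable_rV.
  by apply: smooth_continuous; exact: smooth_eval_terms.
have mlim : measurable_fun B (fun x => h x * peval (lim_terms T) x).
  by apply: measurable_funM => //; exact: measurable_peval.
have mw := @measurable_weight R d be.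
have [] := @dominated_convergence _ _ _ leb B mB
  (fun n x => (h x * eval_terms (eps n) be T x)%:E)
  (fun x => (h x * peval (lim_terms T) x * weight be x)%:E)
  (fun x => (C * `|h x| * weight be x)%:E).
- by move=> n; apply/measurable_EFinP; exact: measurable_funM.
- by apply/measurable_EFinP; exact: measurable_funM.
- apply: filterS ae_open_ball => x hx Bx; apply/cvg_EFin; first by near=> n.
  by rewrite -mulrA; apply: cvgMr; apply: eval_terms_cvg => //; exact: hx.
- exact: (wintegrableZ C (wintegrable_norm ih)).
- apply: aeW => x n Bx; rewrite /= lee_fin normrM -mulrA mulrCA.
  by rewrite ler_wpM2l // hC.
move=> ilim _ cv; rewrite /wint /Rintegral.
apply: fine_cvg; rewrite fineK //; exact: integrable_fin_num.
Unshelve. all: by end_near. Qed.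

Lemma wint_lim_terms be T h (c : R) : -1 < be -> wf_terms T -> measurable_fun B h ->
  wintegrable be h ->
  (forall e, 0 < e -> \int[leb]_(x in B) (h x * eval_terms e be T x) = c) ->
  wint be (fun x => h x * peval (lim_terms T) x) = c.
Proof.
move=> be1 wT mh ih hc; have := eval_terms_limit be1 wT mh ih.
rewrite (_ : (fun n => _) = cst c); last by apply/funext => n; rewrite hc.
by move=> /(cvg_lim (@norm_hausdorff _ R)) <-; rewrite lim_cst //; exact: norm_hausdorff.
Qed.

(** The limit of the divergence theorem for the families with compact support; the
    boundary term is lost because nu + 1 > 0. *)
Lemma wint_dstar nu j q : -1 < nu -> @weight_int R d nu ->
  wint nu (peval (dstar (nu + 1) j q) : E -> R) = 0.
Proof.
move=> nu1 inu.
have wT : wf_terms (partial_terms (nu + 1) j [:: (q, 0%N, 0%N)]) by exact: wf_partial_terms.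
have hc e : 0 < e -> \int[leb]_(x in B)
    (cst 1 x * eval_terms e nu (partial_terms (nu + 1) j [:: (q, 0%N, 0%N)]) x) = 0.
  move=> e0; rewrite -[RHS](integral_partial_terms (nu + 1) [:: (q, 0%N, 0%N)] j e0).
  by apply: eq_Rintegral => x _; rewrite /= mul1r addrK.
have m1 : measurable_fun B (cst 1 : E -> R) by exact: measurable_cst.
have := wint_lim_terms nu1 wT m1 ((wintegrable1 nu).1 inu) hc.
rewrite lim_partial_terms // /lim_terms big_cons big_nil /= addr0 => <-.
by apply: eq_wint => x _; rewrite mul1r.
Qed.

Lemma wint_drot nu i j q : -1 < nu -> @weight_int R d nu ->
  wint nu (peval (drot i j q) : E -> R) = 0.
Proof.
move=> nu1 inu; have [->|ij] := eqVneq i j.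
  rewrite drot_diag (_ : peval 0 = fun x => 0 * cst 1 x) ?wintZ ?mul0r //.
    exact/wintegrable1.
  by apply/funext => x; rewrite -(mpolyC0 d R) pevalC mul0r.
pose T : seq (@term R d) := [:: (q, 0%N, 0%N)].
pose Ti k : seq (@term R d) := [:: (xvar R k * q, 0%N, 0%N)].
have wT : wf_terms (drot_terms i j T) by [].
have hc e : 0 < e -> \int[leb]_(x in B) (cst 1 x * eval_terms e nu (drot_terms i j T) x) = 0.
  move=> e0.
  have TE k x : eval_terms e nu (Ti k) x = x 0 k * eval_terms e nu T x.
    by rewrite /eval_terms !big_cons !big_nil /eval_term /= !addr0 pevalM pevalX -mulrA.
  have iT k l : leb.-integrable B (EFin \o eval_terms e (nu - 1) (partial_terms nu l (Ti k))).
    apply: measurable_bounded_integrable => //; first exact: unit_ball_fin.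
      apply: measurable_funTS; apply: continuous_measurable_rV.
      by apply: smooth_continuous; exact: smooth_eval_terms.
    apply: continuous_bounded_on; first by rewrite unit_ballE; exact: compact_sublevel.
    by apply: smooth_continuous; exact: smooth_eval_terms.
  rewrite -[RHS](subrr 0) -{1}(integral_partial_terms nu (Ti i) j e0).
  rewrite -[X in _ - X](integral_partial_terms nu (Ti j) i e0) -RintegralB //.
  apply: eq_Rintegral => x _; rewrite mul1r -drot_fun_eval_terms // -!partial_eval_terms //.
  have TiE k : eval_terms e nu (Ti k) = fun y => y 0 k * eval_terms e nu T y by exact/funext.
  have sT := smooth_eval_terms nu T e0.
  have pk k l y : k != l ->
      partial l (eval_terms e nu (Ti k)) y = y 0 k * partial l (eval_terms e nu T) y.
    by move=> kl; rewrite (TiE k) (partial_coordM k l sT) (negPf kl) mul0r addr0.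
  by rewrite (pk i j x ij) (pk j i x) // eq_sym.
have m1 : measurable_fun B (cst 1 : E -> R) by exact: measurable_cst.
have := wint_lim_terms nu1 wT m1 ((wintegrable1 nu).1 inu) hc.
rewrite lim_drot_terms /lim_terms big_cons big_nil /= addr0 => <-.
by apply: eq_wint => x _; rewrite mul1r.
Qed.

Lemma dot_peval nu (p q : P) : dot nu (peval p : E -> R) (peval q) = wint nu (peval (p * q)).
Proof. by apply: eq_wint => x _; rewrite pevalM. Qed.

Lemma weightS nu x : -1 < nu -> B x -> (1 - sqnorm2 x) * weight nu x = weight (nu + 1) x.
Proof.
rewrite unit_ballE /= => nu1 x1; rewrite !weightE.
have : 0 <= 1 - sqnorm2 x by rewrite subr_ge0.
rewrite le_eqVlt => /predU1P[<-|t0].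
  by rewrite mul0r powR0 // gt_eqF //; lra.
by rewrite powRD ?(gt_eqF t0) ?implybT // powRr1 ?ltW // mulrC.
Qed.

Lemma dot_mderiv nu j (p q : P) : -1 < nu -> @weight_int R d nu ->
  dot (nu + 1) (peval (mderiv j p) : E -> R) (peval q) =
  - dot nu (peval p : E -> R) (peval (dstar (nu + 1) j q)).
Proof.
move=> nu1 inu; apply/eqP; rewrite -addr_eq0; apply/eqP.
rewrite -(wint_dstar j (p * q) nu1 inu) !dot_peval.
have -> : wint (nu + 1) (peval (mderiv j p * q) : E -> R) =
    wint nu (peval ((1 - rsq R d) * (mderiv j p * q)) : E -> R).
  apply: eq_Rintegral => x; rewrite inE => Bx.
  by rewrite -weightS // [in RHS]pevalM pevalB peval1 peval_rsq; ring.
rewrite -wintD; [|exact: wintegrable_peval|exact: wintegrable_peval].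
apply: eq_wint => x _; rewrite -pevalD (mul_mderiv_dstar (nu + 1)); congr (peval _ x); ring.
Qed.

Lemma dot_drot nu i j (p q : P) : -1 < nu -> @weight_int R d nu ->
  dot nu (peval (drot i j p) : E -> R) (peval q) = - dot nu (peval p : E -> R) (peval (drot i j q)).
Proof.
move=> nu1 inu; apply/eqP; rewrite -addr_eq0; apply/eqP.
rewrite -(wint_drot i j (p * q) nu1 inu) !dot_peval.
rewrite -wintD; [|exact: wintegrable_peval|exact: wintegrable_peval].
by apply: eq_wint => x _; rewrite -pevalD drotM.
Qed.

Lemma dot_sum_l (I : Type) (r : seq I) (S : pred I) (F : I -> P) nu (q : P) :
  @weight_int R d nu ->
  dot nu (peval (\sum_(i <- r | S i) F i) : E -> R) (peval q) =
  \sum_(i <- r | S i) dot nu (peval (F i) : E -> R) (peval q).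
Proof.
move=> inu; elim: r => [|a r IH].
  have -> : dot nu (peval (\sum_(i <- [::] | S i) F i) : E -> R) (peval q) =
      wint nu (fun x => 0 * peval q x).
    by apply: eq_wint => x _; rewrite big_nil -(mpolyC0 d R) pevalC.
  by rewrite big_nil wintZ ?mul0r //; exact: wintegrable_peval.
rewrite !big_cons; case: ifP => // _; rewrite -IH -[dot _ (peval (F a)) _]mul1r -dotDZ.
- by apply: eq_wint => x _; rewrite pevalD mul1r.
- exact: L2_peval.
- exact: L2_peval.
- exact: L2_peval.
Qed.

Lemma dot_sum_r (I : Type) (r : seq I) (S : pred I) (F : I -> P) nu (q : P) :
  @weight_int R d nu ->
  dot nu (peval q : E -> R) (peval (\sum_(i <- r | S i) F i)) =
  \sum_(i <- r | S i) dot nu (peval q : E -> R) (peval (F i)).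
Proof. by move=> inu; rewrite dotC dot_sum_l //; apply: eq_bigr => i _; rewrite dotC. Qed.

Lemma dot_sphlap nu (p q : P) : -1 < nu -> @weight_int R d nu ->
  dot nu (peval (sphlap p) : E -> R) (peval q) = dot nu (peval p : E -> R) (peval (sphlap q)).
Proof.
move=> nu1 inu.
transitivity (\sum_(i < d) \sum_(j < d | (i < j)%N)
    dot nu (peval p : E -> R) (peval (drot i j (drot i j q)))).
  rewrite [LHS]dot_sum_l //; apply: eq_bigr => i _.
  rewrite [LHS]dot_sum_l //; apply: eq_bigr => j _.
  by rewrite (dot_drot _ _ (drot i j p)) // dot_drot // opprK.
rewrite [RHS]dot_sum_r //; apply: eq_bigr => i _.
by rewrite [RHS]dot_sum_r.
Qed.

Lemma dot_lap nu (p q : P) : -1 < nu -> @weight_int R d nu ->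
  dot (nu + 2) (peval (lap p) : E -> R) (peval q) =
  dot nu (peval p : E -> R) (peval (lapstar (nu + 2) q)).
Proof.
move=> nu1 inu.
have nu11 : -1 < nu + 1 by lra.
have inu1 : @weight_int R d (nu + 1) by apply: weight_int_le inu => //; lra.
have inu2 : @weight_int R d (nu + 2) by apply: weight_int_le inu => //; lra.
rewrite /lap /lapstar (dot_sum_l _ _ _ q inu2) (dot_sum_r _ _ _ p inu); apply: eq_bigr => j _.
have -> : nu + 2 - 1 = nu + 1 by ring.
have -> : nu + 2 = nu + 1 + 1 by ring.
by rewrite dot_mderiv // dot_mderiv // opprK.
Qed.

Lemma ball_form_dot mu : -1 < mu -> @weight_int R d mu ->
  ball_form mu (fun nu p q => dot nu (peval p : E -> R) (peval q)).
Proof.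
move=> mu1 imu.
have gt nu : mu <= nu -> -1 < nu by exact: lt_le_trans.
have int nu : mu <= nu -> @weight_int R d nu by move=> h; exact: weight_int_le imu.
split.
- by move=> nu p q; exact: dotC.
- move=> nu a p q r h; rewrite -dotDZ; try exact: (L2_peval _ (int _ h)).
  by apply: eq_wint => x _; rewrite pevalD pevalZ.
- by move=> nu p _; exact: dot_ge0.
- by move=> nu p q h; apply: dot_sphlap; [exact: gt|exact: int].
- by move=> nu p q h; apply: dot_lap; [exact: gt|exact: int].
Qed.

(** Each Laplacian lowers the exponent by 2. *)
Definition iter_lap_terms : nat -> R -> seq (@term R d) -> seq (@term R d) :=
  fix loop s be T := if s is s'.+1 then loop s' (be - 2) (lap_terms be T) else T.

Lemma wf_iter_lap_terms s be T : wf_terms T -> wf_terms (iter_lap_terms s be T).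
Proof. by elim: s be T => //= s IH be T wT; apply: IH; exact: wf_lap_terms. Qed.

Lemma lapstarsS s mu q :
  lapstars s.+1 mu q = lapstars s mu (lapstar (mu + (2 * s.+1)%:R) q).
Proof.
elim: s mu => [//|s IH] mu.
have -> : mu + (2 * s.+2)%:R = mu + 2 + (2 * s.+1)%:R by rewrite mulnS natrD addrA.
by rewrite -[RHS]/(lapstar (mu + 2) (lapstars s (mu + 2) _)) -IH.
Qed.

Lemma lim_iter_lap_terms s mu T : wf_terms T ->
  lim_terms (iter_lap_terms s (mu + (2 * s)%:R) T) = lapstars s mu (lim_terms T).
Proof.
elim: s T => //= s IH T wT; have -> : mu + (2 * s.+1)%:R - 2 = mu + (2 * s)%:R.
  by rewrite mulnS natrD; ring.
by rewrite IH ?wf_lap_terms // lim_lap_terms // -lapstarsS.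
Qed.

Lemma weakly_diff_iter_laplacian s n f : weakly_diff (2 * s + n) f ->
  weakly_diff n (iter s laplacian f).
Proof.
elim: s n => // s IH n h; apply: weakly_diff_laplacian; apply: IH.
by rewrite (_ : 2 * s + n.+2 = 2 * s.+1 + n)%N //; lia.
Qed.

Lemma pairing_iter_laplacian s f be T e : 0 < e -> weakly_diff (2 * s) f ->
  pairing (iter s laplacian f) (eval_terms e be T) =
  pairing f (eval_terms e (be - (2 * s)%:R) (iter_lap_terms s be T)).
Proof.
move=> e0; elim: s be T => [|s IH] be T fs; first by rewrite subr0.
have f2 : weakly_diff 2 (iter s laplacian f).
  by apply: weakly_diff_iter_laplacian; rewrite (_ : 2 * s + 2 = 2 * s.+1)%N //; lia.
have fs' : weakly_diff (2 * s) f by apply: weakly_diff_leq fs; lia.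
rewrite iterS pairing_laplacian //; last exact: test_eval_terms.
have lg := weakly_diff_locint f2.
rewrite pairing_sumr //; last first.
  by move=> j _; do 2 apply: test_partial; exact: test_eval_terms.
rewrite (_ : (fun x => _) = eval_terms e (be - 2) (lap_terms be T)); last first.
  by apply/funext => x; rewrite eval_lap_terms.
have -> : be - (2 * s.+1)%:R = be - 2 - (2 * s)%:R by rewrite mulnS natrD; ring.
exact: (IH (be - 2) (lap_terms be T) fs').
Qed.

Lemma weakly_diff_iter_laplace_beltrami s n f : weakly_diff (2 * s + n) f ->
  weakly_diff n (iter s laplace_beltrami f).
Proof.
elim: s n => // s IH n h; apply: weakly_diff_laplace_beltrami; apply: IH.
by rewrite (_ : 2 * s + n.+2 = 2 * s.+1 + n)%N //; lia.
Qed.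

Lemma pairing_iter_laplace_beltrami s f be T e : 0 < e -> weakly_diff (2 * s) f ->
  pairing (iter s laplace_beltrami f) (eval_terms e be T) =
  pairing f (eval_terms e be (iter s (@sphlap_terms R d) T)).
Proof.
move=> e0; elim: s T => [|s IH] T fs //.
have f2 : weakly_diff 2 (iter s laplace_beltrami f).
  by apply: weakly_diff_iter_laplace_beltrami; rewrite (_ : 2 * s + 2 = 2 * s.+1)%N //; lia.
have fs' : weakly_diff (2 * s) f by apply: weakly_diff_leq fs; lia.
have tt i j : test_function (drot_fun i j (drot_fun i j (eval_terms e be T))).
  by do 2 apply: test_drot_fun; exact: test_eval_terms.
rewrite iterS pairing_laplace_beltrami //; last exact: test_eval_terms.
have lg := weakly_diff_locint f2.
under eq_bigr do rewrite pairing_sumr //.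
rewrite pairing_sumr //; last by move=> i _; exact: test_sum.
rewrite (_ : (fun x => _) = eval_terms e be (sphlap_terms T)); last first.
  by apply/funext => x; rewrite eval_sphlap_terms.
by rewrite IH // iterSr.
Qed.

Lemma wf_iter_sphlap_terms s T : wf_terms T -> wf_terms (iter s (@sphlap_terms R d) T).
Proof. by move=> wT; elim: s => //= s; exact: wf_sphlap_terms. Qed.

Lemma lim_iter_sphlap_terms s T :
  lim_terms (iter s (@sphlap_terms R d) T) = iter s (@sphlap R d) (lim_terms T).
Proof. by elim: s => //= s <-; exact: lim_sphlap_terms. Qed.

(** An identity between pairings with two cutoff families passes to the limit on
    both sides. *)
Lemma dot_lim_terms be be' T T' f g q q' : -1 < be -> -1 < be' ->
  @weight_int R d be -> @weight_int R d be' -> wf_terms T -> wf_terms T' ->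
  L2 be f -> L2 be' g -> lim_terms T = q -> lim_terms T' = q' ->
  (forall e, 0 < e -> pairing f (eval_terms e be T) = pairing g (eval_terms e be' T')) ->
  dot be f (peval q) = dot be' g (peval q').
Proof.
move=> b1 b1' i i' wT wT' hf hg <- <- h.
have c1 := eval_terms_limit b1 wT hf.1 (L2_wintegrable i hf).
have c2 := eval_terms_limit b1' wT' hg.1 (L2_wintegrable i' hg).
have hd := @norm_hausdorff _ R.
apply: etrans (esym (cvg_lim hd c1)) (etrans _ (cvg_lim hd c2)).
by congr (lim (_ @ \oo)); apply/funext => n; exact: h.
Qed.

(** The family of limit q (1 - |x|^2)^(mu+2s) consists of test functions, on
    which weak derivatives act by definition; its s-th Laplacian has the limit
    lapstars s mu q times the weight of exponent mu. *)
Lemma dot_iter_laplacian s mu f q : -1 < mu -> @weight_int R d mu ->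
  weakly_diff (2 * s) f -> L2 mu f -> L2 (mu + (2 * s)%:R) (iter s laplacian f) ->
  dot (mu + (2 * s)%:R) (iter s laplacian f) (peval q) = dot mu f (peval (lapstars s mu q)).
Proof.
move=> mu1 imu fs hf hg.
have s0 : 0 <= (2 * s)%:R :> R by exact: ler0n.
have be1 : -1 < mu + (2 * s)%:R by lra.
have ibe : @weight_int R d (mu + (2 * s)%:R) by apply: weight_int_le imu => //; rewrite lerDl.
pose T : seq (@term R d) := [:: (q, 0%N, 0%N)].
have limT : lim_terms T = q by rewrite /lim_terms big_cons big_nil /= addr0.
have wT : wf_terms T by [].
apply: (dot_lim_terms be1 mu1 ibe imu wT (wf_iter_lap_terms s (mu + (2 * s)%:R) wT) hg hf limT).
  by rewrite lim_iter_lap_terms // limT.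
move=> e e0; have := pairing_iter_laplacian (mu + (2 * s)%:R) T e0 fs.
by rewrite addrK.
Qed.

Lemma dot_iter_laplace_beltrami s mu f q : -1 < mu -> @weight_int R d mu ->
  weakly_diff (2 * s) f -> L2 mu f -> L2 mu (iter s laplace_beltrami f) ->
  dot mu (iter s laplace_beltrami f) (peval q) = dot mu f (peval (iter s (@sphlap R d) q)).
Proof.
move=> mu1 imu fs hf hg.
pose T : seq (@term R d) := [:: (q, 0%N, 0%N)].
have limT : lim_terms T = q by rewrite /lim_terms big_cons big_nil /= addr0.
have wT : wf_terms T by [].
apply: (dot_lim_terms mu1 mu1 imu imu wT (wf_iter_sphlap_terms s wT) hg hf limT).
  by rewrite lim_iter_sphlap_terms // limT.
by move=> e e0; exact: pairing_iter_laplace_beltrami.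
Qed.

End limits.

(** * Density of polynomials *)
Section density.
Import HBNNSimple.
Context {R : realType} {d : nat}.
Local Notation E := 'rV[R]_d.
Local Notation P := (mpoly d R).
Local Notation leb := (lebesgue_rV d).
Local Notation B := (unit_ball : set E).
Variable mu : R.
Hypothesis imu : @weight_int R d mu.
Implicit Types (f g h G : E -> R) (x : E) (q : P) (A : set E) (M c e : R).

Let mB : measurable B := measurable_unit_ball.

Definition approximable f :=
  L2 mu f /\ forall e, 0 < e -> exists q, wint mu (fun x => (f x - peval q x) ^+ 2) <= e.

Lemma approximable_peval q : approximable (peval q).
Proof.
split; first exact: L2_peval.
move=> e e0; exists q; rewrite (_ : wint _ _ = 0) ?ltW //.
have i0 : wintegrable mu (cst 1 : E -> R) by exact/wintegrable1.
rewrite -[RHS](mul0r (wint mu (cst 1 : E -> R))) -wintZ //.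
by apply: eq_wint => x _; rewrite subrr mul0r expr0n.
Qed.

Lemma L2B f g : L2 mu f -> L2 mu g -> L2 mu (fun x => f x - g x).
Proof.
move=> hf hg; have := L2DZ (-1) hg hf.
by rewrite (_ : (fun x => -1 * g x + f x) = (fun x => f x - g x)) //; apply/funext => x; ring.
Qed.

Lemma eq_L2 f g : (forall x, B x -> f x = g x) -> L2 mu f -> L2 mu g.
Proof.
move=> fg [mf if_].
have mg : measurable_fun B g.
  by apply: eq_measurable_fun mf => x; rewrite inE => /fg.
split => //; apply: (wintegrable_le _ if_); first exact: measurable_funX.
by move=> x Bx; rewrite ger0_norm ?sqr_ge0 // fg.
Qed.

Lemma approximable_closed f : L2 mu f ->
  (forall e, 0 < e -> exists2 g, approximable g & wint mu (fun x => (f x - g x) ^+ 2) <= e) ->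
  approximable f.
Proof.
move=> hf h; split => // e e0.
have e4 : 0 < e / 4 by rewrite divr_gt0.
have [g [hg ag] fg] := h _ e4; have [q gq] := ag _ e4; exists q.
have hq := L2_peval q imu.
have [_ i1] := L2B hf hg; have [_ i2] := L2B hg hq; have [_ i3] := L2B hf hq.
apply: (@le_trans _ _ (wint mu (fun x => 2 * (f x - g x) ^+ 2 + 2 * (g x - peval q x) ^+ 2))).
  apply: le_wint => //; first by apply: wintegrableD; exact: wintegrableZ.
  move=> x _; have := sqr_ge0 ((f x - g x) - (g x - peval q x)).
  by move: (f x) (g x) (peval q x) => a b c; lra.
rewrite wintD; [|exact: wintegrableZ|exact: wintegrableZ].
by rewrite !wintZ //; lra.
Qed.

Lemma eq_approximable f g : (forall x, B x -> f x = g x) -> approximable f -> approximable g.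
Proof.
move=> fg [hf af]; split; first exact: eq_L2 hf.
by move=> e /af[q hq]; exists q; apply: le_trans hq; rewrite le_eqVlt; apply/orP; left;
  apply/eqP; apply: eq_wint => x Bx; rewrite fg.
Qed.

Lemma approximableDZ c f g : approximable f -> approximable g ->
  approximable (fun x => c * f x + g x).
Proof.
move=> [hf af] [hg ag]; split; first exact: L2DZ.
move=> e e0.
have c0 : 0 < 1 + c ^+ 2 by have := sqr_ge0 c; lra.
have e1 : 0 < e / (4 * (1 + c ^+ 2)) by rewrite divr_gt0 // mulr_gt0.
have e4 : 0 < e / 4 by rewrite divr_gt0.
have [p fp] := af _ e1; have [q gq] := ag _ e4; exists (c *: p + q).
have hp := L2_peval p imu; have hq := L2_peval q imu.
have [_ i1] := L2B hf hp; have [_ i2] := L2B hg hq.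
have [_ i3] := L2B (L2DZ c hf hg) (L2_peval (c *: p + q) imu).
apply: (@le_trans _ _ (wint mu
    (fun x => (2 * c ^+ 2) * (f x - peval p x) ^+ 2 + 2 * (g x - peval q x) ^+ 2))).
  apply: le_wint => //; first by apply: wintegrableD; exact: wintegrableZ.
  move=> x _; rewrite pevalD pevalZ.
  have := sqr_ge0 (c * (f x - peval p x) - (g x - peval q x)).
  by move: (f x) (g x) (peval p x) (peval q x) => a b a' b'; lra.
rewrite wintD; [|exact: wintegrableZ|exact: wintegrableZ].
rewrite !wintZ // -[leRHS](_ : e / 2 + 2 * (e / 4) = e); last by field.
rewrite lerD ?ler_pM2l //.
apply: (@le_trans _ _ (2 * c ^+ 2 * (e / (4 * (1 + c ^+ 2))))).
  by rewrite ler_wpM2l // mulr_ge0 // sqr_ge0.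
have -> : 2 * c ^+ 2 * (e / (4 * (1 + c ^+ 2))) = e / 2 * (c ^+ 2 / (1 + c ^+ 2)).
  by field; rewrite gt_eqF.
rewrite ger_pMr; last by rewrite divr_gt0.
by rewrite ler_pdivrMr // mul1r lerDr.
Qed.

Lemma approximable_cst c : approximable (cst c).
Proof.
by apply: eq_approximable (approximable_peval (mpolyC d c)) => x _; rewrite pevalC.
Qed.

Lemma approximable_limit (F : nat -> E -> R) f G : L2 mu G ->
  (forall n, approximable (F n)) -> (forall n x, B x -> `|F n x| <= G x) ->
  (forall x, B x -> F n x @[n --> \oo] --> f x) -> approximable f.
Proof.
move=> hG aF FG Ff.
have fG x : B x -> `|f x| <= G x.
  move=> Bx; have cn : `|F n x| @[n --> \oo] --> `|f x| by apply: cvg_norm; exact: Ff.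
  rewrite -(cvg_lim (@norm_hausdorff _ R) cn); apply: limr_le.
    by apply/cvg_ex; eexists; exact: cn.
  by near=> n; exact: FG.
have mF n : measurable_fun B (F n) by case: (aF n) => -[].
have mf : measurable_fun B f by exact: (measurable_fun_cvg mF Ff).
have hf : L2 mu f.
  split => //; apply: (wintegrable_le _ hG.2); first exact: measurable_funX.
  move=> x Bx; rewrite ger0_norm ?sqr_ge0 // -[f x ^+ 2]real_normK ?num_real //.
  by rewrite lerXn2r ?nnegrE ?fG // (le_trans _ (fG _ Bx)).
apply: approximable_closed => // e e0.
have iFf n : wintegrable mu (fun x => (f x - F n x) ^+ 2) by apply: (L2B hf (aF n).1).2.
have [] := @dominated_convergence _ _ _ leb B mB
  (fun n x => ((f x - F n x) ^+ 2 * weight mu x)%:E) (fun x => 0%E)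
  (fun x => (4 * G x ^+ 2 * weight mu x)%:E).
- move=> n; apply/measurable_EFinP; apply: measurable_funM; last exact: measurable_weight.
  by apply: measurable_funX; exact: measurable_funB.
- exact: measurable_cst.
- apply: aeW => x Bx; apply/cvg_EFin; first by near=> n.
  rewrite -[X in _ --> X](mul0r (weight mu x)); apply: cvgMl.
  rewrite -[X in _ --> X](_ : (f x - f x) ^+ 2 = 0); last by rewrite subrr expr0n.
  have cF := Ff x Bx; under eq_fun do rewrite expr2; rewrite expr2.
  by apply: cvgM; apply: cvgB => //; exact: cvg_cst.
- exact: (wintegrableZ 4 hG.2).
- apply: aeW => x n Bx; rewrite /= lee_fin normrM (ger0_norm (weight_ge0 _ _)).
  rewrite ler_wpM2r ?weight_ge0 // ger0_norm ?sqr_ge0 // -real_normK ?num_real //.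
  have h : `|f x - F n x| <= 2 * G x.
    by rewrite (le_trans (ler_normB _ _)) // mulr_natl mulr2n lerD ?fG ?FG.
  rewrite (_ : 4 * G x ^+ 2 = (2 * G x) ^+ 2); last by ring.
  by rewrite lerXn2r ?nnegrE // (le_trans _ h).
move=> _ _; rewrite integral0_eq // => cv.
have {}cv : wint mu (fun x => (f x - F n x) ^+ 2) @[n --> \oo] --> (0 : R).
  rewrite /wint /Rintegral.
  by apply: fine_cvg.
have /cvgrPdist_le /(_ e e0) [N _ hN] := cv.
exists (F N) => //; have := hN N (leqnn N).
by rewrite sub0r normrN ger0_norm // wint_ge0 // => x _; rewrite sqr_ge0.
Unshelve. all: by end_near. Qed.

Definition bounded_on_ball f := exists M, forall x, B x -> `|f x| <= M.

(** Approximate f by a polynomial p first, where multiplying the error by the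
    bounded g does no harm, and then g by a polynomial, where multiplying the error
    by the bounded p does none. *)
Lemma approximableM f g : approximable f -> approximable g -> bounded_on_ball g ->
  approximable (fun x => f x * g x).
Proof.
move=> [hf af] [hg ag] [M0 hM0].
have [M M1 hM] : exists2 M, 1 <= M & forall x, B x -> `|g x| <= M.
  by exists (Num.max 1 M0) => [|x Bx]; rewrite le_max ?lexx // hM0 ?orbT.
have L2bd h : L2 mu h -> L2 mu (fun x => h x * g x).
  move=> [mh ih]; split; first by apply: measurable_funM => //; case: hg.
  apply: (wintegrable_le _ (wintegrableZ (M ^+ 2) ih)).
    by apply: measurable_funX; apply: measurable_funM => //; case: hg.
  move=> x Bx; rewrite ger0_norm ?sqr_ge0 // exprMn mulrC ler_wpM2r ?sqr_ge0 //.
  by rewrite -[g x ^+ 2]real_normK ?num_real // lerXn2r ?nnegrE ?hM // (le_trans _ M1).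
apply: approximable_closed; first exact: L2bd.
move=> e e0.
have M20 : 0 < M ^+ 2 by rewrite exprn_gt0 // (lt_le_trans _ M1).
have [p fp] := af (e / M ^+ 2) (divr_gt0 e0 M20).
have hp := L2_peval p imu; have [mfp ifp] := L2B hf hp.
exists (fun x => peval p x * g x); last first.
  apply: (@le_trans _ _ (wint mu (fun x => M ^+ 2 * (f x - peval p x) ^+ 2))).
    apply: le_wint.
    - exact: (L2B (L2bd _ hf) (L2bd _ hp)).2.
    - exact: wintegrableZ.
    - move=> x Bx; rewrite -mulrBl exprMn mulrC ler_wpM2r ?sqr_ge0 //.
      by rewrite -[g x ^+ 2]real_normK ?num_real // lerXn2r ?nnegrE ?hM // (le_trans _ M1).
  by rewrite wintZ // mulrC -ler_pdivlMr.
split; first exact: L2bd.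
move=> e1 e10; have [C C0 hC] := peval_bounded p.
have C20 : 0 < 1 + C ^+ 2 by have := sqr_ge0 C; lra.
have [q gq] := ag (e1 / (1 + C ^+ 2)) (divr_gt0 e10 C20).
exists (p * q); have hq := L2_peval q imu; have [mgq igq] := L2B hg hq.
apply: (@le_trans _ _ (wint mu (fun x => (1 + C ^+ 2) * (g x - peval q x) ^+ 2))).
  apply: le_wint.
  - exact: (L2B (L2bd _ hp) (L2_peval _ imu)).2.
  - exact: wintegrableZ.
  - move=> x Bx; rewrite pevalM -mulrBr exprMn ler_wpM2r ?sqr_ge0 //.
    rewrite -[leLHS]real_normK ?num_real // (@le_trans _ _ (C ^+ 2)) ?lerDr //.
    by rewrite lerXn2r ?nnegrE ?hC.
by rewrite wintZ // mulrC -ler_pdivlMr.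
Qed.

(** The map (3 y - y^3) / 2 fixes -1, 0 and 1, and 1 - y is multiplied at each step
    by a factor at most 1 - y0 / 2 if the start y0 is positive. As an odd polynomial
    map of [-1, 1] into itself it makes the sign function a bounded limit of
    polynomials. *)
Lemma smoothstep_cvg (t : R) : `|t| <= 1 ->
  iter n (fun y => (3 * y - y ^+ 3) / 2) t @[n --> \oo] --> Num.sg t.
Proof.
pose T (y : R) := (3 * y - y ^+ 3) / 2.
have pos (y : R) : 0 < y -> y <= 1 -> iter n T y @[n --> \oo] --> (1 : R).
  move=> y0 y1.
  have h n : y <= iter n T y /\ 0 <= 1 - iter n T y <= (1 - y / 2) ^+ n.
    elim: n => [|n [IH1 /andP[IH2 IH3]]]; first by split => //=; rewrite expr0; apply/andP; lra.
    rewrite iterS; move: (iter n T y) IH1 IH2 IH3 => z yz z1 zn.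
    have z0 : 0 < z by lra.
    have E : 1 - T z = (1 - z) * (1 - (z + z ^+ 2) / 2) by rewrite /T; field.
    have zz : z ^+ 2 <= 1 by rewrite expr_le1 //; lra.
    have z20 := sqr_ge0 z.
    have E2 : T z - z = z * (1 - z ^+ 2) / 2 by rewrite /T; field.
    have : 0 <= z * (1 - z ^+ 2) by rewrite mulr_ge0 //; lra.
    split; first lra.
    rewrite E (exprSr (1 - y / 2)) mulr_ge0 //=; last lra.
    by apply: ler_pM => //; lra.
  have g0 : (1 - y / 2) ^+ n @[n --> \oo] --> (0 : R).
    by apply: cvg_expr; rewrite ger0_norm; lra.
  have c0 : 1 - iter n T y @[n --> \oo] --> (0 : R).
    apply: (squeeze_cvgr _ (cvg_cst 0) g0).
    by near=> n; have [_ ->] := h n.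
  rewrite (_ : (fun n => iter n T y) = (fun n => 1 - (1 - iter n T y))); last first.
    by apply/funext => n; rewrite subKr.
  by rewrite -[X in _ --> X]subr0; apply: cvgB c0; exact: cvg_cst.
have [t0|t0|->] := ltgtP t 0.
- rewrite ler0_norm ?(ltW t0) // => t1; rewrite ltr0_sg //.
  have -> : (fun n => iter n T t) = (fun n => - iter n T (- t)).
    by apply/funext; elim=> /= [|n ->]; rewrite ?opprK // /T; field.
  by apply: cvgN; apply: pos; lra.
- by rewrite gtr0_norm // => t1; rewrite gtr0_sg //; apply: pos.
- move=> _; rewrite sgr0 (_ : (fun n => iter n T 0) = cst 0); first exact: cvg_cst.
  by apply/funext; elim=> [//|n /= ->]; rewrite /T expr0n mulr0 subrr mul0r.
Unshelve. all: by end_near. Qed.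

(** The indicator is (sg^2 - sg) / 2 at x_j - a, rescaled into [-1, 1]. *)
Lemma approximable_half_space (j : 'I_d) (a : R) :
  approximable (\1_[set x : E | x 0 j < a] : E -> R).
Proof.
pose p : P := ((1 + `|a|)^-1) *: (xvar R j - mpolyC d a).
have a0 : 0 < 1 + `|a| by rewrite ltr_pwDl.
have pE x : peval p x = (x 0 j - a) / (1 + `|a|).
  by rewrite pevalZ pevalB pevalX pevalC mulrC.
have p1 x : B x -> `|peval p x| <= 1.
  rewrite unit_ballE => Bx; rewrite pE normrM normfV (gtr0_norm a0) ler_pdivrMr // mul1r.
  by rewrite (le_trans (ler_normB _ _)) // lerD // coord_le1.
have asg : approximable (fun x => Num.sg (peval p x)).
  apply: (@approximable_limit
    (fun n x => peval (iter n (fun q => 2^-1 *: (3 *: q - q ^+ 3)) p) x) _ (cst 1)).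
  - exact: L2_cst.
  - by move=> n; exact: approximable_peval.
  - move=> n x Bx; elim: n => [|n]; first exact: p1.
    rewrite iterS; move: (iter n _ p) => q /=; rewrite pevalZ pevalB pevalZ !exprS expr0 mulr1 !pevalM.
    move: (peval q x) => t; rewrite !ler_norml => /andP[t1 t2].
    have tt : 0 <= (1 - t) ^+ 2 * (2 + t) by rewrite mulr_ge0 ?sqr_ge0 //; lra.
    have tt' : 0 <= (1 + t) ^+ 2 * (2 - t) by rewrite mulr_ge0 ?sqr_ge0 //; lra.
    by apply/andP; split; lra.
  - move=> x Bx; have := smoothstep_cvg (p1 x Bx).
    rewrite (_ : (fun n => iter n _ _) =
      (fun n => peval (iter n (fun q => 2^-1 *: (3 *: q - q ^+ 3)) p) x)) //.
    apply/funext; elim=> //= n ->.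
    by rewrite pevalZ pevalB pevalZ !exprS !expr0 !mulr1 !pevalM mulrC.
have b1 : bounded_on_ball (fun x => Num.sg (peval p x)).
  by exists 1 => x _; rewrite normr_sg; case: (_ != 0).
have := approximableDZ 2^-1 (approximableM asg asg b1)
  (approximableDZ (- 2^-1) asg (approximable_cst 0)).
apply: eq_approximable => x Bx; rewrite indicE /=.
have E1 : ((x \in [set x : E | x 0 j < a]) : bool) = (peval p x < 0).
  rewrite pE pmulr_llt0 ?invr_gt0 // subr_lt0; apply/idP/idP; first by rewrite inE.
  by move=> h; rewrite inE.
rewrite E1; case: ltgtP => h.
- by rewrite ltr0_sg //; rewrite /=; lra.
- by rewrite gtr0_sg //; rewrite /=; lra.
- by rewrite h sgr0; rewrite /=; lra.
Qed.

(** Since bounded approximable functions form an algebra stable under bounded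
    limits, the sets with an approximable indicator form a sigma-algebra; it
    contains the half-spaces, which generate. *)
Lemma approximable_indic A : measurable A -> approximable (\1_A : E -> R).
Proof.
have bd (C : set E) : bounded_on_ball (\1_C : E -> R).
  by exists 1 => x _; rewrite indicE; case: (x \in _); rewrite ?normr1 ?normr0 /=.
have aC (C : set E) : approximable (\1_C : E -> R) -> approximable (\1_(~` C) : E -> R).
  move=> aC; apply: eq_approximable (approximableDZ (-1) aC (approximable_cst 1)) => x _.
  by rewrite !indicE in_setC; case: (x \in C) => /=; lra.
have a0 : approximable (\1_(set0 : set E) : E -> R).
  by apply: eq_approximable (approximable_cst 0) => x _; rewrite indicE in_set0.
have aI (C D : set E) : approximable (\1_C : E -> R) -> approximable (\1_D : E -> R) ->
    approximable (\1_(C `&` D) : E -> R).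
  move=> a b; apply: eq_approximable (approximableM a b (bd _)) => x _.
  by rewrite !indicE in_setI; case: (x \in C); case: (x \in D) => /=; lra.
have aU (F : (set E)^nat) : (forall n, approximable (\1_(F n) : E -> R)) ->
    approximable (\1_(\bigcup_n F n) : E -> R).
  move=> aF; apply: (@approximable_limit
    (fun n => \1_(~` (\big[setI/setT]_(i < n) ~` F i))) _ (cst 1)).
  - exact: L2_cst.
  - move=> n; apply: (aC); elim: n => [|n IH].
      by rewrite big_ord0 -setC0; exact: aC.
    by rewrite big_ord_recr /=; apply: aI => //; exact: aC.
  - by move=> n x _ /=; rewrite indicE; case: (x \in _); rewrite ?normr1 ?normr0 /=.
  - move=> x _; have [[k _ Fk]|nF] := pselect ((\bigcup_n F n) x).
      apply: cvg_near_cst.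
      exists k.+1 => // n kn; rewrite !indicE (mem_set (ex_intro2 _ _ k I Fk)) mem_set //.
      by rewrite -(bigcap_mkord _ (fun i => ~` F i)) => /(_ k kn).
    apply: cvg_near_cst.
    exists 0%N => // n _; rewrite !indicE (memNset nF) memNset //.
    by apply; rewrite -(bigcap_mkord _ (fun i => ~` F i)) => k _ Fk; apply: nF; exists k.
pose S := [set C : set E | approximable (\1_C : E -> R)].
suff : (measurable : set (set E)) `<=` S by apply.
apply: smallest_sub.
  by split; [exact: a0|move=> C; rewrite setTD; exact: aC|exact: aU].
rewrite -bigcup_seq; apply: bigcup_sub => j _ _ [C mC <-]; rewrite setTI.
pose Sj := [set C : set R | approximable (\1_((fun x : E => x 0 j) @^-1` C) : E -> R)].
suff : (measurable : set (set R)) `<=` Sj by apply.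
have -> : (measurable : set (set R)) = <<s @RGenInftyO.G R >> by exact: RGenInftyO.measurableE.
apply: smallest_sub.
  split; first by rewrite /Sj /= preimage_set0.
    by move=> D; rewrite setTD /Sj /= preimage_setC; exact: aC.
  by move=> F; rewrite /Sj /= preimage_bigcup; exact: aU.
move=> _ [a ->]; rewrite /Sj /=.
exact: approximable_half_space j a.
Qed.

(** Simple functions increase to the positive and to the negative part of f. *)
Lemma L2_approximable f : L2 mu f -> approximable f.
Proof.
have pos g : L2 mu g -> (forall x, B x -> 0 <= g x) -> approximable g.
  move=> hg g0; have mg : measurable_fun B (EFin \o g) by apply/measurable_EFinP; case: hg.
  have cv x : B x -> nnsfun_approx mB mg n x @[n --> \oo] --> g x.
    move=> Bx; have := @cvg_nnsfun_approx _ _ _ _ mB _ mg (fun y By => g0 y By) x Bx.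
    by move=> /fine_cvgP[_].
  apply: (@approximable_limit (fun n => nnsfun_approx mB mg n) _ g) => //.
  - move=> n; set F := nnsfun_approx mB mg n.
    apply: eq_approximable (fun x _ => esym (fimfunEord F x)) _.
    elim: (size _) => [|k IH].
      by apply: eq_approximable (approximable_cst 0) => x _; rewrite big_ord0.
    apply: eq_approximable (approximableDZ _ (approximable_indic _) IH) => [x _|].
      by rewrite big_ord_recr /= addrC.
    exact: measurable_funPTI.
  - move=> n x Bx; rewrite ger0_norm //.
    have nd : nondecreasing_seq (fun k => nnsfun_approx mB mg k x).
      by move=> k l kl; move/lefP: (nd_nnsfun_approx mB mg kl).
    have c := cv x Bx; rewrite -(cvg_lim (@norm_hausdorff _ R) c).
    by apply: nondecreasing_cvgn_le => //; apply/cvg_ex; eexists; exact: c.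
move=> hf; have [mf if_] := hf.
have ap : approximable f^\+.
  apply: pos => //; split; first exact: measurable_funrpos.
  apply: (wintegrable_le _ if_); first by apply: measurable_funX; exact: measurable_funrpos.
  move=> x _; rewrite ger0_norm ?sqr_ge0 // /funrpos maxEle.
  by case: ifP => _; rewrite ?expr0n ?sqr_ge0.
have an : approximable f^\-.
  apply: pos => //; split; first exact: measurable_funrneg.
  apply: (wintegrable_le _ if_); first by apply: measurable_funX; exact: measurable_funrneg.
  move=> x _; rewrite ger0_norm ?sqr_ge0 // /funrneg maxEle.
  by case: ifP => _; rewrite ?expr0n ?sqr_ge0 ?sqrrN.
apply: eq_approximable (approximableDZ (-1) an ap) => x _.
by rewrite -[in RHS](funrposBneg f) /= mulN1r addrC.
Qed.

End density.

(** * Orthogonal projections and the main estimate *)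
Section best_polynomials.
Context {R : realType} {d : nat}.
Local Notation E := 'rV[R]_d.
Local Notation P := (mpoly d R).
Local Notation leb := (lebesgue_rV d).
Local Notation B := (unit_ball : set E).
Implicit Types (mu nu : R) (f g : E -> R) (p q : P) (n k s : nat).

Definition nrm nu f : R := Num.sqrt (dot nu f f).

Lemma nrm_ge0 nu f : 0 <= nrm nu f.
Proof. exact: sqrtr_ge0. Qed.

Lemma nrm_sqr nu f : nrm nu f ^+ 2 = dot nu f f.
Proof. by rewrite sqr_sqrtr ?dot_ge0. Qed.

Lemma dotDl nu f g h : L2 nu f -> L2 nu g -> L2 nu h ->
  dot nu (fun x => f x + g x) h = dot nu f h + dot nu g h.
Proof.
move=> hf hg hh; rewrite -[dot nu f h]mul1r -dotDZ //.
by apply: eq_wint => x _; rewrite mul1r.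
Qed.

Lemma dotBl nu f g h : L2 nu f -> L2 nu g -> L2 nu h ->
  dot nu (fun x => f x - g x) h = dot nu f h - dot nu g h.
Proof.
move=> hf hg hh; rewrite addrC -mulN1r -dotDZ //.
by apply: eq_wint => x _; rewrite mulN1r [f x - g x]addrC.
Qed.

Lemma L2D nu f g : L2 nu f -> L2 nu g -> L2 nu (fun x => f x + g x).
Proof.
move=> hf hg; have := L2DZ 1 hf hg; congr (L2 _ _).
by apply/funext => x; rewrite mul1r.
Qed.

Lemma dot_sqrD nu f g : L2 nu f -> L2 nu g ->
  dot nu (fun x => f x + g x) (fun x => f x + g x) =
  dot nu f f + 2 * dot nu f g + dot nu g g.
Proof.
move=> hf hg; have hfg := L2D hf hg.
rewrite dotDl // (dotC _ f) (dotC _ g) !dotDl // (dotC _ g f); ring.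
Qed.

Lemma nrmD nu f g : L2 nu f -> L2 nu g ->
  nrm nu (fun x => f x + g x) <= nrm nu f + nrm nu g.
Proof.
move=> hf hg; have hfg := L2D hf hg.
rewrite -[leRHS]ger0_norm ?addr_ge0 ?nrm_ge0 // -sqrtr_sqr ler_wsqrtr //.
rewrite dot_sqrD // sqrrD !nrm_sqr.
suff : dot nu f g <= nrm nu f * nrm nu g by lra.
rewrite -sqrtrM ?dot_ge0 // (le_trans (ler_norm _)) // -sqrtr_sqr ler_wsqrtr //.
exact: dot_cauchy.
Qed.

(** The projection of f is the Riesz representative of q |-> <f, q> on a
    finite-dimensional space. *)
Lemma projection nu k f : (0 < d)%N -> -1 < nu -> @weight_int R d nu -> L2 nu f ->
  exists2 p, deg_lt k p &
    forall q, deg_lt k q -> dot nu (peval p : E -> R) (peval q) = dot nu f (peval q).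
Proof.
move=> d_gt0 nu1 inu hf.
have lin a (p q : P) : dot nu f (peval (a *: p + q)) = a * dot nu f (peval p) + dot nu f (peval q).
  rewrite !(dotC _ f) -dotDZ //; try exact: L2_peval.
  by apply: eq_wint => x _; rewrite pevalD pevalZ.
have bd (p : P) : dot nu f (peval p) ^+ 2 <= dot nu f f * dot nu (peval p : E -> R) (peval p).
  by apply: dot_cauchy => //; exact: L2_peval.
exact: (riesz_deg (ball_form_dot d_gt0 nu1 inu) k (lexx nu) lin bd).
Qed.

Lemma projection_best nu k f p q : @weight_int R d nu -> L2 nu f ->
  (forall q, deg_lt k q -> dot nu (peval p : E -> R) (peval q) = dot nu f (peval q)) ->
  deg_lt k p -> deg_lt k q ->
  nrm nu (fun x => f x - peval p x) <= nrm nu (fun x => f x - peval q x).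
Proof.
move=> inu hf hp kp kq.
have Lp := L2_peval p inu; have Lq := L2_peval q inu.
have Lfp : L2 nu (fun x => f x - peval p x) by exact: L2B.
have Lpq := L2_peval (p - q) inu.
rewrite ler_wsqrtr //.
have -> : dot nu (fun x => f x - peval q x) (fun x => f x - peval q x) =
    dot nu (fun x => (f x - peval p x) + peval (p - q) x)
           (fun x => (f x - peval p x) + peval (p - q) x).
  by apply: eq_wint => x _; rewrite pevalB; ring.
have o : dot nu (fun x => f x - peval p x) (peval (p - q)) = 0.
  by rewrite dotBl // hp ?subrr //; exact: deg_ltB.
rewrite (dot_sqrD Lfp Lpq) o mulr0 addr0.
by rewrite lerDl dot_ge0.
Qed.

Lemma projection_density nu f e : -1 < nu -> @weight_int R d nu -> L2 nu f -> 0 < e ->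
  exists K, forall k p, (K <= k)%N -> deg_lt k p ->
    (forall q, deg_lt k q -> dot nu (peval p : E -> R) (peval q) = dot nu f (peval q)) ->
    nrm nu (fun x => f x - peval p x) <= e.
Proof.
move=> nu1 inu hf e0; have [_ af] := L2_approximable inu hf.
have [q hq] := af (e ^+ 2) (exprn_gt0 2 e0); have [K Kq] := deg_lt_exists q.
exists K => k p Kk kp hp.
apply: le_trans (projection_best inu hf hp kp (deg_ltW Kq Kk)) _.
by rewrite -[leRHS]gtr0_norm // -sqrtr_sqr ler_wsqrtr.
Qed.

Lemma iter_sphlap_sym nu s p q : (0 < d)%N -> -1 < nu -> @weight_int R d nu ->
  dot nu (peval (iter s (@sphlap R d) p) : E -> R) (peval q) =
  dot nu (peval p : E -> R) (peval (iter s (@sphlap R d) q)).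
Proof.
move=> d_gt0 nu1 inu; elim: s q => [//|s IH] q.
have := dot_sphlap d_gt0 (iter s (@sphlap R d) p) q nu1 inu.
move=> e; apply: etrans e _; apply: etrans (IH (sphlap q)) _.
by rewrite -(iterSr s (@sphlap R d) q).
Qed.

Lemma deg_lt_lapstars k s nu p : deg_lt k p -> deg_lt (k + 2 * s) (lapstars s nu p).
Proof.
move=> kp; elim: s nu => [|s IH] nu; first by rewrite addn0.
by rewrite mulnS addnCA; exact: deg_lt_lapstar.
Qed.

(** The hypothesis says that f is the projection of g on the line of f. *)
Lemma nrm_le_of_dot nu f g : L2 nu f -> L2 nu g -> dot nu g f = dot nu f f ->
  dot nu f f <= dot nu g g.
Proof.
move=> hf hg e; have := dot_cauchy hg hf; rewrite e expr2.
have := dot_ge0 nu f; rewrite le_eqVlt => /predU1P[<- _|f0].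
  exact: dot_ge0.
by rewrite ler_pM2r.
Qed.

Lemma sum_sqr_bound (N X C G1 G2 a b : R) : 0 <= N -> 0 <= X -> 0 <= a -> 0 <= b -> 0 <= C ->
  N ^+ 2 * X ^+ 2 <= C * (G1 + G2) -> G1 <= a ^+ 2 -> G2 <= b ^+ 2 ->
  N * X <= Num.sqrt C * (a + b).
Proof.
move=> N0 X0 a0 b0 C0 h h1 h2; have ab := mulr_ge0 a0 b0.
rewrite -(ler_pXn2r (n := 2)) ?nnegrE ?mulr_ge0 ?addr_ge0 ?sqrtr_ge0 //.
rewrite !exprMn sqr_sqrtr //; apply: (le_trans h); rewrite ler_wpM2l //.
by rewrite (le_trans (lerD h1 h2)) // sqrrD -addrA lerD2l lerDr mulrn_wge0.
Qed.

Section estimate.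
Variables (mu : R) (s : nat).
Hypotheses (d_ge2 : (2 <= d)%N) (mu_gtN1 : -1 < mu) (s_gt0 : (0 < s)%N).
Hypothesis imu : @weight_int R d mu.
Local Notation nu := (mu + (2 * s)%:R).

Let d_gt0 : (0 < d)%N. Proof. exact: ltnW. Qed.

Let inu : @weight_int R d nu. Proof. by apply: weight_int_le imu; rewrite ?lerDl. Qed.

Let bf := ball_form_dot d_gt0 mu_gtN1 imu.

(** For h = pK - p, the form of L^s f - q0 with L^s h is the square norm of L^s h:
    the adjoint moves L^s to the right, where f can be replaced by pK as the
    degrees stay below K, and then pK by h and q0 by 0, as h is orthogonal to all
    degrees up to n. The same holds for the Laplace-Beltrami operator. *)
Lemma projection_gap_bound f q0 r0 n K p pK : weakly_diff (2 * s) f -> L2 mu f ->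
  L2 nu (iter s laplacian f) -> L2 mu (iter s laplace_beltrami f) ->
  (2 * s <= n)%N -> (n < K)%N -> deg_lt (n - 2 * s).+1 q0 -> deg_lt n.+1 r0 ->
  deg_lt n.+1 p -> deg_lt K pK ->
  (forall q, deg_lt n.+1 q -> dot mu (peval p : E -> R) (peval q) = dot mu f (peval q)) ->
  (forall q, deg_lt K q -> dot mu (peval pK : E -> R) (peval q) = dot mu f (peval q)) ->
  dot nu (peval (iter s (@lap R d) (pK - p)) : E -> R) (peval (iter s (@lap R d) (pK - p))) <=
    nrm nu (fun x => iter s laplacian f x - peval q0 x) ^+ 2 /\
  dot mu (peval (iter s (@sphlap R d) (pK - p)) : E -> R)
         (peval (iter s (@sphlap R d) (pK - p))) <=
    nrm mu (fun x => iter s laplace_beltrami f x - peval r0 x) ^+ 2.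
Proof.
move=> fs hf hg1 hg2 sn nK hq0 hr0 np KpK hp hpK.
have L q : L2 mu (peval q : E -> R) by exact: L2_peval.
have Ln q : L2 nu (peval q : E -> R) by exact: L2_peval.
have hK : deg_lt K (pK - p) by apply: deg_ltB => //; exact: deg_ltW nK.
have dB q : dot mu (peval (pK - p) : E -> R) (peval q) =
    dot mu (peval pK : E -> R) (peval q) - dot mu (peval p : E -> R) (peval q).
  by rewrite -dotBl //; apply: eq_wint => x _; rewrite pevalB.
have orth q : deg_lt n.+1 q -> dot mu (peval (pK - p) : E -> R) (peval q) = 0.
  by move=> nq; rewrite dB hp // hpK ?subrr //; exact: deg_ltW nK.
move: (pK - p) hK dB orth => h hK dB orth.
have adj u v : dot nu (peval (iter s (@lap R d) u) : E -> R) (peval v) =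
    dot mu (peval u : E -> R) (peval (lapstars s mu v)).
  exact: (ip_iter_lap bf s u v (lexx mu)).
have adj' u v : dot mu (peval (iter s (@sphlap R d) u) : E -> R) (peval v) =
    dot mu (peval u : E -> R) (peval (iter s (@sphlap R d) v)).
  exact: (iter_sphlap_sym s u v d_gt0 mu_gtN1 imu).
have K2 : (K - 2 * s + 2 * s = K)%N by rewrite subnK // (leq_trans sn) // ltnW.
have n2 : ((n - 2 * s).+1 + 2 * s = n.+1)%N by rewrite addSn subnK.
have hlap : deg_lt (K - 2 * s) (iter s (@lap R d) h) by exact: deg_lt_iter_lap.
have hsph : deg_lt K (iter s (@sphlap R d) h) by exact: deg_lt_iter_sphlap.
split; rewrite nrm_sqr; apply: nrm_le_of_dot.
- exact: Ln.
- exact: L2B.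
- have o1 : dot nu (peval q0 : E -> R) (peval (iter s (@lap R d) h)) = 0.
    by rewrite dotC adj orth // -n2; exact: deg_lt_lapstars.
  have o2 : dot mu (peval p : E -> R) (peval (lapstars s mu (iter s (@lap R d) h))) = 0.
    rewrite -adj dotC adj orth // -n2; apply: deg_lt_lapstars.
    by rewrite -subSn //; exact: deg_lt_iter_lap.
  rewrite (dotBl hg1 (Ln q0) (Ln _)) o1 subr0.
  rewrite (dot_iter_laplacian d_gt0 _ mu_gtN1 imu fs hf hg1) -hpK; last first.
    by rewrite -K2; exact: deg_lt_lapstars.
  by rewrite adj dB o2 subr0.
- exact: L.
- exact: L2B.
- have o1 : dot mu (peval r0 : E -> R) (peval (iter s (@sphlap R d) h)) = 0.
    by rewrite dotC adj' orth //; exact: deg_lt_iter_sphlap.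
  have o2 : dot mu (peval p : E -> R) (peval (iter s (@sphlap R d) (iter s (@sphlap R d) h))) = 0.
    by rewrite -adj' dotC adj' orth //; do 2 apply: deg_lt_iter_sphlap.
  rewrite (dotBl hg2 (L r0) (L _)) o1 subr0.
  rewrite (dot_iter_laplace_beltrami d_gt0 _ mu_gtN1 imu fs hf hg2) -hpK; last first.
    exact: deg_lt_iter_sphlap.
  by rewrite adj' dB o2 subr0.
Qed.

(** The polynomial p is the projection of f, and f - p is the sum of the gap of
    [projection_gap_bound] and of f - pK, which is arbitrarily small. *)
Lemma projection_estimate : exists2 C, 0 < C & forall f q0 r0 n,
  weakly_diff (2 * s) f -> L2 mu f ->
  L2 nu (iter s laplacian f) -> L2 mu (iter s laplace_beltrami f) ->
  (2 * s <= n)%N -> deg_lt (n - 2 * s).+1 q0 -> deg_lt n.+1 r0 ->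
  exists2 p, deg_lt n.+1 p & n%:R ^+ (2 * s) * nrm mu (fun x => f x - peval p x) <=
    C * (nrm nu (fun x => iter s laplacian f x - peval q0 x) +
         nrm mu (fun x => iter s laplace_beltrami f x - peval r0 x)).
Proof.
have [C0 C00 hC] := orth_bound mu_gtN1 bf d_ge2 (lexx mu) s_gt0.
exists (Num.sqrt C0); first by rewrite sqrtr_gt0.
move=> f q0 r0 n fs hf hg1 hg2 sn hq0 hr0.
have [p np hp] := projection n.+1 d_gt0 mu_gtN1 imu hf; exists p => //.
set a := nrm nu _; set b := nrm mu (fun x => iter s laplace_beltrami f x - _).
have n0 : 0 < n%:R ^+ (2 * s) :> R.
  by rewrite exprn_gt0 // ltr0n (leq_trans _ sn) // muln_gt0.
apply/ler_addgt0Pr => e e0.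
(* K is so large that pK costs at most e, after multiplication by n^(2s). *)
have [K0 hK0] := projection_density mu_gtN1 imu hf (divr_gt0 e0 n0).
pose K := maxn K0 n.+1.
have [pK KpK hpK] := projection K d_gt0 mu_gtN1 imu hf.
have nK : (n < K)%N by rewrite leq_maxr.
have gap := projection_gap_bound fs hf hg1 hg2 sn nK hq0 hr0 np KpK hp hpK.
have fK := hK0 K pK (leq_maxl _ _) KpK hpK.
have hK : deg_lt K (pK - p) by apply: deg_ltB => //; exact: deg_ltW nK.
have orth q : deg_lt n.+1 q -> dot mu (peval (pK - p) : E -> R) (peval q) = 0.
  move=> nq; have Kq := deg_ltW nq nK.
  rewrite -(subrr (dot mu f (peval q))) -{1}(hpK q Kq) -(hp q nq) -dotBl; try exact: L2_peval.
  by apply: eq_wint => x _; rewrite pevalB.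
have [gap1 gap2] := gap.
have bound := hC n K (pK - p) sn hK orth.
have {}bound : n%:R ^+ (2 * s) * nrm mu (peval (pK - p) : E -> R) <= Num.sqrt C0 * (a + b).
  apply: sum_sqr_bound gap1 gap2; [exact: ltW|exact: nrm_ge0|exact: nrm_ge0|exact: nrm_ge0|exact: ltW|].
  by rewrite nrm_sqr -exprM mulnAC.
have tri := nrmD (L2B hf (L2_peval pK imu)) (L2_peval (pK - p) imu).
have {}tri : nrm mu (fun x => f x - peval p x) <=
    nrm mu (fun x => f x - peval pK x) + nrm mu (peval (pK - p) : E -> R).
  apply: le_trans tri; rewrite ler_wsqrtr // le_eqVlt; apply/orP; left; apply/eqP.
  by apply: eq_wint => x _; rewrite pevalB; ring.
apply: (le_trans (ler_wpM2l (ltW n0) tri)); rewrite mulrDr addrC lerD //.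
by rewrite mulrC -ler_pdivlMr.
Qed.

End estimate.
End best_polynomials.

(** * The normalized norms and the theorem *)
Section weighted_norms.
Context {R : realType} {d : nat}.
Local Notation E := 'rV[R]_d.
Local Notation P := (mpoly d R).
Local Notation leb := (lebesgue_rV d).
Local Notation B := (unit_ball : set E).
Implicit Types (mu nu : R) (f g : E -> R) (p q : P) (n k s : nat).
Local Notation wc := (@weight_const R d).

Let mB : measurable B := measurable_unit_ball.

Lemma weight_constE nu : wc nu = (wint nu (cst 1 : E -> R))^-1.
Proof. by congr (_^-1); apply: eq_Rintegral => x _; rewrite mul1r. Qed.

Lemma weight_const_ge0 nu : 0 <= wc nu.
Proof. by rewrite weight_constE invr_ge0 wint_ge0. Qed.

(** A divergent integral has the real value 0, and so has its inverse. *)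
Lemma weight_int_const nu : wc nu != 0 -> @weight_int R d nu.
Proof.
move=> h; apply/integrableP; split.
  by apply/measurable_EFinP; exact: measurable_weight.
rewrite ltey; apply: contra_neq h => h.
rewrite /weight_const /Rintegral (_ : (\int[leb]_(x in B) (weight nu x)%:E)%E = +oo%E) ?invr0 //.
by rewrite -h; apply: eq_integral => x _; rewrite /= ger0_norm ?weight_ge0.
Qed.

(** The sum over j of the vanishing integrals of dstar (nu + 1) j x_j. *)
Lemma wint1_step nu : (0 < d)%N -> -1 < nu -> @weight_int R d nu ->
  (d%:R + 2 * (nu + 1)) * wint (nu + 1) (cst 1 : E -> R) =
  2 * (nu + 1) * wint nu (cst 1 : E -> R).
Proof.
move=> d_gt0 nu1 inu.
have i1 : @weight_int R d (nu + 1) by apply: weight_int_le inu => //; lra.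
have E1 : wint (nu + 1) (cst 1 : E -> R) = wint nu (fun x : E => 1 - sqnorm2 x).
  rewrite /wint. apply: eq_Rintegral => x; rewrite inE => Bx.
  by rewrite mul1r -weightS.
have w1 : wintegrable nu (cst 1 : E -> R) by exact/wintegrable1.
have wt : wintegrable nu (fun x : E => 1 - sqnorm2 x).
  rewrite (_ : (fun x => _) = peval (1 - rsq R d)); first exact: wintegrable_peval.
  by apply/funext => x; rewrite pevalB peval1 peval_rsq.
have : wint nu (fun x : E => (d%:R + 2 * (nu + 1)) * (1 - sqnorm2 x) + - (2 * (nu + 1)) * cst 1 x) = 0.
  rewrite -[RHS](_ : dot nu (peval (\sum_(j < d) dstar (nu + 1) j (xvar R j)) : E -> R) (peval 1) = 0).
    apply: eq_wint => x _; rewrite peval1 mulr1 pevalsum.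
    have dE j : peval (dstar (nu + 1) j (xvar R j)) x =
        (1 - sqnorm2 x) - 2 * (nu + 1) * x 0 j ^+ 2.
      by rewrite /dstar mderiv_xvar_diag pevalB !pevalM pevalB !peval1 peval_rsq pevalC !pevalX mulr1.
    under eq_bigr => j _ do rewrite dE.
    by rewrite sumrB sumr_const card_ord -mulr_sumr -/(sqnorm2 x) -mulr_natl /=; ring.
  rewrite dot_sum_l // big1 // => j _.
  rewrite -[RHS](wint_dstar d_gt0 j (xvar R j) nu1 inu).
  by apply: eq_wint => x _; rewrite peval1 mulr1.
rewrite wintD; [|exact: wintegrableZ|exact: wintegrableZ].
by rewrite (wintZ _ wt) (wintZ _ w1) -E1 mulNr => /eqP; rewrite subr_eq0 => /eqP.
Qed.

Lemma weight_const_gt0 mu k : (0 < d)%N -> -1 < mu -> 0 < wc mu -> 0 < wc (mu + k%:R).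
Proof.
move=> d_gt0 mu1 w0; have imu := weight_int_const (lt0r_neq0 w0).
elim: k => [|k IH]; first by rewrite addr0.
move: IH; rewrite !weight_constE !invr_gt0 -natr1 addrA => IH.
have k1 : -1 < mu + k%:R by rewrite (lt_le_trans mu1) // lerDl.
have ik : @weight_int R d (mu + k%:R) by apply: weight_int_le imu => //; rewrite lerDl.
have k2 : 0 < 2 * (mu + k%:R + 1) by lra.
have c0 : 0 < d%:R + 2 * (mu + k%:R + 1) by rewrite ltr_pwDr.
by rewrite -(pmulr_rgt0 _ c0) wint1_step // mulr_gt0.
Qed.

Lemma wnormE nu f : L2 nu f -> wnorm nu f = (Num.sqrt (wc nu) * nrm nu f)%:E.
Proof.
move=> [mf if_]; rewrite /wnorm.
rewrite (_ : (\int[leb]_(x in B) _)%E = (dot nu f f)%:E).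
  rewrite -EFinM poweR_EFin powR12_sqrt ?mulr_ge0 ?weight_const_ge0 ?dot_ge0 //.
  by rewrite sqrtrM ?weight_const_ge0.
rewrite /dot /wint /Rintegral fineK; last exact: (integrable_fin_num mB if_).
by apply: eq_integral => x _; rewrite -[f x * f x]expr2 real_normK ?num_real.
Qed.

Lemma wnorm_ge0 nu f : (0 <= wnorm nu f)%E.
Proof. exact: poweR_ge0. Qed.

Lemma wnorm_lty_L2 nu f : 0 < wc nu -> measurable_fun B f -> (wnorm nu f < +oo)%E -> L2 nu f.
Proof.
move=> w0 mf; rewrite /wnorm => /lty_poweRy h; split => //; apply/integrableP.
have mg : measurable_fun B (fun x => f x ^+ 2 * weight nu x).
  by apply: measurable_funM; [exact: measurable_funX|exact: measurable_weight].
split; first exact/measurable_EFinP.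
have {h} := h (_ : 2^-1 != 0); rewrite invr_eq0 pnatr_eq0 => /(_ isT).
rewrite (_ : (\int[leb]_(x in B) `|_|)%E = (\int[leb]_(x in B) (`|f x| ^+ 2 * weight nu x)%:E)%E).
  move=> h; rewrite ltNge leye_eq; apply/eqP => e; move: h.
  by rewrite e gt0_muley ?lte_fin.
apply: eq_integral => x _; rewrite /= real_normK ?num_real // ger0_norm //.
by rewrite mulr_ge0 ?sqr_ge0 ?weight_ge0.
Qed.

Lemma polys_deg_leP n f :
  polys_deg_le n f <-> exists2 p : P, deg_lt n.+1 p & f = peval p.
Proof.
split=> [[p hp <-]|[p hp ->]]; exists p => //; exact/deg_lt_msupp.
Qed.

Lemma best_approx_ge0 n nu f : (0 <= best_approx n nu f)%E.
Proof. by apply/ereal_infP => _ [q _ <-]; exact: wnorm_ge0. Qed.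

End weighted_norms.

(** The infimum of a sum over independent pairs is the sum of the infima. *)
Lemma lee_inf_sum (R : realType) (X c : R) (S T : set \bar R) : 0 < c ->
  (forall y, S y -> 0 <= y)%E -> (forall y, T y -> 0 <= y)%E ->
  (forall a b : R, S a%:E -> T b%:E -> X <= c * (a + b)) ->
  (X%:E <= c%:E * (ereal_inf S + ereal_inf T))%E.
Proof.
move=> c0 S0 T0 h.
have iS : (0 <= ereal_inf S)%E by apply/ereal_infP.
have iT : (0 <= ereal_inf T)%E by apply/ereal_infP.
have [Sy|Sf] := eqVneq (ereal_inf S) +oo%E.
  by rewrite Sy addye ?gt_eqF ?(lt_le_trans _ iT) // gt0_muley ?lte_fin // leey.
have [Ty|Tf] := eqVneq (ereal_inf T) +oo%E.
  by rewrite Ty addey ?gt_eqF ?(lt_le_trans _ iS) // gt0_muley ?lte_fin // leey.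
have fS : ereal_inf S \is a fin_num by rewrite ge0_fin_numE // ltey.
have fT : ereal_inf T \is a fin_num by rewrite ge0_fin_numE // ltey.
rewrite -(fineK fS) -(fineK fT) -EFinD -EFinM lee_fin.
apply/ler_addgt0Pr => e e0; have e2 : 0 < e / (2 * c) by rewrite divr_gt0 ?mulr_gt0.
have [a Sa] := lb_ereal_inf_adherent e2 fS; have [b Tb] := lb_ereal_inf_adherent e2 fT.
rewrite -(fineK fS) -(fineK fT) -!EFinD.
case: a Sa => [a| |] //; last by move=> /S0.
case: b Tb => [b| |] //; last by move=> /T0.
move=> Tb Sa; rewrite !lte_fin => hb ha; apply: (le_trans (h _ _ Sa Tb)).
have -> : e = c * (e / (2 * c) + e / (2 * c)) by field; rewrite gt_eqF.
rewrite -mulrDr ler_pM2l //; lra.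
Qed.

(** Here a and b are the square roots of the normalizing constants for the exponents
    mu and mu + 2s, which relate the integrals to the norms of the statement. *)
Lemma rescale_bound (R : realFieldType) (a b C N X A G : R) : 0 <= G ->
  N * X <= C * (A + G) -> 0 < a -> 0 < b -> 0 < C -> 0 < N -> 0 <= A ->
  a * X <= C * (a / b + 1) / N * (b * A + a * G).
Proof.
move=> G0 est a0 b0 C0 N0 A0.
have : X <= C * (A + G) / N by rewrite ler_pdivlMr // mulrC.
move=> /(ler_wpM2l (ltW a0)) /le_trans; apply.
have -> : C * (a / b + 1) / N * (b * A + a * G) =
    a * (C * (A + G) / N) + C / N * (b * A + a ^+ 2 / b * G).
  by field; rewrite !gt_eqF.
rewrite lerDl mulr_ge0 ?divr_ge0 ?(ltW C0) ?(ltW N0) //.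
by rewrite addr_ge0 // mulr_ge0 ?divr_ge0 ?sqr_ge0 ?(ltW b0).
Qed.

Theorem theorem1p1 (R : realType) (d : nat) (mu : R) (s : nat) :
  (2 <= d)%N -> -1 < mu -> (0 < s)%N ->
  exists2 c : R, 0 < c &
    forall f : 'rV[R]_d -> R, sobolev (2 * s)%N mu f ->
    forall n : nat, (2 * s <= n)%N ->
      (best_approx n mu f <=
       (c / n%:R ^+ (2 * s)%N)%:E *
       (best_approx (n - 2 * s)%N (mu + (2 * s)%N%:R) (iter s laplacian f) +
        best_approx n mu (iter s laplace_beltrami f)))%E.
Proof.
move=> d2 mu1 s0; have d0 : (0 < d)%N by exact: ltnW.
have [w0|w0] := eqVneq (@weight_const R d mu) 0.
  (* All norms for the exponent mu vanish. *)
  exists 1 => // f _ n sn; apply: (@le_trans _ _ 0%E); last first.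
    by rewrite mule_ge0 ?adde_ge0 ?best_approx_ge0 // lee_fin divr_ge0 ?exprn_ge0.
  apply: ge_ereal_inf; exists (wnorm mu (f \- peval 0)); last first.
    by rewrite /wnorm w0 mul0e poweR0r // invr_neq0.
  by exists (peval 0) => //; apply/polys_deg_leP; exists 0 => //; exact: deg_lt0.
have imu := weight_int_const w0.
have {}w0 : 0 < @weight_const R d mu by rewrite lt_neqAle eq_sym w0 weight_const_ge0.
set nu := mu + (2 * s)%:R.
have wn0 : 0 < @weight_const R d nu by exact: weight_const_gt0.
have inu : @weight_int R d nu by apply: weight_int_le imu => //; rewrite lerDl.
have [C C0 hC] := projection_estimate d2 mu1 s0 imu.
move: hC; rewrite -/nu => hC.
have [a aE] : {a : R | a = Num.sqrt (@weight_const R d mu)} by eexists.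
have [b bE] : {b : R | b = Num.sqrt (@weight_const R d nu)} by eexists.
have a0 : 0 < a by rewrite aE sqrtr_gt0.
have b0 : 0 < b by rewrite bE sqrtr_gt0.
have c0 : 0 < C * (a / b + 1) by apply: mulr_gt0 => //; apply: addr_gt0 => //; exact: divr_gt0.
exists (C * (a / b + 1)) => //.
move=> f [[mf ff] hf] n sn.
have Lf : L2 mu f by exact: wnorm_lty_L2.
have wf : weakly_diff (2 * s) f.
  by apply: sobolev_weakly_diff => m /hf[g hg _]; exists g.
have mg1 : measurable_fun unit_ball (iter s laplacian f : 'rV[R]_d -> R).
  have w : weakly_diff 0 (iter s laplacian f) by apply: (weakly_diff_iter_laplacian d0); rewrite addn0.
  by case: (weakly_diff_locint w).
have mg2 : measurable_fun unit_ball (iter s laplace_beltrami f : 'rV[R]_d -> R).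
  have w : weakly_diff 0 (iter s laplace_beltrami f) by apply: (weakly_diff_iter_laplace_beltrami d0); rewrite addn0.
  by case: (weakly_diff_locint w).
have n0 : 0 < n%:R ^+ (2 * s) :> R.
  by rewrite exprn_gt0 // ltr0n (leq_trans _ sn) // muln_gt0.
have le_wnorm (p : mpoly d R) : deg_lt n.+1 p -> (best_approx n mu f <= wnorm mu (f \- peval p)%R)%E.
  move=> hp; apply: ge_ereal_inf; exists (wnorm mu (f \- peval p)) => //.
  by exists (peval p) => //; apply/polys_deg_leP; exists p.
have Lfp (p : mpoly d R) : L2 mu (f \- peval p) by apply: L2B => //; exact: L2_peval.
(* Finiteness is what allows the real inequality of [lee_inf_sum]. *)
have fin : best_approx n mu f \is a fin_num.
  rewrite ge0_fin_numE ?best_approx_ge0 // (le_lt_trans (le_wnorm 0 (@deg_lt0 _ _ _))) //.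
  by rewrite wnormE // ltry.
have L2_finite tau (g : 'rV[R]_d -> R) (q : mpoly d R) x : 0 < @weight_const R d tau ->
    @weight_int R d tau -> measurable_fun unit_ball g ->
    wnorm tau (g \- peval q) = x%:E -> L2 tau (fun y => g y - peval q y) /\ L2 tau g.
  move=> wt it mg e; have h : L2 tau (fun y => g y - peval q y).
    have mh := measurable_funB mg (measurable_peval q).
    by apply: (wnorm_lty_L2 wt mh); rewrite e ltry.
  split => //; have := L2D h (L2_peval q it); congr (L2 _ _).
  by apply/funext => y; rewrite subrK.
rewrite -(fineK fin); apply: lee_inf_sum; first exact: divr_gt0.
- by move=> _ [q _ <-]; exact: wnorm_ge0.
- by move=> _ [q _ <-]; exact: wnorm_ge0.
move=> u v [_ /polys_deg_leP[q0 hq0 ->] eu] [_ /polys_deg_leP[r0 hr0 ->] ev].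
have [L1 Lg1] := L2_finite _ _ _ _ wn0 inu mg1 eu.
have [L2' Lg2] := L2_finite _ _ _ _ w0 imu mg2 ev.
have [p hp est] := hC f q0 r0 n wf Lf Lg1 Lg2 sn hq0 hr0.
have := le_wnorm p hp; rewrite -{1}(fineK fin) wnormE // lee_fin => /le_trans; apply.
have := wnormE L1; rewrite {}eu -bE => -[->]; have := wnormE L2'; rewrite {}ev -aE => -[->].
move: est a0 b0 C0 n0 (nrm_ge0 nu (fun x => iter s laplacian f x - peval q0 x)).
move: (nrm_ge0 mu (fun x => iter s laplace_beltrami f x - peval r0 x)).
exact: rescale_bound.
Qed.
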